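(* Let $\mathcal{G}_1=(\mathcal{E}_1,\mathcal{V}_1,m_1)$ and $\mathcal{G}_2=(\mathcal{E}_2,\mathcal{V}_2,m_2)$ be graphs with magnetic potentials $\theta_1,\theta_2$, and let $\mathcal{I}\subset\mathcal{V}_2$ be non-empty. Assume that $\mathcal{G}:=\mathcal{G}_1\times_{\mathcal{I}}\mathcal{G}_2$, with its product magnetic potential $\theta$, is a discrete cusp. If $\mathrm{Hol}_{\theta_2}=0$ (for instance if $\theta_2=0$), then the form-domain $\mathcal{D}(\Delta_{\mathcal{G},\theta}^{1/2})$ is the domain of $m_1^{-1/2}(\cdot)\otimes P^{\perp}_{\ker(\Delta_{\mathcal{G}_2,\theta_2})}$, where $P^{\perp}_{\ker(\Delta_{\mathcal{G}_2,\theta_2})}$ is the orthogonal projection onto $\ker(\Delta_{\mathcal{G}_2,\theta_2})^\perp$; in particular, the form-domain of $\Delta_{\mathcal{G},\theta}$ is not that of $\deg_{\mathcal{G}}(\cdot)$. One obtains: \[\mathcal{D}\big(\Delta_{\mathcal{G},\theta}^{1/2}\big)=\mathcal{D}\big(\deg_{\mathcal{G}}^{1/2}(\cdot)\big)\iff\mathrm{Hol}_{\theta_2}\neq0\iff\Delta_{\mathcal{G},\theta}\text{ has a compact resolvent}.\]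
   Context: A (weighted) graph is a triple $\mathcal{G}=(\mathcal{E},\mathcal{V},m)$ with $\mathcal{V}$ a countable set, $\mathcal{E}:\mathcal{V}\times\mathcal{V}\to[0,\infty)$ symmetric, and $m:\mathcal{V}\to(0,\infty)$. Write $x\sim y$ if $\mathcal{E}(x,y)>0$. All graphs are locally finite, connected, and without loops ($\mathcal{E}(x,x)=0$). $\ell^2(\mathcal{V},m)$ is the Hilbert space of $f:\mathcal{V}\to\mathbb{C}$ with $\sum_x m(x)|f(x)|^2<\infty$; $\mathcal{C}_c(\mathcal{V})$ denotes finitely supported functions. A magnetic potential is a map $\theta:\mathcal{V}\times\mathcal{V}\to\mathbb{R}/2\pi\mathbb{Z}$ with $\theta_{x,y}=-\theta_{y,x}$ and $\theta_{x,y}=0$ if $\mathcal{E}(x,y)=0$. The magnetic Laplacian $\Delta_{\mathcal{G},\theta}$ is the Friedrichs extension in $\ell^2(\mathcal{V},m)$ of $(\Delta_{\mathcal{G},\theta}f)(x)=\frac1{m(x)}\sum_{y}\mathcal{E}(x,y)(f(x)-e^{i\theta_{x,y}}f(y))$ on $\mathcal{C}_c(\mathcal{V})$; it is the non-negative self-adjoint operator associated with the closure of the form $Q_{\mathcal{G},\theta}(f)=\frac12\sum_{x,y}\mathcal{E}(x,y)|f(x)-e^{i\theta_{x,y}}f(y)|^2$ on $\mathcal{C}_c(\mathcal{V})$. The degree is $\deg_{\mathcal{G}}(x)=\frac1{m(x)}\sum_y\mathcal{E}(x,y)$; $\deg_{\mathcal{G}}(\cdot)$ is the multiplication operator, and $\mathcal{D}(\deg_{\mathcal{G}}^{1/2}(\cdot))=\{f\in\ell^2(\mathcal{V},m):\deg_{\mathcal{G}}^{1/2}f\in\ell^2(\mathcal{V},m)\}$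 is its form-domain. The holonomy of $\theta$ assigns to each cycle (closed walk) $(x_0,\dots,x_N=x_0)$ with $x_i\sim x_{i+1}$ the element $\theta_{x_0,x_1}+\dots+\theta_{x_{N-1},x_N}\in\mathbb{R}/2\pi\mathbb{Z}$; $\mathrm{Hol}_\theta=0$ means that this vanishes for every cycle, and $\mathrm{Hol}_\theta\ne0$ otherwise. Product through $\mathcal{I}$: given $\mathcal{G}_1,\mathcal{G}_2$, magnetic potentials $\theta_1,\theta_2$ and $\mathcal{I}\subset\mathcal{V}_2$, $\mathcal{G}_1\times_{\mathcal{I}}\mathcal{G}_2=(\mathcal{E},\mathcal{V},m)$ has $\mathcal{V}=\mathcal{V}_1\times\mathcal{V}_2$, $m(x,y)=m_1(x)m_2(y)$, $\mathcal{E}((x,y),(x',y'))=\mathcal{E}_1(x,x')\delta_{y,y'}1_{\mathcal{I}}(y)+\delta_{x,x'}\mathcal{E}_2(y,y')$, and $\theta((x,y),(x',y'))=\theta_1(x,x')\delta_{y,y'}+\delta_{x,x'}\theta_2(y,y')$ (values on non-edges play no role and are set to $0$). One identifies $\ell^2(\mathcal{V},m)\simeq\ell^2(\mathcal{V}_1,m_1)\otimes\ell^2(\mathcal{V}_2,m_2)$. $\mathcal{G}_1\times_{\mathcal{I}}\mathcal{G}_2$ is a discrete cusp if: (H1) $m_1(x)\to0$ as $|x|\to\infty$, where $|x|$ is the combinatorial graph distance in $\mathcal{G}_1$ from $x$ to a fixed vertex; (H2) $\mathcal{G}_2$ is finite; (H3) $\Delta_{\mathcal{G}_1,\theta_1}$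 is bounded (equivalently, $\sup_{x\in\mathcal{V}_1}\deg_{\mathcal{G}_1}(x)<\infty$). $\mathcal{D}(H)$ is the domain of $H$.
   Formalization: The equivalences and the ''in particular'' clause are stated for infinite $\mathcal{V}_1$, and those involving $\deg_{\mathcal{G}}$ also for $\mathcal{V}_2$ with at least two vertices; with finite $\mathcal{V}_1$ or one-point $\mathcal{V}_2$ they fail when $\mathrm{Hol}_{\theta_2}=0$. *)

(* Defs.v *)
From HB Require Import structures.
From mathcomp Require Import all_boot all_order all_algebra.
From mathcomp Require Import complex.
From mathcomp Require Import all_classical all_reals all_analysis.

Set Implicit Arguments.
Unset Strict Implicit.
Unset Printing Implicit Defensive.

Import Order.TTheory GRing.Theory Num.Theory.
Import numFieldNormedType.Exports.

Local Open Scope classical_set_scope.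
Local Open Scope ring_scope.

(* Sum of an absolutely summable family, as the difference of the sums of its
   positive and negative parts (real and imaginary parts for [csum]). *)
Definition rsum (R : realType) (V : choiceType) (F : V -> R) : R :=
  fine (\esum_(x in [set: V]) (Num.max (F x) 0)%:E) -
  fine (\esum_(x in [set: V]) (Num.max (- F x) 0)%:E).

Definition csum (R : realType) (V : choiceType) (F : V -> R[i]) : R[i] :=
  Complex (rsum (fun x => complex.Re (F x))) (rsum (fun x => complex.Im (F x))).

(* The Hilbert space l^2(V, m); the weights m considered are positive, so an
   element of it is a plain function. *)
Section L2.
Context {R : realType} {V : choiceType}.
Variable m : V -> R.
Implicit Types f g h : V -> R[i].

Definition l2sq f : \bar R :=
  \esum_(x in [set: V]) (m x * Normc.normc (f x) ^+ 2)%:E.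

Definition l2 : set (V -> R[i]) := [set f | (l2sq f < +oo)%E].

Definition l2norm f : R := Num.sqrt (fine (l2sq f)).

(* linear in the first argument *)
Definition inner f g : R[i] :=
  csum (fun x => (m x)%:C%C * f x * (g x)^*%C).

Definition l2cvg (u : nat -> V -> R[i]) f :=
  l2sq (u n \- f) @[n --> \oo] --> 0%E.

Definition orth (N : set (V -> R[i])) : set (V -> R[i]) :=
  [set g | l2 g /\ forall f, N f -> inner g f = 0].

End L2.

(* Unbounded operators, as graphs: [A (f, g)] means f \in D(A) and A f = g. *)
Definition op (R : realType) (V : Type) := set ((V -> R[i]) * (V -> R[i])).

Section Operators.
Context {R : realType} {V : choiceType}.
Variable m : V -> R.
Implicit Types (A B S : op R V) (f g h k : V -> R[i]).

Definition op_dom A : set (V -> R[i]) := [set f | exists g, A (f, g)].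

Definition op_ker A : set (V -> R[i]) := [set f | A (f, cst 0)].

Definition op_comp B A : op R V :=
  [set fh | exists g, A (fh.1, g) /\ B (g, fh.2)].

Definition op_bounded A :=
  exists C : R, forall f g, A (f, g) -> l2norm m g <= C * l2norm m f.

Definition densely_defined A :=
  op_dom A `<=` l2 m /\
  forall f, l2 m f ->
    exists u, (forall n, op_dom A (u n)) /\ l2cvg m u f.

Definition op_adjoint A : op R V :=
  [set hk | [/\ l2 m hk.1, l2 m hk.2 &
    forall f g, A (f, g) -> inner m g hk.1 = inner m f hk.2]].

(* An adjoint is a linear relation, and it is single-valued when A is densely
   defined: neither property has to be required separately. *)
Definition self_adjoint A := densely_defined A /\ A = op_adjoint A.

Definition op_nonneg A := forall f g, A (f, g) -> 0 <= inner m g f.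

Definition is_op_sqrt A S :=
  [/\ self_adjoint S, op_nonneg S & op_comp S S = A].

(* D(A^{1/2}), for A self-adjoint and non-negative *)
Definition sqrt_dom A : set (V -> R[i]) :=
  [set f | exists S, is_op_sqrt A S /\ op_dom S f].

Definition op_closure A : op R V :=
  [set fg | [/\ l2 m fg.1, l2 m fg.2 &
    exists u v, [/\ forall n, A (u n, v n), l2cvg m u fg.1 & l2cvg m v fg.2]]].

(* multiplication by w, on its maximal domain *)
Definition mult_op (w : V -> R) : op R V :=
  [set fg | [/\ l2 m fg.1, l2 m fg.2 &
    forall x, fg.2 x = (w x)%:C%C * fg.1 x]].

(* orthogonal projection onto the closed subspace M *)
Definition orth_proj (M : set (V -> R[i])) : op R V :=
  [set fg | [/\ l2 m fg.1, M fg.2 &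
    forall h, M h -> inner m (fg.1 \- fg.2) h = 0]].

(* the graph of (A - z)^{-1} *)
Definition resolvent A (z : R[i]) : op R V :=
  [set gf | exists h, A (gf.2, h) /\ forall x, gf.1 x = h x - z * gf.2 x].

Definition in_resolvent_set A (z : R[i]) :=
  (forall g, l2 m g -> exists! f, resolvent A z (g, f)) /\
  op_bounded (resolvent A z).

Definition compact_op A :=
  forall (u v : nat -> V -> R[i]) (C : R),
    (forall n, A (u n, v n)) ->
    (forall n, l2norm m (u n) <= C) ->
    exists (phi : nat -> nat) (f : V -> R[i]),
      [/\ {homo phi : i j / (i < j)%N}, l2 m f & l2cvg m (v \o phi) f].

Definition compact_resolvent A :=
  exists z, in_resolvent_set A z /\ compact_op (resolvent A z).

End Operators.

(* A (x) B on l^2(V1 * V2, m1 (x) m2): the closure of its restriction to the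
   algebraic tensor product D(A) (x) D(B). *)
Section Tensor.
Context {R : realType} {V1 V2 : choiceType}.
Variables (m1 : V1 -> R) (m2 : V2 -> R).

Definition alg_tensor (A : op R V1) (B : op R V2) : op R (V1 * V2)%type :=
  [set fg | exists (n : nat) (a a' : 'I_n -> V1 -> R[i])
                   (b b' : 'I_n -> V2 -> R[i]),
    [/\ forall i, A (a i, a' i), forall i, B (b i, b' i),
        forall p, fg.1 p = \sum_(i < n) a i p.1 * b i p.2 &
        forall p, fg.2 p = \sum_(i < n) a' i p.1 * b' i p.2]].

Definition op_tensor (A : op R V1) (B : op R V2) : op R (V1 * V2)%type :=
  op_closure (fun p => m1 p.1 * m2 p.2) (alg_tensor A B).

End Tensor.

Record wgraph (R : realType) (V : countType) := WGraph {
  edge : V -> V -> R;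
  weight : V -> R;
  edge_ge0 : forall x y, 0 <= edge x y;
  edge_sym : forall x y, edge x y = edge y x;
  weight_gt0 : forall x, 0 < weight x;
  edge_loopless : forall x, edge x x = 0;
  edge_locally_finite : forall x, finite_set [set y | 0 < edge x y];
  edge_connected : forall x y,
    exists p, path (fun a b => 0 < edge a b) x p /\ last x p = y
}.

Section Graphs.
Context {R : realType} {V : countType}.
Variable G : wgraph R V.

Definition adj : rel V := fun x y => 0 < edge G x y.

Definition walk_length (x y : V) : pred nat :=
  fun n => `[< exists p, [/\ path adj x p, last x p = y & size p = n] >].

Lemma walk_length_ex x y : exists n, walk_length x y n.
Proof.
have [p [px py]] := edge_connected G x y.
by exists (size p); apply/asboolP; exists p.
Qed.

Definition gdist (x y : V) : nat := ex_minn (walk_length_ex x y).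

(* the sum is finite by local finiteness *)
Definition deg (x : V) : R :=
  (weight G x)^-1 * \sum_(y \in [set: V]) edge G x y.

End Graphs.

(* Elements of R / 2 pi Z are represented by real numbers, compared with
   [eq2pi]. *)
Definition eq2pi (R : realType) (s t : R) :=
  exists k : int, s - t = k%:~R * (2 * pi).

Record potential (R : realType) (V : countType) (G : wgraph R V) := Potential {
  theta :> V -> V -> R;
  theta_antisym : forall x y, eq2pi (theta x y) (- theta y x);
  theta_nonedge : forall x y, edge G x y = 0 -> eq2pi (theta x y) 0
}.

Definition cexp (R : realType) (t : R) : R[i] := Complex (cos t) (sin t).

Section Laplacian.
Context {R : realType} {V : countType} {G : wgraph R V}.
Variable th : potential G.
Let m := weight G.
Implicit Types f g h : V -> R[i].

Definition holonomy (x : V) (p : seq V) : R := \sum_(t <- pairmap th x p) t.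

Definition hol_zero :=
  forall x p, path (adj G) x p -> last x p = x -> eq2pi (holonomy x p) 0.

Definition Cc : set (V -> R[i]) := [set f | finite_set [set x | f x != 0]].

(* The sesquilinear form polarizing Q_{G, theta}. It is only used on
   finitely supported functions, for which both sums are finite. *)
Definition formQ f h : R[i] :=
  2^-1 * \sum_(x \in [set: V]) \sum_(y \in [set: V])
    (edge G x y)%:C%C * (f x - cexp (th x y) * f y) *
    (h x - cexp (th x y) * h y)^*%C.

Definition form_approx (u : nat -> V -> R[i]) f :=
  [/\ forall n, Cc (u n), l2 m f, l2cvg m u f &
    forall eps : R, 0 < eps -> exists N : nat, forall n k : nat,
      (N <= n)%N -> (N <= k)%N ->
      complex.Re (formQ (u n \- u k) (u n \- u k)) < eps].

Definition form_dom : set (V -> R[i]) := [set f | exists u, form_approx u f].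

(* the value at (f, h) of the closure of the form is z *)
Definition form_closure f h (z : R[i]) :=
  exists u v, [/\ form_approx u f, form_approx v h &
    Normc.normc (formQ (u n) (v n) - z) @[n --> \oo] --> (0 : R)].

(* The Friedrichs extension: the operator associated with the closed form. *)
Definition laplacian : op R V :=
  [set fg | [/\ form_dom fg.1, l2 m fg.2 &
    forall h, form_dom h -> form_closure fg.1 h (inner m fg.2 h)]].

End Laplacian.

Section Product.
Context {R : realType} {V1 V2 : countType}.
Variables (G1 : wgraph R V1) (G2 : wgraph R V2) (I : set V2).
Hypothesis I0 : I !=set0.

Definition prod_weight (p : V1 * V2) : R := weight G1 p.1 * weight G2 p.2.

Definition prod_edge (p q : V1 * V2) : R :=
  edge G1 p.1 q.1 * (p.2 == q.2)%:R * (p.2 \in I)%:R +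
  (p.1 == q.1)%:R * edge G2 p.2 q.2.

Lemma prod_edge_ge0 p q : 0 <= prod_edge p q.
Proof. by rewrite addr_ge0 // !mulr_ge0 ?edge_ge0 ?ler0n. Qed.

Lemma prod_edge_sym p q : prod_edge p q = prod_edge q p.
Proof.
rewrite /prod_edge (edge_sym G1) (edge_sym G2) (eq_sym p.1).
by rewrite (eq_sym p.2); case: eqP => [->|_] //; rewrite !(mulr0, mul0r).
Qed.

Lemma prod_weight_gt0 p : 0 < prod_weight p.
Proof. by rewrite mulr_gt0 ?weight_gt0. Qed.

Lemma prod_edge_loopless p : prod_edge p p = 0.
Proof. by rewrite /prod_edge !edge_loopless !mul0r mulr0 addr0. Qed.

Lemma prod_edge_locally_finite p : finite_set [set q | 0 < prod_edge p q].
Proof.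
have F1 := edge_locally_finite G1 p.1; have F2 := edge_locally_finite G2 p.2.
apply: (@sub_finite_set _ _
  ((fun x => (x, p.2)) @` [set x | 0 < edge G1 p.1 x] `|`
   (fun y => (p.1, y)) @` [set y | 0 < edge G2 p.2 y])); last first.
  by rewrite finite_setU; split; apply: finite_image.
case=> x y /=; rewrite /prod_edge /=.
have := edge_ge0 G1 p.1 x; rewrite le_eqVlt => /orP[/eqP <-|E1].
  rewrite !mul0r add0r; case: (eqVneq p.1 x) => [<-|_]; rewrite ?mul0r ?ltxx//.
  by rewrite mul1r => E2; right; exists y.
case: (eqVneq p.2 y) => [<- _|_]; first by left; exists x.
rewrite mulr0 mul0r add0r.
case: (eqVneq p.1 x) => [<-|_]; rewrite ?mul0r ?ltxx// mul1r => E2.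
by right; exists y.
Qed.

Lemma prod_path1 (i : V2) (x : V1) (p : seq V1) : I i ->
  path (adj G1) x p ->
  path (fun a b => 0 < prod_edge a b) (x, i) [seq (z, i) | z <- p].
Proof.
move=> Ii; rewrite path_map; apply: sub_path => a b /= ab.
by rewrite /prod_edge /= eqxx mem_set// !mulr1 ltr_wpDr// mulr_ge0 ?edge_ge0.
Qed.

Lemma prod_path2 (x : V1) (y : V2) (p : seq V2) :
  path (adj G2) y p ->
  path (fun a b => 0 < prod_edge a b) (x, y) [seq (x, z) | z <- p].
Proof.
rewrite path_map; apply: sub_path => a b /= ab.
by rewrite /prod_edge /= edge_loopless !mul0r add0r eqxx mul1r.
Qed.

Lemma prod_edge_connected p q :
  exists s, path (fun a b => 0 < prod_edge a b) p s /\ last p s = q.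
Proof.
case: p q I0 => [x y] [x' y'] [i Ii].
have [s1 [p1 l1]] := edge_connected G2 y i.
have [s2 [p2 l2]] := edge_connected G1 x x'.
have [s3 [p3 l3]] := edge_connected G2 i y'.
exists ([seq (x, z) | z <- s1] ++ [seq (z, i) | z <- s2] ++
        [seq (x', z) | z <- s3]).
have e1 : last (x, y) [seq (x, z) | z <- s1] = (x, i).
  by rewrite (last_map (pair x)) l1.
have e2 : last (x, i) [seq (z, i) | z <- s2] = (x', i).
  by rewrite (last_map (pair^~ i)) l2.
rewrite !cat_path !last_cat e1 e2; split; last first.
  by rewrite (last_map (pair x')) l3.
by rewrite prod_path2// prod_path1// prod_path2.
Qed.

Definition prod_graph : wgraph R (V1 * V2)%type :=
  WGraph prod_edge_ge0 prod_edge_sym prod_weight_gt0 prod_edge_loopless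
    prod_edge_locally_finite prod_edge_connected.

Variables (th1 : potential G1) (th2 : potential G2).

Definition prod_theta (p q : V1 * V2) : R :=
  if 0 < prod_edge p q then
    th1 p.1 q.1 * (p.2 == q.2)%:R + (p.1 == q.1)%:R * th2 p.2 q.2
  else 0.

Lemma eq2pi_refl (t : R) : eq2pi t t.
Proof. by exists 0; rewrite subrr mul0r. Qed.

Lemma prod_theta_antisym p q :
  eq2pi (prod_theta p q) (- prod_theta q p).
Proof.
rewrite /prod_theta prod_edge_sym; case: ifP => _; last first.
  by rewrite oppr0; exact: eq2pi_refl.
rewrite (eq_sym q.1) (eq_sym q.2).
have [k1 E1] := theta_antisym th1 p.1 q.1.
have [k2 E2] := theta_antisym th2 p.2 q.2.
exists (k1 * (p.2 == q.2)%:R + k2 * (p.1 == q.1)%:R).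
rewrite rmorphD !rmorphM /= !rmorph_nat mulrDl.
rewrite ![_%:~R * _ * (2 * pi)]mulrAC -E1 -E2.
by case: eqP => _; case: eqP => _;
  rewrite ?(mulr0, mulr1, mul0r, mul1r, addr0, add0r, oppr0, subr0)// opprK;
  rewrite ?opprD ?opprK addrACA.
Qed.

Lemma prod_theta_nonedge p q :
  prod_edge p q = 0 -> eq2pi (prod_theta p q) 0.
Proof. by rewrite /prod_theta => ->; rewrite ltxx; exact: eq2pi_refl. Qed.

Definition prod_potential : potential prod_graph :=
  @Potential R _ prod_graph prod_theta prod_theta_antisym prod_theta_nonedge.

End Product.

(* m1(x) tends to 0 as |x| tends to infinity, |x| being the distance from the
   fixed vertex o; G2 is finite; the Laplacian of G1 is bounded. *)
Definition discrete_cusp (R : realType) (V1 V2 : countType)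
    (G1 : wgraph R V1) (th1 : potential G1) (o : V1) (G2 : wgraph R V2) :=
  [/\ forall eps : R, 0 < eps -> exists N : nat, forall x : V1,
        (N <= gdist G1 o x)%N -> weight G1 x < eps,
      finite_set [set: V2] &
      op_bounded (weight G1) (laplacian th1)].

(* Main.v *)
Require Import Defs.
From HB Require Import structures.
From mathcomp Require Import all_boot all_order all_algebra.
From mathcomp Require Import ring lra.
From mathcomp Require Import complex.
From mathcomp Require Import all_classical all_reals all_analysis.

Set Implicit Arguments.
Unset Strict Implicit.
Unset Printing Implicit Defensive.

Import Order.TTheory GRing.Theory Num.Theory.
Import numFieldNormedType.Exports.

Local Open Scope classical_set_scope.
Local Open Scope ring_scope.

(** The Laplacian of a graph is [d* d], where [d] is the closure of
    [f |-> f x - e^(i theta_xy) f y] on finitely supported functions. Positive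
    square roots [S] exist (as [Q T^(-1/2)], with [T = (1 + A)^-1] and
    [Q = (1 - T)^(1/2)]), and both [S] and [d] are closed operators [B] with
    [B* B = A], so that D(A) is a core of each and D(S) = D(d): the form domain.

    On a discrete cusp the horizontal part of the form is bounded, and the vertical
    part is the sum over [x] of the energies of the fibres [f (x, -)] in G2, in
    which the weight [m1 x] has cancelled. On the finite connected graph G2 the
    energy dominates the distance to the parallel sections, as one sees along
    paths. If the holonomy is non-zero there are none, and the form domain is
    the set of the [f] in l^2 with [sum |f|^2 < oo]: this is D(deg^(1/2)), and
    it embeds compactly because [m1] vanishes at infinity. If the holonomy is
    zero, there is a unimodular parallel section [phi]; then the energy is comparable to
    [|P f (x, -)|^2], where [P] projects onto the complement of [phi], and the functions
    [c (x) phi (y)] witness both the failure of compactness and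
    D(Delta^(1/2)) <> D(deg^(1/2)). *)

(** * Real Hilbert spaces *)

(** The analysis is done over the reals: [inner] is recovered from a real form tested against [g]
    and against ['i * g], and complex linearity becomes compatibility with multiplication by ['i].
    Unbounded operators are subspaces of a product space, so that surjectivity of [1 + A] comes from
    orthogonal projection onto a closed graph. The square root uses no spectral calculus: it is a
    monotone iteration on bounded operators. As [sqrt_dom] asks only for some square root, existence
    and independence of the root are both required; the description in [posop_form_dom], which
    mentions [A] only, settles the second. Energy estimates are proved on finite duplicate-free
    lists, where sums can be rearranged freely, and reach infinite sums as suprema. *)

Definition hnorm (R : realType) (H : lmodType R) (d : H -> H -> R) (x : H) : R :=
  Num.sqrt (d x x).

Definition hcvg (R : realType) (H : lmodType R) (d : H -> H -> R)
    (u : nat -> H) (l : H) :=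
  forall e : R, 0 < e -> exists N, forall n, (N <= n)%N -> hnorm d (u n - l) < e.

Definition hcauchy (R : realType) (H : lmodType R) (d : H -> H -> R)
    (u : nat -> H) :=
  forall e : R, 0 < e -> exists N, forall n k, (N <= n)%N -> (N <= k)%N ->
    hnorm d (u n - u k) < e.

(* Definiteness is not part of the structure: edge weights may vanish. *)
Record hilbert (R : realType) (H : lmodType R) := Hilbert {
  dot :> H -> H -> R;
  dotC : forall x y, dot x y = dot y x;
  dotDl : forall x y z, dot (x + y) z = dot x z + dot y z;
  dotZl : forall a x y, dot (a *: x) y = a * dot x y;
  dot_ge0 : forall x, 0 <= dot x x;
  dot_complete : forall u, hcauchy dot u -> exists l, hcvg dot u l
}.

Section HilbertTheory.
Context {R : realType} {H : lmodType R} (d : hilbert H).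
Implicit Types (x y z : H) (u v : nat -> H).

Local Notation "|[ x ]|" := (hnorm d x) (format "|[ x ]|").

Lemma dotDr x y z : d x (y + z) = d x y + d x z.
Proof. by rewrite dotC dotDl !(dotC _ x). Qed.

Lemma dotZr a x y : d x (a *: y) = a * d x y.
Proof. by rewrite dotC dotZl dotC. Qed.

Lemma dotNl x y : d (- x) y = - d x y.
Proof. by rewrite -scaleN1r dotZl mulN1r. Qed.

Lemma dotNr x y : d x (- y) = - d x y.
Proof. by rewrite dotC dotNl dotC. Qed.

Lemma dotBl x y z : d (x - y) z = d x z - d y z.
Proof. by rewrite dotDl dotNl. Qed.

Lemma dotBr x y z : d x (y - z) = d x y - d x z.
Proof. by rewrite dotDr dotNr. Qed.

Lemma dot0l x : d 0 x = 0.
Proof. by rewrite -(subrr x) dotBl subrr. Qed.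

Lemma dot0r x : d x 0 = 0. Proof. by rewrite dotC dot0l. Qed.

Definition dotE := (dotDl, dotDr, dotBl, dotBr, dotNl, dotNr, dotZl, dotZr).

Lemma hnorm_ge0 x : 0 <= |[x]|. Proof. exact: sqrtr_ge0. Qed.

Lemma hnorm0 : |[0]| = 0. Proof. by rewrite /hnorm dot0l sqrtr0. Qed.

Lemma sqr_hnorm x : |[x]| ^+ 2 = d x x.
Proof. by rewrite sqr_sqrtr// dot_ge0. Qed.

Lemma hnorm_le x (c : R) : 0 <= c -> (|[x]| <= c) = (d x x <= c ^+ 2).
Proof. by move=> c0; rewrite -sqr_hnorm ler_sqr// nnegrE hnorm_ge0. Qed.

Lemma hnorm_lt x (c : R) : 0 <= c -> (|[x]| < c) = (d x x < c ^+ 2).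
Proof. by move=> c0; rewrite -sqr_hnorm ltr_sqr// nnegrE hnorm_ge0. Qed.

Lemma hnormZ a x : |[a *: x]| = `|a| * |[x]|.
Proof.
by rewrite /hnorm !dotE mulrA -expr2 sqrtrM ?sqr_ge0// sqrtr_sqr.
Qed.

Lemma hnormN x : |[- x]| = |[x]|.
Proof. by rewrite -scaleN1r hnormZ normrN1 mul1r. Qed.

Lemma hnormB x y : |[x - y]| = |[y - x]|.
Proof. by rewrite -hnormN opprB. Qed.

Lemma dot_sqr_le x y : d x y ^+ 2 <= d x x * d y y.
Proof.
have P (t : R) : 0 <= d x x - 2 * t * d x y + t ^+ 2 * d y y.
  have := dot_ge0 d (x - t *: y).
  by rewrite !dotE (dotC d y x); congr (_ <= _); ring.
have [y0|y0] := eqVneq (d y y) 0.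
  rewrite y0 mulr0 -(subrr 0); have [->|n0] := eqVneq (d x y) 0.
    by rewrite expr0n subrr.
  (* This [t] would make the affine expression equal to -1. *)
  have := P ((d x x + 1) / (2 * d x y)); rewrite y0 mulr0 addr0.
  by rewrite [X in _ - X](_ : _ = d x x + 1) ?opprD ?addrA ?subrr; [lra|field].
have yp : 0 < d y y by rewrite lt_neqAle eq_sym y0 dot_ge0.
have := P (d x y / d y y).
rewrite [X in 0 <= X](_ : _ = d x x - d x y ^+ 2 / d y y); last by field.
by rewrite subr_ge0 ler_pdivrMr.
Qed.

Lemma dot_le x y : `|d x y| <= |[x]| * |[y]|.
Proof.
rewrite -ler_sqr ?nnegrE ?mulr_ge0 ?hnorm_ge0//.
by rewrite exprMn !sqr_hnorm real_normK ?num_real// dot_sqr_le.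
Qed.

Lemma hnormD x y : |[x + y]| <= |[x]| + |[y]|.
Proof.
rewrite hnorm_le ?addr_ge0 ?hnorm_ge0// sqrrD !sqr_hnorm !dotE (dotC d y x).
by have := dot_le x y; have := ler_norm (d x y); lra.
Qed.

Lemma hnorm_tri y x z : |[x - z]| <= |[x - y]| + |[y - z]|.
Proof. by have := hnormD (x - y) (y - z); rewrite addrA subrK. Qed.

Lemma parallelogram x y :
  d (x + y) (x + y) + d (x - y) (x - y) = 2 * d x x + 2 * d y y.
Proof. by rewrite !dotE (dotC d y x); ring. Qed.

Lemma hcvgD u v x y : hcvg d u x -> hcvg d v y -> hcvg d (u \+ v) (x + y).
Proof.
move=> ux vy e e0.
have [N1 h1] := ux (e / 2) (divr_gt0 e0 (ltr0Sn _ _)).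
have [N2 h2] := vy (e / 2) (divr_gt0 e0 (ltr0Sn _ _)).
exists (maxn N1 N2) => n; rewrite geq_max => /andP[/h1 a /h2 b].
rewrite /= opprD addrACA; apply: (le_lt_trans (hnormD _ _)); lra.
Qed.

Lemma hcvgZ a u x : hcvg d u x -> hcvg d (fun n => a *: u n) (a *: x).
Proof.
move=> ux e e0.
have a0 : 0 < `|a| + 1 by rewrite ltr_wpDl.
have [N h] := ux (e / (`|a| + 1)) (divr_gt0 e0 a0).
exists N => n /h; rewrite -scalerBr hnormZ ltr_pdivlMr// => k.
by apply: le_lt_trans k; have := hnorm_ge0 (u n - x); nra.
Qed.

Lemma hcvg_dot u x y (c : R) : hcvg d u x ->
  (forall e, 0 < e -> exists N, forall n, (N <= n)%N -> `|d (u n) y - c| < e) ->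
  d x y = c.
Proof.
move=> ux h; apply/eqP; rewrite -subr_eq0 -normr_le0; apply/ler_addgt0Pl => e e0.
have y0 : 0 < |[y]| + 1 by rewrite ltr_wpDl// hnorm_ge0.
have [N1 h1] := ux (e / 2 / (|[y]| + 1)) (divr_gt0 (divr_gt0 e0 (ltr0Sn _ _)) y0).
have [N2 h2] := h (e / 2) (divr_gt0 e0 (ltr0Sn _ _)).
have := h1 (maxn N1 N2) (leq_maxl _ _); have := h2 (maxn N1 N2) (leq_maxr _ _).
set n := maxn _ _ => b; rewrite ltr_pdivlMr// => a.
have := dot_le (u n - x) y; have := hnorm_ge0 (u n - x).
rewrite dotBl (distrC (d (u n) y) (d x y)) ?addr0 => s0 s1.
have s2 := ler_normD (d (u n) y - c) (d x y - d (u n) y).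
have e1 : d (u n) y - c + (d x y - d (u n) y) = d x y - c by ring.
rewrite e1 in s2; rewrite mulrDr mulr1 in a b; lra.
Qed.

Lemma hcvg_cauchy u x : hcvg d u x -> hcauchy d u.
Proof.
move=> ux e e0; have [N h] := ux (e / 2) (divr_gt0 e0 (ltr0Sn _ _)).
exists N => n k /h hn /h hk; apply: le_lt_trans (hnorm_tri x _ _) _.
by rewrite (hnormB x); lra.
Qed.

Lemma hcvg_hnorm_le u x (c : R) : hcvg d u x ->
  (forall e, 0 < e -> exists N, forall n, (N <= n)%N -> |[u n]| < c + e) ->
  |[x]| <= c.
Proof.
move=> ux h; apply/ler_addgt0Pr => e e0.
have [N1 h1] := ux (e / 2) (divr_gt0 e0 (ltr0Sn _ _)).
have [N2 h2] := h (e / 2) (divr_gt0 e0 (ltr0Sn _ _)).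
have := h1 (maxn N1 N2) (leq_maxl _ _); have := h2 (maxn N1 N2) (leq_maxr _ _).
set n := maxn _ _ => a b; have := hnormD (x - u n) (u n).
by rewrite subrK hnormB; lra.
Qed.

Definition subspace (M : set H) :=
  [/\ M 0, forall x y, M x -> M y -> M (x + y) & forall a x, M x -> M (a *: x)].

Definition hclosed (M : set H) :=
  forall u x, (forall n, M (u n)) -> hcvg d u x -> M x.

Definition hclosure (M : set H) : set H :=
  [set x | forall e, 0 < e -> exists2 y, M y & |[x - y]| < e].

Lemma hclosureP M x : hclosure M x ->
  exists u, (forall n, M (u n)) /\ hcvg d u x.
Proof.
move=> Mx.
have /choice[u hu] n : exists y, M y /\ |[x - y]| < n.+1%:R^-1.
  by have [|y My h] := Mx n.+1%:R^-1; [rewrite invr_gt0|exists y].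
exists u; split=> [n|e e0]; first by case: (hu n).
have [N hN] : exists N : nat, e^-1 < N%:R.
  by exists (Num.truncn e^-1).+1; exact: truncnS_gt.
exists N => n Nn; rewrite hnormB; have [_ /lt_trans->//] := hu n.
rewrite -[ltRHS]invrK ltf_pV2 ?posrE ?invr_gt0//.
by apply: lt_le_trans hN _; rewrite ler_nat (leq_trans Nn).
Qed.

Lemma hclosed_closure M : hclosed (hclosure M).
Proof.
move=> u x Mu ux e e0.
have [N h] := ux (e / 2) (divr_gt0 e0 (ltr0Sn _ _)).
have [y My yu] := Mu N (e / 2) (divr_gt0 e0 (ltr0Sn _ _)).
exists y => //; apply: le_lt_trans (hnorm_tri (u N) _ _) _.
by rewrite hnormB; have := h N (leqnn _); lra.
Qed.

Lemma sub_hclosure M : M `<=` hclosure M.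
Proof. by move=> x Mx e e0; exists x => //; rewrite subrr hnorm0. Qed.

Lemma hclosure_min M N : M `<=` N -> hclosed N -> hclosure M `<=` N.
Proof.
move=> MN cN x /hclosureP[u [Mu ux]]; apply: cN ux => n; exact/MN/Mu.
Qed.

Lemma subspace_closure M : subspace M -> subspace (hclosure M).
Proof.
move=> [M0 MD MZ]; split; first exact: sub_hclosure.
- move=> x y Mx My e e0.
  have [x' Mx' hx] := Mx (e / 2) (divr_gt0 e0 (ltr0Sn _ _)).
  have [y' My' hy] := My (e / 2) (divr_gt0 e0 (ltr0Sn _ _)).
  exists (x' + y'); first exact: MD.
  rewrite opprD addrACA; apply: le_lt_trans (hnormD _ _) _; lra.
- move=> a x Mx e e0.
  have a0 : 0 < `|a| + 1 by rewrite ltr_wpDl.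
  have [x' Mx' hx] := Mx (e / (`|a| + 1)) (divr_gt0 e0 a0).
  exists (a *: x'); first exact: MZ.
  move: hx; rewrite -scalerBr hnormZ ltr_pdivlMr// => k.
  by apply: le_lt_trans k; have := hnorm_ge0 (x - x'); nra.
Qed.

(** A minimising sequence is Cauchy by the parallelogram law. As [d] is only semi-definite, [p] need
    not be unique; its orthogonality property is all that is recorded. *)
Lemma projection M x : subspace M -> hclosed M ->
  exists2 p, M p & forall y, M y -> d (x - p) y = 0.
Proof.
move=> [M0 MD MZ] cM.
have MB y z : M y -> M z -> M (y - z).
  by move=> My Mz; apply: MD => //; rewrite -scaleN1r; exact: MZ.
pose D := [set |[x - y]| | y in M].
have D0 : D !=set0 by exists |[x - 0]|, 0.
have Dl : has_inf D by split=> //; exists 0 => _ [y _ <-]; exact: hnorm_ge0.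
pose b := inf D.
have bP y : M y -> b <= |[x - y]| by move=> My; apply: (inf_lbound Dl.2); exists y.
have b0 : 0 <= b by apply: lb_le_inf => // _ [y _ <-]; exact: hnorm_ge0.
have /choice[u hu] n : exists y, M y /\ |[x - y]| < b + n.+1%:R^-1.
  have [|_ [y My <-] h] := @inf_adherent R D n.+1%:R^-1 _ Dl; last by exists y.
  by rewrite invr_gt0.
have inv e : 0 < e -> exists N, forall n, (N <= n)%N -> n.+1%:R^-1 < e :> R.
  move=> e0; exists (Num.truncn e^-1).+1 => n Nn.
  rewrite -[ltRHS]invrK ltf_pV2 ?posrE ?invr_gt0//.
  apply: lt_le_trans (truncnS_gt _) _; rewrite ler_nat; exact: leq_trans Nn _.
have cu : hcauchy d u.
  (* [t] bounds the excess over the infimum [b]: the parallelogram law leaves at most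
     [4 (b + t)^2 - 4 b^2 = 8 b t + 4 t^2], which is below [e^2] since [t <= 1] and
     [t (8 b + 8) <= e^2]. *)
  move=> e e0; pose t := Num.min 1 (e ^+ 2 / (8 * b + 8)).
  have t1 : t <= 1 by rewrite ge_min lexx.
  have te : t * (8 * b + 8) <= e ^+ 2.
    by rewrite -ler_pdivlMr ?ge_min ?lexx ?orbT//; lra.
  have t0 : 0 < t by rewrite lt_min ltr01 divr_gt0 ?exprn_gt0//; lra.
  have [N hN] := inv t t0; exists N => n k /hN hn /hN hk.
  rewrite hnorm_lt ?ltW//.
  have [Mn /lt_trans/(_ (etrans (ltrD2l _ _ _) hn)) dn] := hu n.
  have [Mk /lt_trans/(_ (etrans (ltrD2l _ _ _) hk)) dk] := hu k.
  have := parallelogram (x - u n) (x - u k).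
  have -> : x - u n + (x - u k) = 2 *: (x - 2^-1 *: (u n + u k)).
    rewrite scalerBr scalerA mulfV ?pnatr_eq0// scale1r scaler_nat mulr2n.
    by rewrite opprD addrACA.
  have -> : x - u n - (x - u k) = - (u n - u k).
    by rewrite !opprB addrC addrA subrK.
  rewrite !dotNl !dotNr opprK dotZl dotZr -!sqr_hnorm.
  have := bP _ (MZ 2^-1 _ (MD _ _ Mn Mk)); set w := hnorm d (x - 2^-1 *: _).
  move=> bw; set wn := |[x - u n]| in dn *; set wk := |[x - u k]| in dk *.
  have wn0 : 0 <= wn by exact: hnorm_ge0.
  have wk0 : 0 <= wk by exact: hnorm_ge0.
  have e1 : wn ^+ 2 < (b + t) ^+ 2 by rewrite ltr_sqr ?nnegrE//; lra.
  have e2 : wk ^+ 2 < (b + t) ^+ 2 by rewrite ltr_sqr ?nnegrE//; lra.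
  have e3 : b ^+ 2 <= w ^+ 2 by rewrite ler_sqr ?nnegrE//; lra.
  by nra.
have [p up] := dot_complete cu.
have Mp : M p by apply: cM up => n; case: (hu n).
exists p => // y My.
have bp : |[x - p]| <= b.
  apply: (@hcvg_hnorm_le (fun n => x - u n)) => e e0.
    have [N h] := up e e0; exists N => n /h; rewrite hnormB.
    have -> // : x - u n - (x - p) = p - u n.
    by rewrite opprB addrC addrA subrK.
  have [N h] := inv e e0; exists N => n /h hn; apply: lt_trans (hu n).2 _.
    by rewrite ltrD2l.
have P (t : R) : 0 <= - 2 * t * d (x - p) y + t ^+ 2 * d y y.
  have := bP _ (MD _ _ Mp (MZ t _ My)); rewrite opprD addrA => /(le_trans bp).
  rewrite hnorm_le ?hnorm_ge0// sqr_hnorm; move: (x - p) => z.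
  by rewrite !dotE (dotC d y z); lra.
apply/eqP; rewrite -sqrf_eq0 eq_le sqr_ge0 andbT.
have y0 := dot_ge0 d y.
have y1 : d y y + 1 != 0 by rewrite gt_eqF//; lra.
(* The [+ 1] avoids dividing by a vanishing [d y y]; the value is still a negative multiple of
   [s^2]. *)
have := P (d (x - p) y / (d y y + 1)); set s := d (x - p) y.
rewrite [X in 0 <= X](_ : _ = - s ^+ 2 * ((d y y + 2) / (d y y + 1) ^+ 2)).
  rewrite mulNr oppr_ge0 pmulr_lle0// divr_gt0 ?exprn_gt0//; lra.
by field.
Qed.

End HilbertTheory.

(** * Square roots of [1 - X] for a symmetric contraction [X] *)

Section BoundedSqrt.
Context {R : realType} {H : lmodType R} (d : hilbert H).
Hypothesis d_def : forall x, d x x = 0 -> x = 0.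

Local Notation "|[ x ]|" := (hnorm d x) (format "|[ x ]|").

Definition hlinear (X : H -> H) :=
  (forall x y, X (x + y) = X x + X y) /\ (forall a x, X (a *: x) = a *: X x).

Definition hsym (X : H -> H) := forall x y, d (X x) y = d x (X y).

Definition contractive (X : H -> H) := forall x, |[X x]| <= |[x]|.

Lemma hlinearB X x y : hlinear X -> X (x - y) = X x - X y.
Proof. by case=> XD XZ; rewrite XD -scaleN1r XZ scaleN1r. Qed.

Lemma hlinear0 X : hlinear X -> X 0 = 0.
Proof. by move=> XL; have := hlinearB 0 0 XL; rewrite !subrr. Qed.

Lemma hnorm_eq0 x : |[x]| = 0 -> x = 0.
Proof. by move=> /(congr1 (fun t => t ^+ 2)); rewrite sqr_hnorm expr0n; exact: d_def. Qed.

Lemma hcvg_unique u x y : hcvg d u x -> hcvg d u y -> x = y.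
Proof.
move=> ux uy; apply/eqP; rewrite -subr_eq0; apply/eqP/hnorm_eq0/eqP.
rewrite eq_le hnorm_ge0 andbT; apply/ler_addgt0Pr => e e0; rewrite add0r.
have [N1 h1] := ux (e / 2) (divr_gt0 e0 (ltr0Sn _ _)).
have [N2 h2] := uy (e / 2) (divr_gt0 e0 (ltr0Sn _ _)).
have := h1 (maxn N1 N2) (leq_maxl _ _); have := h2 (maxn N1 N2) (leq_maxr _ _).
set n := maxn _ _ => a b; have := hnorm_tri d (u n) x y.
by rewrite (hnormB d x (u n)); lra.
Qed.

Variable X : H -> H.
Hypotheses (Xlin : hlinear X) (Xsym : hsym X) (Xcon : contractive X).

(** The limit [Y] solves [Y = (X + Y^2) / 2], that is [(1 - Y)^2 = 1 - X]. *)
Fixpoint sqrt_iter n (x : H) : H :=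
  if n is n'.+1 then 2^-1 *: (X x + sqrt_iter n' (sqrt_iter n' x)) else 0.

(* [sqrt_iter n] is a polynomial in [X] with non-negative coefficients, and
   [sqrt_bound n] is the value of that polynomial at 1. *)
Fixpoint sqrt_bound n : R :=
  if n is n'.+1 then 2^-1 * (1 + sqrt_bound n' ^+ 2) else 0.

Lemma sqrt_bound_bounds n :
  [/\ 0 <= sqrt_bound n, sqrt_bound n <= 1 & sqrt_bound n <= sqrt_bound n.+1].
Proof.
elim: n => [|n [a b c]]; first by split=> /=; lra.
have e k : sqrt_bound k.+1 = 2^-1 * (1 + sqrt_bound k ^+ 2) by [].
have d0 : 0 <= sqrt_bound n.+1 by apply: le_trans c.
split=> //; first by rewrite e; nra.
by rewrite [leLHS]e [leRHS]e ler_pM2l ?invr_gt0// lerD2l ler_sqr.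
Qed.

Lemma sqrt_iter_linear n : hlinear (sqrt_iter n).
Proof.
have [XD XZ] := Xlin.
elim: n => [|n [iD iZ]]; split=> /=.
- by move=> x y; rewrite addr0.
- by move=> a x; rewrite scaler0.
- by move=> x y; rewrite XD !iD -scalerDr addrACA.
- by move=> a x; rewrite XZ !iZ -scalerDr !scalerA mulrC.
Qed.

Lemma sqrt_iter_sym n : hsym (sqrt_iter n).
Proof.
elim: n => [|n IH] x y /=; first by rewrite dot0l dot0r.
by rewrite !dotE Xsym !IH.
Qed.

Lemma sqrt_iter_bound n x : |[sqrt_iter n x]| <= sqrt_bound n * |[x]|.
Proof.
elim: n x => [|n IH] x /=; first by rewrite hnorm0 mul0r.
rewrite hnormZ ger0_norm; last lra.
rewrite -mulrA ler_pM2l; last lra.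
apply: le_trans (hnormD _ _ _) _; rewrite mulrDl mul1r lerD// expr2 -mulrA.
have [a _ _] := sqrt_bound_bounds n.
by apply: le_trans (IH _) _; rewrite ler_wpM2l.
Qed.

Lemma sqrt_iter_con n : contractive (sqrt_iter n).
Proof.
move=> x; apply: le_trans (sqrt_iter_bound n x) _.
by have [_ b _] := sqrt_bound_bounds n; have := hnorm_ge0 d x; nra.
Qed.

(** The difference of consecutive iterates is again a polynomial in [X] with non-negative
    coefficients, so its norm is at most its value at 1. The induction uses
    [Y^2 - Z^2 = (Y - Z) Y + Z (Y - Z)]. *)
Lemma sqrt_iter_step n x :
  |[sqrt_iter n.+1 x - sqrt_iter n x]| <=
    (sqrt_bound n.+1 - sqrt_bound n) * |[x]|.
Proof.
elim: n x => [|n IH] x.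
  rewrite /= addr0 !subr0 hnormZ ger0_norm; last lra.
  by have := Xcon x; lra.
set Y := sqrt_iter n.+1; set Z := sqrt_iter n.
have -> : sqrt_iter n.+2 x - Y x =
    2^-1 *: ((Y (Y x) - Z (Y x)) + Z (Y x - Z x)).
  rewrite /Z (hlinearB _ _ (sqrt_iter_linear n)) -/Z addrA subrK.
  transitivity (2^-1 *: (X x + Y (Y x)) - 2^-1 *: (X x + Z (Z x))) => //.
  by rewrite -scalerBr opprD addrACA subrr add0r.
rewrite hnormZ ger0_norm; last lra.
apply: (@le_trans _ _ (2^-1 * ((sqrt_bound n.+1 - sqrt_bound n) *
    (sqrt_bound n.+1 * |[x]|) + sqrt_bound n *
    ((sqrt_bound n.+1 - sqrt_bound n) * |[x]|)))).
  rewrite ler_pM2l; last lra.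
  have [a0 _ an] := sqrt_bound_bounds n.
  apply: le_trans (hnormD _ _ _) _; apply: lerD.
    apply: le_trans (IH _) _; rewrite ler_wpM2l ?subr_ge0//.
    exact: sqrt_iter_bound.
  by apply: le_trans (sqrt_iter_bound _ _) _; rewrite ler_wpM2l.
rewrite [leRHS](_ : _ = 2^-1 * (1 + sqrt_bound n.+1 ^+ 2) * |[x]| -
  2^-1 * (1 + sqrt_bound n ^+ 2) * |[x]|); last by rewrite -mulrBl.
by rewrite le_eqVlt; apply/orP; left; apply/eqP; ring.
Qed.

Lemma sqrt_iter_dist n k x : (n <= k)%N ->
  |[sqrt_iter k x - sqrt_iter n x]| <= (sqrt_bound k - sqrt_bound n) * |[x]|.
Proof.
move=> /subnK <-; elim: (k - n)%N => [|j IH].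
  by rewrite add0n !subrr mul0r hnorm0.
apply: le_trans (hnorm_tri d (sqrt_iter (j + n) x) _ _) _.
by rewrite addSn; have := sqrt_iter_step (j + n) x; lra.
Qed.

(** The bounds increase and stay below 1, so their increments beyond some index are small by the
    supremum property, without any rate. *)
Lemma sqrt_iter_cauchy x : hcauchy d (sqrt_iter^~ x).
Proof.
pose D := range sqrt_bound.
have Ds : has_sup D.
  split; first by exists (sqrt_bound 0), 0%N.
  by exists 1 => _ [n _ <-]; have [] := sqrt_bound_bounds n.
have mono n k : (n <= k)%N -> sqrt_bound n <= sqrt_bound k.
  move=> /subnK <-; elim: (k - n)%N => [|j IH] //.
  by apply: le_trans IH _; have [] := sqrt_bound_bounds (j + n).
move=> e e0; have x0 := hnorm_ge0 d x.
have x1 : 0 < |[x]| + 1 by lra.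
have [_ [N _ <-] hN] := sup_adherent (divr_gt0 e0 x1) Ds.
have key n k : (N <= n)%N -> (n <= k)%N ->
    |[sqrt_iter k x - sqrt_iter n x]| < e.
  move=> Nn nk; apply: le_lt_trans (sqrt_iter_dist x nk) _.
  have : sqrt_bound k <= sup D by apply: (ub_le_sup Ds.2); exists k.
  have := mono _ _ Nn; have := mono _ _ nk => a b c.
  have : sqrt_bound k - sqrt_bound n < e / (|[x]| + 1) by lra.
  by rewrite ltr_pdivlMr//; nra.
exists N => n k Nn Nk; case: (leqP n k) => nk; last exact/key/ltnW.
by rewrite hnormB; exact: key.
Qed.

(** [1 - Y] is the square root of [1 - X]. The last clause makes it commute with every bounded
    operator that commutes with [X], which later lets several roots be multiplied. *)
Lemma bounded_sqrt : exists Y : H -> H,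
  [/\ hlinear Y, hsym Y, contractive Y,
      forall x, x - Y x - Y (x - Y x) = x - X x &
      forall Z : H -> H, hlinear Z ->
        (exists c, forall x, |[Z x]| <= c * |[x]|) ->
        (forall x, Z (X x) = X (Z x)) -> forall x, Z (Y x) = Y (Z x)].
Proof.
have /choice[Y hY] x : exists l, hcvg d (sqrt_iter^~ x) l.
  exact/dot_complete/sqrt_iter_cauchy.
have Ylin : hlinear Y.
  split=> [x y|a x].
    apply: hcvg_unique (hY _) _.
    rewrite (_ : sqrt_iter^~ (x + y) = sqrt_iter^~ x \+ sqrt_iter^~ y).
      exact: hcvgD.
    by apply/funext => n; rewrite (sqrt_iter_linear n).1.
  apply: hcvg_unique (hY _) _.
  rewrite (_ : sqrt_iter^~ (a *: x) = (fun n => a *: sqrt_iter n x)).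
    exact: hcvgZ.
  by apply/funext => n; rewrite (sqrt_iter_linear n).2.
have Ycon : contractive Y.
  move=> x; apply: (hcvg_hnorm_le (hY x)) => e e0; exists 0%N => n _.
  by have := sqrt_iter_con n x; lra.
have Ysym : hsym Y.
  move=> x y; apply: (hcvg_dot (hY x)) => e e0.
  have x1 : 0 < |[x]| + 1 by have := hnorm_ge0 d x; lra.
  have [N h] := hY y _ (divr_gt0 e0 x1); exists N => n /h.
  rewrite ltr_pdivlMr// => k; rewrite sqrt_iter_sym -dotBr.
  apply: le_lt_trans (dot_le d _ _) _.
  by have := hnorm_ge0 d x; have := hnorm_ge0 d (sqrt_iter n y - Y y); nra.
have YY x : Y x = 2^-1 *: (X x + Y (Y x)).
  have shift : hcvg d (fun n => sqrt_iter n.+1 x) (Y x).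
    by move=> e e0; have [N h] := hY x e e0; exists N => n Nn; apply/h/leqW.
  apply: (hcvg_unique shift) => /=; apply: hcvgZ.
  apply: (@hcvgD _ _ _ (fun=> X x)) => e e0.
    by exists 0%N => n _; rewrite subrr hnorm0.
  have [N1 h1] := hY x _ (divr_gt0 e0 (ltr0Sn _ 1)).
  have [N2 h2] := hY (Y x) _ (divr_gt0 e0 (ltr0Sn _ 1)).
  exists (maxn N1 N2) => n; rewrite geq_max => /andP[/h1 a /h2 b].
  apply: le_lt_trans (hnorm_tri d (sqrt_iter n (Y x)) _ _) _.
  rewrite -(hlinearB _ _ (sqrt_iter_linear n)).
  by have := sqrt_iter_con n (sqrt_iter n x - Y x); lra.
exists Y; split=> // [x|Z Zlin [c Zc] ZX x].
  rewrite (hlinearB _ _ Ylin); have := YY x; move: (Y (Y x)) => z e.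
  have -> : z = 2 *: Y x - X x.
    by rewrite {1}e scalerA mulfV ?pnatr_eq0// scale1r addrAC subrr add0r.
  rewrite scaler_nat mulr2n; move: (Y x) (X x) => b c.
  by rewrite opprB [b + b - c - b]addrAC addrK addrA subrK.
have ZYn n y : Z (sqrt_iter n y) = sqrt_iter n (Z y).
  elim: n y => [|n IH] y /=; first by rewrite -(scale0r 0) Zlin.2 !scale0r.
  by rewrite Zlin.2 Zlin.1 ZX !IH.
apply: hcvg_unique (hY (Z x)) => e e0.
have c1 : 0 < `|c| + 1 by have := normr_ge0 c; lra.
have [N h] := hY x _ (divr_gt0 e0 c1); exists N => n /h.
rewrite ltr_pdivlMr// => k; rewrite -ZYn -(hlinearB _ _ Zlin).
apply: le_lt_trans (Zc _) _.
by have := ler_norm c; have := hnorm_ge0 d (sqrt_iter n x - Y x); nra.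
Qed.

End BoundedSqrt.

Section ProdHilbert.
Context {R : realType} {H K : lmodType R} (d : hilbert H) (k : hilbert K).

(** Its norm is the graph norm: a closed operator from [H] to [K] is a closed subspace for it. *)
Definition prod_dot (x y : H * K) : R := d x.1 y.1 + k x.2 y.2.

Lemma prod_dot_ge0 x : 0 <= prod_dot x x.
Proof. by rewrite addr_ge0 ?dot_ge0. Qed.

Lemma prod_hnorm_ge x :
  hnorm d x.1 <= hnorm prod_dot x /\ hnorm k x.2 <= hnorm prod_dot x.
Proof.
by split; rewrite ler_sqrt ?prod_dot_ge0// ?lerDl ?lerDr dot_ge0.
Qed.

Lemma prod_hnorm_le x : hnorm prod_dot x <= hnorm d x.1 + hnorm k x.2.
Proof.
have a := hnorm_ge0 d x.1; have b := hnorm_ge0 k x.2.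
rewrite -ler_sqr ?nnegrE ?sqrtr_ge0 ?addr_ge0//.
by rewrite sqr_sqrtr ?prod_dot_ge0// /prod_dot -!sqr_hnorm; nra.
Qed.

Lemma prod_hcvg (u : nat -> H * K) l : hcvg prod_dot u l ->
  hcvg d (fun n => (u n).1) l.1 /\ hcvg k (fun n => (u n).2) l.2.
Proof.
move=> ul; split=> e e0; have [N h] := ul e e0; exists N => n /h;
by apply: le_lt_trans; have [] := prod_hnorm_ge (u n - l).
Qed.

Lemma prod_complete (u : nat -> H * K) : hcauchy prod_dot u ->
  exists l, hcvg prod_dot u l.
Proof.
move=> cu.
have [l1 h1] : exists l, hcvg d (fun n => (u n).1) l.
  apply: dot_complete => e e0; have [N h] := cu e e0; exists N => n j Nn Nj.
  by apply: le_lt_trans (h _ _ Nn Nj); have [] := prod_hnorm_ge (u n - u j).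
have [l2 h2] : exists l, hcvg k (fun n => (u n).2) l.
  apply: dot_complete => e e0; have [N h] := cu e e0; exists N => n j Nn Nj.
  by apply: le_lt_trans (h _ _ Nn Nj); have [] := prod_hnorm_ge (u n - u j).
exists (l1, l2) => e e0.
have [N1 k1] := h1 _ (divr_gt0 e0 (ltr0Sn _ 1)).
have [N2 k2] := h2 _ (divr_gt0 e0 (ltr0Sn _ 1)).
exists (maxn N1 N2) => n; rewrite geq_max => /andP[/k1 a /k2 b].
by apply: le_lt_trans (prod_hnorm_le _) _ => /=; lra.
Qed.

(** Transparent, because later steps read off identities between the components by conversion. *)
Definition prod_hilbert : hilbert (H * K)%type.
Proof.
apply: (@Hilbert _ _ prod_dot _ _ _ prod_dot_ge0 prod_complete).
- by move=> x y; rewrite /prod_dot dotC [in X in _ + X]dotC.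
- by move=> x y z; rewrite /prod_dot !dotDl addrACA.
- by move=> a x y; rewrite /prod_dot !dotZl mulrDr.
Defined.

End ProdHilbert.

Arguments prod_hilbert {R H K} d k : simpl never.

(** * Non-negative self-adjoint relations and their form domains *)

Section PositiveRelation.
Context {R : realType} {H : lmodType R} (d : hilbert H).
Hypothesis d_def : forall x, d x x = 0 -> x = 0.

Local Notation "|[ x ]|" := (hnorm d x) (format "|[ x ]|").

(* Self-adjointness is encoded by [posop_range]: a non-negative symmetric
   operator is self-adjoint when [1 + A] is onto. *)
Record positive_op (A : set (H * H)) : Prop := PositiveOp {
  posop_subspace : subspace A;
  posop_sym : forall f g f' g', A (f, g) -> A (f', g') -> d g f' = d f g';
  posop_ge0 : forall f g, A (f, g) -> 0 <= d g f;
  posop_range : forall u, exists f g, A (f, g) /\ u = f + g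
}.

Variable A : set (H * H).
Hypothesis pA : positive_op A.

Let AD f g f' g' : A (f, g) -> A (f', g') -> A (f + f', g + g').
Proof. by have [_ AD _] := posop_subspace pA; move=> a b; exact: AD a b. Qed.

Let AZ a f g : A (f, g) -> A (a *: f, a *: g).
Proof. by have [_ _ AZ] := posop_subspace pA; move=> h; exact: AZ a _ h. Qed.

Let AB f g f' g' : A (f, g) -> A (f', g') -> A (f - f', g - g').
Proof. by move=> a b; rewrite -(scaleN1r f') -(scaleN1r g'); apply: AD => //; exact: AZ. Qed.

(** The cross term in the square of [|[f + g]|] is non-negative; hence [(1 + A)^-1] and
    [A (1 + A)^-1] are contractions. *)
Lemma posop_bound f g : A (f, g) -> |[f]| <= |[f + g]| /\ |[g]| <= |[f + g]|.
Proof.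
move=> /(posop_ge0 pA) h; split; rewrite hnorm_le ?hnorm_ge0// sqr_hnorm !dotE;
by rewrite (dotC d f g); have := dot_ge0 d f; have := dot_ge0 d g; lra.
Qed.

Lemma posop_inj f g f' g' : A (f, g) -> A (f', g') -> f + g = f' + g' -> f = f'.
Proof.
move=> h h' e; apply/eqP; rewrite -subr_eq0; apply/eqP/(hnorm_eq0 d_def)/eqP.
have e0 : f - f' + (g - g') = 0 by rewrite addrACA -opprD e subrr.
have [+ _] := posop_bound (AB h h').
by rewrite e0 hnorm0 eq_le hnorm_ge0 andbT.
Qed.

(* With [T = (1 + A)^-1], [Rr] and [Q] are the square roots of [T] and
   [1 - T], so that [A] is [Q^2 Rr^-2]. *)
Lemma posop_sqrt (J : H -> H) : hlinear J ->
  (exists c, forall x, |[J x]| <= c * |[x]|) ->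
  (forall f g, A (f, g) -> A (J f, J g)) ->
  exists Rr Q : H -> H,
  [/\ hlinear Rr /\ hlinear Q, hsym d Rr /\ hsym d Q,
      (forall x, Rr (Q x) = Q (Rr x)) /\ (forall x, 0 <= d (Rr (Q x)) x),
      (forall x, Rr (J x) = J (Rr x)) /\ (forall x, Q (J x) = J (Q x)) &
      (forall x, Rr (Rr x) + Q (Q x) = x) /\
      (forall f g, A (f, g) <-> f = Rr (Rr (f + g)))].
Proof.
move=> Jlin Jb AJ.
have /choice[T hT] u : exists f, A (f, u - f).
  by have [f [g [h ->]]] := posop_range pA u; exists f; rewrite addrAC subrr add0r.
have TE f g : A (f, g) -> f = T (f + g).
  by move=> h; apply: (posop_inj h (hT _)); rewrite subrKC.
have AE f g : A (f, g) <-> f = T (f + g).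
  split; first exact: TE.
  by move=> e; have := hT (f + g); rewrite -e addrAC subrr add0r.
have Tlin : hlinear T.
  split=> [x y|a x]; symmetry.
    rewrite (_ : x + y = (T x + T y) + ((x - T x) + (y - T y))).
      by apply: TE; exact: AD.
    by rewrite addrACA !subrKC.
  rewrite (_ : a *: x = a *: T x + a *: (x - T x)).
    by apply: TE; exact: AZ.
  by rewrite -scalerDr subrKC.
have Tsym : hsym d T.
  move=> x y; have := posop_sym pA (hT x) (hT y).
  rewrite !dotBl !dotBr (dotC d (T x) (T y)) => e.
  by rewrite -(dotC d (T y)) in e *; move: e; rewrite (dotC d (T y) (T x)); lra.
have TJ x : T (J x) = J (T x).
  by symmetry; rewrite {2}(_ : x = T x + (x - T x));
    [rewrite Jlin.1; apply: TE; exact: AJ|rewrite subrKC].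
have Tb x : |[T x]| <= |[x]|.
  by have [h _] := posop_bound (hT x); rewrite subrKC in h.
pose X x := x - T x.
have Xcon : contractive d X.
  by move=> x; have [_ h] := posop_bound (hT x); rewrite subrKC in h.
have lin1 (Z : H -> H) : hlinear Z -> hlinear (fun x => x - Z x).
  move=> [ZD ZZ]; split=> [x y|a x]; first by rewrite ZD opprD addrACA.
  by rewrite ZZ scalerBr.
have sym1 (Z : H -> H) : hsym d Z -> hsym d (fun x => x - Z x).
  by move=> Zs x y; rewrite dotBl dotBr Zs.
have commB (Z Z' : H -> H) : hlinear Z -> hlinear Z' ->
    (forall x, Z (Z' x) = Z' (Z x)) ->
    forall x, x - Z' x - Z (x - Z' x) = x - Z x - Z' (x - Z x).
  move=> Zl Zl' ZZ' x; rewrite (hlinearB _ _ Zl) (hlinearB _ _ Zl') ZZ'.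
  by rewrite !opprD !opprK !addrA; congr (_ + _); exact: addrAC.
have con1 (Z : H -> H) : contractive d Z -> exists c, forall x, |[Z x]| <= c * |[x]|.
  by move=> h; exists 1 => x; rewrite mul1r.
(* Each call extracts the root of 1 minus its input: [1 - Y] is the root of [T], [1 - W] the root of
   [1 - T], and [1 - Z] the root of [1 - Y], that is the fourth root of [T]. *)
have [Y [Ylin Ysym Ycon YX Ycomm]] :=
  bounded_sqrt d_def (lin1 _ Tlin) (sym1 _ Tsym) Xcon.
have [W [Wlin Wsym Wcon WT Wcomm]] := bounded_sqrt d_def Tlin Tsym Tb.
have [Z [Zlin Zsym Zcon ZY Zcomm]] := bounded_sqrt d_def Ylin Ysym Ycon.
pose Rr x := x - Y x; pose Q x := x - W x; pose P x := x - Z x.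
have TX x : T (X x) = X (T x) by rewrite /X (hlinearB _ _ Tlin).
have TY x : T (Y x) = Y (T x) by apply: Ycomm => //; exact: con1.
have YW x : Y (W x) = W (Y x) by apply: Wcomm => //; exact: con1.
have WY x : W (Y x) = Y (W x) by rewrite YW.
have WZ x : W (Z x) = Z (W x) by apply: Zcomm => //; exact: con1.
have JX x : J (X x) = X (J x) by rewrite /X (hlinearB _ _ Jlin) TJ.
have JY x : J (Y x) = Y (J x) by exact: Ycomm.
have JW x : J (W x) = W (J x) by exact: Wcomm.
have RR x : Rr (Rr x) = T x by rewrite /Rr YX opprB addrC subrK.
have QQ x : Q (Q x) = X x by exact: WT.
exists Rr, Q; split.
- by split; exact: lin1.
- by split; exact: sym1.
- split=> x; first exact: commB.
  (* The fourth root makes positivity visible: [Rr Q = P Q P], and [Q = 1 - W] is non-negative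
     because [W] is a contraction. *)
  have PP y : P (P y) = Rr y by exact: ZY.
  have PQ y : P (Q y) = Q (P y) by symmetry; exact: commB.
  rewrite -PP PQ (sym1 _ Zsym) -/P -/(P x).
  have := Wcon (P x); move: (P x) => y.
  rewrite hnorm_le ?hnorm_ge0// sqr_hnorm => h.
  rewrite /Q dotBl subr_ge0; apply: le_trans (ler_norm _) _.
  apply: le_trans (dot_le _ _ _) _; rewrite -sqr_hnorm expr2.
  by rewrite ler_wpM2r ?hnorm_ge0.
- by split=> x; rewrite /Rr /Q (hlinearB _ _ Jlin) ?JY ?JW.
- split=> [x|f g]; first by rewrite RR QQ /X addrC subrK.
  by rewrite RR; exact: AE.
Qed.

(* [A = B* B] for a closed operator [B]: then D(A) is a core of [B], which
   determines D(B) by [A] alone. *)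
Lemma posop_form_dom (K : lmodType R) (k : hilbert K) (B : set (H * K))
    (BS : subspace B) :
  (forall u v x y, (forall n, B (u n, v n)) -> hcvg d u x -> hcvg k v y ->
    B (x, y)) ->
  (forall f g, A (f, g) -> exists2 b, B (f, b) &
     forall f' b', B (f', b') -> d g f' = k b b') ->
  forall f, (exists b, B (f, b)) <-> exists u g,
    [/\ forall n, A (u n, g n), hcvg d u f &
     forall e : R, 0 < e -> exists N, forall n j, (N <= n)%N -> (N <= j)%N ->
       d (g n - g j) (u n - u j) < e].
Proof.
move=> Bclosed AB' f; split; last first.
  move=> [u [g [Aug uf gu]]].
  have /choice[b hb] n : exists b, B (u n, b) /\
      forall f' b', B (f', b') -> d (g n) f' = k b b'.
    by have [b Bb h] := AB' _ _ (Aug n); exists b.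
  (* [d (g n - g j) (u n - u j)] is the squared [k]-norm of [b n - b j], so the form-Cauchy
     condition says that [b] is Cauchy. *)
  have bc : hcauchy k b.
    move=> e e0; have [N hN] := gu _ (exprn_gt0 2 e0).
    exists N => n j Nn Nj; rewrite hnorm_lt ?ltW//.
    have [Bn hn] := hb n; have [Bj hj] := hb j.
    have Bnj : B (u n - u j, b n - b j).
      have [_ BD BZ] := BS; rewrite -(scaleN1r (u j)) -(scaleN1r (b j)).
      exact: BD _ _ Bn (BZ _ _ Bj).
    by rewrite dotBl -(hn _ _ Bnj) -(hj _ _ Bnj) -dotBl; exact: hN.
  have [b0 bb0] := dot_complete bc.
  by exists b0; apply: Bclosed uf bb0 => n; case: (hb n).
move=> [b Bfb].
(* The restriction of [B] to D(A), together with its link to [A]; the aim is that [f] is the first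
   component of a point of its closure. *)
pose M0 : set (H * K) := [set z | exists g, [/\ A (z.1, g), B z &
  forall f' b', B (f', b') -> d g f' = k z.2 b']].
have [B0 BD BZ] := BS.
have M0S : subspace M0.
  have [A0 _ _] := posop_subspace pA.
  split=> [ | [x1 y1] [x2 y2] [g1 [ /= A1 B1 h1]] [g2 [ /= A2 B2 h2]]
           | a [x1 y1] [g1 [ /= A1 B1 h1]]].
  - by exists 0; split=> // f' b' _; rewrite !dot0l.
  - exists (g1 + g2); split=> /=; [exact: AD|exact: BD B1 B2|].
    by move=> f' b' h; rewrite !dotDl (h1 _ _ h) (h2 _ _ h).
  - exists (a *: g1); split=> /=; [exact: AZ|exact: BZ B1|].
    by move=> f' b' h; rewrite !dotZl (h1 _ _ h).
pose D := prod_hilbert d k.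
have [[p1 p2] Mp hp] :=
  projection (f, b) (subspace_closure D M0S) (@hclosed_closure _ _ D M0).
have Bc : hclosed D B.
  move=> u [x y] Bu /prod_hcvg[ux uy].
  apply: Bclosed ux uy => n; by case: (u n) (Bu n).
have Bp : B (p1, p2) by apply: (hclosure_min _ Bc Mp) => z [g []].
have Bfp : B (f - p1, b - p2).
  by rewrite -(scaleN1r p1) -(scaleN1r p2); exact: BD _ _ Bfb (BZ _ _ Bp).
(* Orthogonality of the residual to [M0] says that [f - p1] is orthogonal to every [h + A h]; the
   choice [h + A h = f - p1] kills it. Nothing is claimed about the second components, as [k] may be
   degenerate. *)
have fp : f = p1.
  have [h [g [Ahg e]]] := posop_range pA (f - p1).
  have [c Bc' hc] := AB' _ _ Ahg.
  have M0h : hclosure D M0 (h, c) by apply: sub_hclosure; exists g.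
  have e0 : d (f - p1) h + k (b - p2) c = 0 := hp _ M0h.
  rewrite (dotC k) -(hc _ _ Bfp) (dotC d g) -dotDr -e in e0.
  by apply/eqP; rewrite -subr_eq0; apply/eqP/d_def.
subst p1; have [z [Mz zf]] := hclosureP Mp.
have /choice[g hg] := Mz.
have [zf1 zf2] := prod_hcvg zf.
exists (fun n => (z n).1), g; split=> [n| |e e0]; first by case: (hg n).
  exact: zf1.
have s0 : 0 < Num.sqrt e by rewrite sqrtr_gt0.
have [N hN] := hcvg_cauchy zf2 s0; exists N => n j Nn Nj.
have [_ Bn hn] := hg n; have [_ Bj hj] := hg j.
have Bnj : B ((z n).1 - (z j).1, (z n).2 - (z j).2).
  rewrite -(scaleN1r (z j).1) -(scaleN1r (z j).2).
  apply: (BD _ _ Bn (BZ _ _ Bj)).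
rewrite dotBl (hn _ _ Bnj) (hj _ _ Bnj) -dotBl -sqr_hnorm.
by rewrite -[ltRHS](sqr_sqrtr (ltW e0)) ltr_sqr ?nnegrE ?hnorm_ge0 ?ltW// hN.
Qed.

End PositiveRelation.

(** * Weighted l^2 spaces *)

Section PositiveSums.
Context {R : realType} {V : choiceType}.
Implicit Types (a b : V -> R) (s : seq V).

(** [fine] sends an infinite sum to 0, so finiteness is carried separately by [sumable]. *)
Definition tsum a : R := fine (\esum_(x in [set: V]) (a x)%:E).
Definition sumable a := (\esum_(x in [set: V]) (a x)%:E < +oo)%E.

Lemma esum_le a (c : R) :
  (forall s, uniq s -> \sum_(x <- s) a x <= c) ->
  (\esum_(x in [set: V]) (a x)%:E <= c%:E)%E.
Proof.
move=> h; apply: ge_ereal_sup => _ [A [finA _] <-].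
by rewrite fsbig_finite// sumEFin lee_fin h// fset_uniq.
Qed.

Lemma esum_ge_seq a s : uniq s ->
  ((\sum_(x <- s) a x)%:E <= \esum_(x in [set: V]) (a x)%:E)%E.
Proof.
move=> us; apply: ereal_sup_ubound; exists [set` s]; first by split.
by rewrite -fsbig_seq// sumEFin.
Qed.

Lemma sumable_bound a (c : R) : 
  (forall s, uniq s -> \sum_(x <- s) a x <= c) -> sumable a.
Proof. by move=> /esum_le h; apply: le_lt_trans h _; rewrite ltry. Qed.

Lemma esum_tsum a : (forall x, 0 <= a x) -> sumable a ->
  \esum_(x in [set: V]) (a x)%:E = (tsum a)%:E.
Proof.
move=> a0 sa; rewrite fineK// ge0_fin_numE//.
by apply: esum_ge0 => x _; rewrite lee_fin.
Qed.

Lemma tsum_ge0 a : (forall x, 0 <= a x) -> 0 <= tsum a.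
Proof. by move=> a0; apply/fine_ge0/esum_ge0 => x _; rewrite lee_fin. Qed.

Lemma tsum_ge_seq a s : (forall x, 0 <= a x) -> sumable a -> uniq s ->
  \sum_(x <- s) a x <= tsum a.
Proof. by move=> a0 sa us; rewrite -lee_fin -esum_tsum// esum_ge_seq. Qed.

Lemma tsum_ge1 a x : (forall x, 0 <= a x) -> sumable a -> a x <= tsum a.
Proof. by move=> a0 sa; have := tsum_ge_seq (s := [:: x]) a0 sa isT; rewrite big_seq1. Qed.

Lemma tsum_le a (c : R) : (forall x, 0 <= a x) ->
  (forall s, uniq s -> \sum_(x <- s) a x <= c) -> tsum a <= c.
Proof.
move=> a0 h; rewrite -lee_fin -esum_tsum//; first exact: esum_le.
exact: sumable_bound h.
Qed.

Lemma sumable_le a b : (forall x, a x <= b x) -> sumable b -> sumable a.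
Proof.
move=> ab; apply: le_lt_trans; apply: le_esum => x _; by rewrite lee_fin.
Qed.

Lemma le_tsum a b : (forall x, 0 <= a x) -> (forall x, a x <= b x) ->
  sumable b -> tsum a <= tsum b.
Proof.
move=> a0 ab sb; rewrite -lee_fin -!esum_tsum//.
- by apply: le_esum => x _; rewrite lee_fin.
- by move=> x; apply: le_trans (ab x).
- exact: sumable_le sb.
Qed.

Lemma sumableD a b : (forall x, 0 <= a x) -> (forall x, 0 <= b x) ->
  sumable a -> sumable b -> sumable (fun x => a x + b x).
Proof.
move=> a0 b0 sa sb; rewrite /sumable.
under eq_esum do rewrite EFinD.
by rewrite esumD ?lte_add_pinfty// => x _; rewrite lee_fin.
Qed.

Lemma tsumD a b : (forall x, 0 <= a x) -> (forall x, 0 <= b x) ->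
  sumable a -> sumable b -> tsum (fun x => a x + b x) = tsum a + tsum b.
Proof.
move=> a0 b0 sa sb; apply: EFin_inj; rewrite -esum_tsum//; last 2 first.
- by move=> x; rewrite addr_ge0.
- exact: sumableD.
under eq_esum do rewrite EFinD.
by rewrite esumD ?EFinD ?esum_tsum// => x _; rewrite lee_fin.
Qed.

Lemma sumableZ (c : R) a : 0 <= c -> (forall x, 0 <= a x) -> sumable a ->
  sumable (fun x => c * a x).
Proof.
move=> c0 a0 sa; apply: (@sumable_bound _ (c * tsum a)) => s us.
by rewrite -mulr_sumr ler_wpM2l// tsum_ge_seq.
Qed.

Lemma tsumZ (c : R) a : 0 <= c -> (forall x, 0 <= a x) -> sumable a ->
  tsum (fun x => c * a x) = c * tsum a.
Proof.
rewrite le_eqVlt => /predU1P[<-|c0] a0 sa.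
  rewrite mul0r /tsum esum1// => x _; by rewrite mul0r.
have ca0 x : 0 <= c * a x by rewrite mulr_ge0// ltW.
apply/eqP; rewrite eq_le; apply/andP; split.
  by apply: tsum_le => // s us; rewrite -mulr_sumr ler_wpM2l ?(ltW c0)// tsum_ge_seq.
rewrite mulrC -ler_pdivlMr//; apply: tsum_le => // s us.
rewrite ler_pdivlMr// mulrC mulr_sumr tsum_ge_seq//.
by apply: sumableZ => //; exact: ltW.
Qed.

Lemma sumable_fin a s : (forall x, 0 <= a x) -> (forall x, x \notin s -> a x = 0) ->
  sumable a.
Proof.
move=> a0 h; apply: (@sumable_bound _ (\sum_(x <- undup s) a x)) => t ut.
rewrite (bigID (fun x => x \in undup s)) /= [X in _ + X]big1 ?addr0; last first.
  by move=> x; rewrite mem_undup => /h.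
rewrite -big_filter.
rewrite [leRHS](bigID (fun x => x \in t)) /= -[in leRHS]big_filter.
rewrite (perm_big [seq x <- undup s | x \in t]) ?lerDl ?sumr_ge0//.
apply: uniq_perm; rewrite ?filter_uniq ?undup_uniq// => x.
by rewrite !mem_filter andbC.
Qed.

Lemma tsum_fin a s : uniq s -> (forall x, 0 <= a x) ->
  (forall x, x \notin s -> a x = 0) -> tsum a = \sum_(x <- s) a x.
Proof.
move=> us a0 h; apply/eqP; rewrite eq_le tsum_ge_seq ?andbT//; last first.
  exact: sumable_fin h.
apply: tsum_le => // t ut.
rewrite (bigID (fun x => x \in s)) /= [X in _ + X]big1 ?addr0; last first.
  by move=> x /h.
rewrite -big_filter.
rewrite [leRHS](bigID (fun x => x \in t)) /= -[in leRHS]big_filter.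
rewrite (perm_big [seq x <- s | x \in t]) ?lerDl ?sumr_ge0//.
apply: uniq_perm; rewrite ?filter_uniq// => x.
by rewrite !mem_filter andbC.
Qed.

(** The bound holds for every list containing [s], so that several families can be truncated along
    one common set. *)
Lemma tsum_tail a (e : R) : (forall x, 0 <= a x) -> sumable a -> 0 < e ->
  exists s, uniq s /\ forall t : seq V, {subset s <= t} ->
    tsum (fun x => if x \in t then 0 else a x) < e.
Proof.
move=> a0 sa e0.
have [s us hs] : exists2 s, uniq s & tsum a - e < \sum_(x <- s) a x.
  apply: contrapT => h; suff: tsum a <= tsum a - e by lra.
  apply: tsum_le => // s us; rewrite leNgt; apply/negP => h'.
  by apply: h; exists s.
exists s; split=> // t st.
pose b x := if x \in s then a x else 0.
pose c x := if x \in s then 0 else a x.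
have b0 x : 0 <= b x by rewrite /b; case: ifP.
have c0 x : 0 <= c x by rewrite /c; case: ifP.
have sb : sumable b by apply: sumable_le sa => x; rewrite /b; case: ifP.
have sc : sumable c by apply: sumable_le sa => x; rewrite /c; case: ifP.
have bc : tsum a = tsum b + tsum c.
  by rewrite -tsumD//; congr tsum; apply/funext => x; rewrite /b /c;
    case: ifP; rewrite ?addr0 ?add0r.
have e1 : tsum b = \sum_(x <- s) a x.
  rewrite (@tsum_fin _ s)//; first by rewrite big_seq [RHS]big_seq;
    apply: eq_bigr => x; rewrite /b => ->.
  by move=> x; rewrite /b => /negbTE ->.
apply: (@le_lt_trans _ _ (tsum c)); last lra.
apply: le_tsum => // x; first by case: ifP.
rewrite /c; case: (boolP (x \in t)) => xt; case: (boolP (x \in s)) => xs //.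
by rewrite (st _ xs) in xt.
Qed.

End PositiveSums.

Section SignedSums.
Context {R : realType} {V : choiceType}.
Implicit Types (F G : V -> R).

Definition abs_sumable F := sumable (fun x => `|F x|).

Let pos F x : R := Num.max (F x) 0.
Let neg F x : R := Num.max (- F x) 0.

Let pos_ge0 F x : 0 <= pos F x. Proof. by rewrite le_max lexx orbT. Qed.
Let neg_ge0 F x : 0 <= neg F x. Proof. by rewrite le_max lexx orbT. Qed.

Let posB F x : F x = pos F x - neg F x.
Proof. by rewrite /pos /neg; case: (lerP (F x) 0) => h; case: (lerP (- F x) 0) => k; lra. Qed.

Let pos_sumable F : abs_sumable F -> sumable (pos F).
Proof.
by apply: sumable_le => x; rewrite ge_max normr_ge0 ler_norm.
Qed.

Let neg_sumable F : abs_sumable F -> sumable (neg F).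
Proof.
by apply: sumable_le => x; rewrite ge_max normr_ge0 -normrN ler_norm.
Qed.

(** Here [a] and [b] may be any non-negative summable families, not just the two parts of their
    difference. Additivity needs this freedom, as the positive part of [F + G] is not the sum of the
    positive parts. *)
Lemma rsumB (a b : V -> R) : (forall x, 0 <= a x) -> (forall x, 0 <= b x) ->
  sumable a -> sumable b -> rsum (fun x => a x - b x) = tsum a - tsum b.
Proof.
move=> a0 b0 sa sb; apply: EFin_inj.
have key := @esumB R V [set: V] (fun x => (a x)%:E) (fun x => (b x)%:E).
rewrite [RHS]EFinB -!esum_tsum// -key//; last 4 first.
- by rewrite /summable; under eq_esum => x _ do rewrite gee0_abs ?lee_fin//.
- by rewrite /summable; under eq_esum => x _ do rewrite gee0_abs ?lee_fin//.
- by move=> x _; rewrite lee_fin.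
- by move=> x _; rewrite lee_fin.
have e1 : \esum_(x in [set: V]) ((fun x => (a x)%:E) \- (fun x => (b x)%:E))%E^\+%E x =
    \esum_(x in [set: V]) (Num.max (a x - b x) 0)%:E.
  by apply: eq_esum => x _; rewrite funeposE EFin_max.
have e2 : \esum_(x in [set: V]) ((fun x => (a x)%:E) \- (fun x => (b x)%:E))%E^\-%E x =
    \esum_(x in [set: V]) (Num.max (- (a x - b x)) 0)%:E.
  by apply: eq_esum => x _; rewrite funenegE EFin_max.
have s1 : sumable (fun x => Num.max (a x - b x) 0).
  by apply: sumable_le sa => x; rewrite ge_max a0 andbT gerBl.
have s2 : sumable (fun x => Num.max (- (a x - b x)) 0).
  by apply: sumable_le sb => x; rewrite ge_max b0 andbT opprB gerBl.
rewrite e1 e2 /rsum !esum_tsum//.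
- by move=> x; rewrite le_max lexx orbT.
- by move=> x; rewrite le_max lexx orbT.
Qed.

Lemma rsumE F : abs_sumable F -> rsum F = tsum (pos F) - tsum (neg F).
Proof. by []. Qed.

Lemma rsumD F G : abs_sumable F -> abs_sumable G ->
  rsum (fun x => F x + G x) = rsum F + rsum G.
Proof.
move=> sF sG; rewrite [rsum F]rsumE// [rsum G]rsumE//.
transitivity (rsum (fun x => (pos F x + pos G x) - (neg F x + neg G x))).
  by congr rsum; apply/funext => x; rewrite [in LHS](posB F) [in LHS](posB G); lra.
have pF := pos_sumable sF; have pG := pos_sumable sG.
have nF := neg_sumable sF; have nG := neg_sumable sG.
rewrite rsumB; [|by move=> x; rewrite addr_ge0|by move=> x; rewrite addr_ge0
  |exact: sumableD|exact: sumableD].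
by rewrite !tsumD//; lra.
Qed.

Lemma rsum_ge0E F : (forall x, 0 <= F x) -> rsum F = tsum F.
Proof.
move=> F0; rewrite /rsum [X in _ - fine X]esum1 ?subr0; last first.
  by move=> x _; rewrite max_r// oppr_le0.
by congr fine; apply: eq_esum => x _; rewrite max_l.
Qed.

Lemma rsumN F : rsum (fun x => - F x) = - rsum F.
Proof.
by rewrite /rsum opprB; congr (_ - fine _); apply: eq_esum => x _; rewrite opprK.
Qed.

Lemma rsumZ (c : R) F : abs_sumable F -> rsum (fun x => c * F x) = c * rsum F.
Proof.
wlog c0 : c F / 0 <= c.
  move=> h sF; have [/h->//|c0] := leP 0 c.
  have := h (- c) F; rewrite oppr_ge0 (ltW c0) => /(_ isT sF).
  have -> : (fun x => - c * F x) = (fun x => - (c * F x)).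
    by apply/funext => x; rewrite mulNr.
  by rewrite rsumN mulNr => /oppr_inj.
move=> sF; rewrite [in RHS]rsumE// mulrBr.
have pF := pos_sumable sF; have nF := neg_sumable sF.
rewrite -(tsumZ c0 (pos_ge0 F) pF) -(tsumZ c0 (neg_ge0 F) nF) -rsumB.
- by congr rsum; apply/funext => x; rewrite {1}(posB F) mulrBr.
- by move=> x; rewrite mulr_ge0.
- by move=> x; rewrite mulr_ge0.
- exact: sumableZ.
- exact: sumableZ.
Qed.

Lemma rsum_seq (s : seq V) F : uniq s -> (forall x, x \notin s -> F x = 0) ->
  rsum F = \sum_(x <- s) F x.
Proof.
move=> us h; rewrite /rsum -/(tsum (pos F)) -/(tsum (neg F)).
rewrite !(@tsum_fin _ _ _ s)//.
- by rewrite -sumrB; apply: eq_bigr => x _; rewrite -posB.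
- by move=> x /h; rewrite /neg => ->; rewrite oppr0 maxxx.
- by move=> x /h; rewrite /pos => ->; rewrite maxxx.
Qed.

End SignedSums.

Section ComplexSquares.
Context {R : realType}.
Implicit Types (a b z : R[i]) (t : R).

Definition sqc z : R := complex.Re z ^+ 2 + complex.Im z ^+ 2.

(* [Re (a * conj b)] *)
Definition re2 a b : R :=
  complex.Re a * complex.Re b + complex.Im a * complex.Im b.

Lemma normc_sqr z : Normc.normc z ^+ 2 = sqc z.
Proof. by case: z => a b; rewrite /= sqr_sqrtr// addr_ge0 ?sqr_ge0. Qed.

Lemma sqc_ge0 z : 0 <= sqc z. Proof. by rewrite addr_ge0 ?sqr_ge0. Qed.

Lemma sqc0 : sqc 0 = 0. Proof. by rewrite /sqc /= expr0n addr0. Qed.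

Lemma sqc_eq0 z : sqc z = 0 -> z = 0.
Proof.
case: z => a b; rewrite /sqc /= => /eqP.
by rewrite paddr_eq0 ?sqr_ge0// !sqrf_eq0 => /andP[/eqP-> /eqP->].
Qed.

Lemma sqc_gt0 z : z != 0 -> 0 < sqc z.
Proof.
move=> z0; rewrite lt_neqAle sqc_ge0 andbT eq_sym; apply: contra z0.
by move=> /eqP/sqc_eq0 ->.
Qed.

Lemma sqcN z : sqc (- z) = sqc z.
Proof. by case: z => a b; rewrite /sqc /= !sqrrN. Qed.

Lemma sqcM a b : sqc (a * b) = sqc a * sqc b.
Proof. by case: a b => [a a'] [b b']; rewrite /sqc /=; ring. Qed.

Lemma sqcD_le a b : sqc (a + b) <= 2 * sqc a + 2 * sqc b.
Proof.
case: a b => [a a'] [b b']; rewrite /sqc /=.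
by have := sqr_ge0 (a - b); have := sqr_ge0 (a' - b'); lra.
Qed.

Lemma sqcB_le a b : sqc (a - b) <= 2 * sqc a + 2 * sqc b.
Proof. by rewrite -[sqc b]sqcN sqcD_le. Qed.

Lemma sqc_real t : sqc t%:C%C = t ^+ 2.
Proof. by rewrite /sqc /= expr0n addr0. Qed.

Lemma sqc_cexp t : sqc (cexp t) = 1.
Proof. by rewrite /sqc /= cos2Dsin2. Qed.

Lemma re2_le a b : `|re2 a b| <= sqc a + sqc b.
Proof.
case: a b => [a a'] [b b']; rewrite /re2 /sqc /= ler_norml.
have := sqr_ge0 (a - b); have := sqr_ge0 (a' - b').
have := sqr_ge0 (a + b); have := sqr_ge0 (a' + b').
by move=> *; apply/andP; split; nra.
Qed.

Lemma re2C a b : re2 a b = re2 b a.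
Proof. by rewrite /re2 mulrC [X in _ + X]mulrC. Qed.

Lemma re2Dl a b z : re2 (a + b) z = re2 a z + re2 b z.
Proof. by case: a b z => [a a'] [b b'] [z z']; rewrite /re2 /=; ring. Qed.

Lemma re2Zl t a z : re2 (t%:C%C * a) z = t * re2 a z.
Proof. by case: a z => [a a'] [z z']; rewrite /re2 /=; ring. Qed.

Lemma re2zz z : re2 z z = sqc z. Proof. by rewrite /re2 /sqc !expr2. Qed.

End ComplexSquares.

Lemma real_cauchy_cvg (R : realType) (a : nat -> R) :
  (forall e, 0 < e -> exists N, forall n k, (N <= n)%N -> (N <= k)%N ->
     `|a n - a k| < e) -> exists l : R, a @ \oo --> l.
Proof.
move=> h; apply/cvg_ex; apply: cauchy_cvg; apply: cauchy_exP => e e0.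
have [N hN] := h e e0; exists (a N), N => // n /= Nn.
exact: hN.
Qed.

Section L2Functions.
Context {R : realType} {V : choiceType}.
Variable w : V -> R.
Hypothesis w0 : forall x, 0 <= w x.
Implicit Types f g h : V -> R[i].

Lemma l2sqE f : l2sq w f = \esum_(x in [set: V]) (w x * sqc (f x))%:E.
Proof. by apply: eq_esum => x _; rewrite normc_sqr. Qed.

Lemma l2E f : l2 w f = sumable (fun x => w x * sqc (f x)).
Proof. by rewrite /l2 /sumable /= l2sqE. Qed.

Lemma l2_sumable f : l2 w f -> sumable (fun x => w x * sqc (f x)).
Proof. by rewrite l2E. Qed.

Lemma wsqc_ge0 f x : 0 <= w x * sqc (f x). Proof. by rewrite mulr_ge0 ?sqc_ge0. Qed.

Hint Resolve wsqc_ge0 : core.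

Lemma l2D f g : l2 w f -> l2 w g -> l2 w (fun x => f x + g x).
Proof.
rewrite !l2E => lf lg.
have := sumableZ (ler0n _ 2) (fun x => addr_ge0 (wsqc_ge0 f x) (wsqc_ge0 g x))
  (sumableD (wsqc_ge0 f) (wsqc_ge0 g) lf lg).
apply: sumable_le => x; apply: le_trans (ler_wpM2l (w0 x) (sqcD_le _ _)) _; lra.
Qed.

Lemma l2Z (c : R[i]) f : l2 w f -> l2 w (fun x => c * f x).
Proof.
rewrite !l2E => /(sumableZ (sqc_ge0 c) (wsqc_ge0 f)).
by apply: sumable_le => x; rewrite sqcM mulrCA.
Qed.

Lemma l2N f : l2 w f -> l2 w (fun x => - f x).
Proof. by rewrite !l2E; apply: sumable_le => x; rewrite sqcN. Qed.

Lemma l2B f g : l2 w f -> l2 w g -> l2 w (fun x => f x - g x).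
Proof. by move=> lf lg; apply: l2D => //; exact: l2N. Qed.

Lemma l2_0 : l2 w (cst 0).
Proof.
by rewrite l2E; apply: (@sumable_fin _ _ _ [::]) => // x _; rewrite sqc0 mulr0.
Qed.

Definition rdot f g : R := rsum (fun x => w x * re2 (f x) (g x)).

Lemma rdot_sumable f g : l2 w f -> l2 w g ->
  abs_sumable (fun x => w x * re2 (f x) (g x)).
Proof.
rewrite !l2E => lf lg; apply: sumable_le (sumableD _ _ lf lg) => // x.
by rewrite normrM ger0_norm// -mulrDr ler_wpM2l// re2_le.
Qed.

Lemma rdotC f g : rdot f g = rdot g f.
Proof. by congr rsum; apply/funext => x; rewrite re2C. Qed.

Lemma rdotDl f g h : l2 w f -> l2 w g -> l2 w h ->
  rdot (fun x => f x + g x) h = rdot f h + rdot g h.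
Proof.
move=> lf lg lh; rewrite /rdot -rsumD ?rdot_sumable//.
by congr rsum; apply/funext => x; rewrite re2Dl mulrDr.
Qed.

Lemma rdotZl t f g : l2 w f -> l2 w g ->
  rdot (fun x => t%:C%C * f x) g = t * rdot f g.
Proof.
move=> lf lg; rewrite /rdot -rsumZ ?rdot_sumable//.
by congr rsum; apply/funext => x; rewrite re2Zl mulrCA.
Qed.

Lemma rdot_tsum f : rdot f f = tsum (fun x => w x * sqc (f x)).
Proof.
rewrite /rdot; under eq_fun do rewrite re2zz.
by rewrite rsum_ge0E.
Qed.

Lemma rdot_ge0 f : 0 <= rdot f f.
Proof. by rewrite rdot_tsum; apply: tsum_ge0; exact: wsqc_ge0. Qed.

Lemma rdot_fine f : rdot f f = fine (l2sq w f).
Proof. by rewrite rdot_tsum l2sqE. Qed.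

Lemma l2norm_sqrt f : l2norm w f = Num.sqrt (rdot f f).
Proof. by rewrite rdot_fine. Qed.

Lemma inner_rdot f g :
  inner w f g = Complex (rdot f g) (rdot f (fun x => 'i%C * g x)).
Proof.
rewrite /inner /csum /rdot; congr Complex; congr rsum; apply/funext => x;
by case: (f x) (g x) => [a a'] [b b'] /=; rewrite /re2 /=; ring.
Qed.

Lemma wsqc_le_rdot f x : l2 w f -> w x * sqc (f x) <= rdot f f.
Proof.
by move=> lf; rewrite rdot_tsum; apply: (tsum_ge1 x (wsqc_ge0 f)); rewrite -l2E.
Qed.

(** Coordinates converge where the weight is positive; the Cauchy bound then passes to the limit on
    each finite list, and the supremum over lists returns the norm. *)
Lemma l2_complete (u : nat -> V -> R[i]) : (forall n, l2 w (u n)) ->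
  (forall e, 0 < e -> exists N, forall n k, (N <= n)%N -> (N <= k)%N ->
     rdot (fun x => u n x - u k x) (fun x => u n x - u k x) <= e) ->
  exists2 l, l2 w l & forall e, 0 < e -> exists N, forall n, (N <= n)%N ->
     rdot (fun x => u n x - l x) (fun x => u n x - l x) <= e.
Proof.
move=> lu cu.
have part (p : R[i] -> R) : (forall a b, p (a - b) = p a - p b) ->
    (forall a, p a ^+ 2 <= sqc a) ->
    forall x, exists l : R, 0 < w x -> (fun n => p (u n x)) @ \oo --> l.
  move=> pB ps x; have [wx|wx] := ltP 0 (w x); last by exists 0.
  suff [l hl] : exists l : R, (fun n => p (u n x)) @ \oo --> l by exists l.
  apply: real_cauchy_cvg => e e0.
  have [N hN] := cu _ (divr_gt0 (mulr_gt0 wx (exprn_gt0 2 e0)) (ltr0Sn R 1)).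
  exists N => n k Nn Nk; have := hN n k Nn Nk.
  move=> /(le_trans (wsqc_le_rdot x (l2B (lu n) (lu k)))).
  rewrite -mulrA ler_pM2l// => h; rewrite -pB.
  rewrite -ltr_sqr ?nnegrE ?(ltW e0)// real_normK ?num_real//.
  by apply: le_lt_trans (ps _) _; apply: le_lt_trans h _; have := exprn_gt0 2 e0; lra.
have /choice[lr hr] := part _ (fun a b => raddfB (@complex.Re R) a b)
  (fun a => ltac:(by rewrite lerDl sqr_ge0)).
have /choice[li hi] := part _ (fun a b => raddfB (@complex.Im R) a b)
  (fun a => ltac:(by rewrite lerDr sqr_ge0)).
pose l x := Complex (lr x) (li x).
have hcv n x : (fun k => w x * sqc (u n x - u k x)) @ \oo --> w x * sqc (u n x - l x).
  have := w0 x; rewrite le_eqVlt => /predU1P[<-|wx].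
    by rewrite mul0r; under eq_fun do rewrite mul0r; exact: cvg_cst.
  have hr' := hr x wx; have hi' := hi x wx.
  have reB (a b : R[i]) : complex.Re (a - b) = complex.Re a - complex.Re b by exact: raddfB.
  have imB (a b : R[i]) : complex.Im (a - b) = complex.Im a - complex.Im b by exact: raddfB.
  rewrite /sqc; under eq_fun do rewrite reB imB.
  rewrite reB imB /=; apply: cvgMr; apply: cvgD; rewrite !expr2.
    under eq_fun do rewrite expr2.
    by apply: cvgM; apply: cvgB => //; exact: cvg_cst.
  under eq_fun do rewrite expr2.
  by apply: cvgM; apply: cvgB => //; exact: cvg_cst.
have bound e N n : (forall k, (N <= k)%N ->
    rdot (fun x => u n x - u k x) (fun x => u n x - u k x) <= e) ->
    forall s, uniq s -> \sum_(x <- s) w x * sqc (u n x - l x) <= e.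
  move=> h s us.
  have cv : (fun k => \sum_(x <- s) w x * sqc (u n x - u k x)) @ \oo -->
      \sum_(x <- s) w x * sqc (u n x - l x).
    by apply: cvg_big => [|x _]; [exact: add_continuous|exact: hcv].
  apply: (@closed_cvg _ _ _ _ _ (fun y => y <= e) _ _ _ cv).
    exact: closed_le.
  exists N => // k /= Nk; apply: le_trans (h k Nk).
  rewrite rdot_tsum; apply: tsum_ge_seq us => [x|].
    exact: (wsqc_ge0 (fun x => u n x - u k x)).
  exact: (l2_sumable (l2B (lu n) (lu k))).
have ll : l2 w l.
  have [N hN] := cu 1 ltr01.
  have : l2 w (fun x => u N x - l x).
    rewrite l2E; apply: (@sumable_bound _ _ _ 1); apply: (bound _ N) => k.
    exact: hN.
  move=> /(l2B (lu N)); congr l2; apply/funext => x; by rewrite opprB addrC subrK.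
exists l => // e e0; have [N hN] := cu e e0; exists N => n Nn.
rewrite rdot_tsum; apply: tsum_le => [x|].
  exact: (wsqc_ge0 (fun x => u n x - l x)).
by apply: (bound _ N) => k; exact: hN.
Qed.

End L2Functions.

Section L2Space.
Context {R : realType} {V : choiceType}.
Variable w : V -> R.
Hypothesis w0 : forall x, 0 <= w x.

Definition l2pred : {pred V -> R[i]} := fun f => `[< l2 w f >].

(** Functions that differ only where [w] vanishes stay distinct, which keeps equality pointwise; the
    price is a semi-definite form for edge weights. *)
Record L2 (w0 : forall x, 0 <= w x) := MkL2 {
  l2val :> V -> R[i]; l2valP : l2val \in l2pred }.

Definition l2mk f (lf : l2 w f) : L2 w0 := MkL2 w0 (asboolT lf).

Lemma l2val_l2 (f : L2 w0) : l2 w f.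
Proof. by case: f => f /= /asboolP. Qed.

HB.instance Definition _ := [isSub for @l2val w0].
HB.instance Definition _ := [Choice of L2 w0 by <:].

Lemma l2pred_zmod_closed : zmod_closed l2pred.
Proof.
split; first by apply/asboolP; exact: l2_0.
by move=> f g /asboolP lf /asboolP lg; apply/asboolP; exact: l2B.
Qed.

HB.instance Definition _ := GRing.isZmodClosed.Build (V -> R[i]) l2pred
  l2pred_zmod_closed.
HB.instance Definition _ := [SubChoice_isSubZmodule of L2 w0 by <:].

Lemma l2_inj (f g : L2 w0) : (forall x, f x = g x) -> f = g.
Proof. by move=> h; apply/val_inj/funext. Qed.

Lemma l2_scale_subproof (t : R) (f : L2 w0) : l2 w (fun x => t%:C%C * f x).
Proof. by apply: l2Z => //; exact: l2val_l2. Qed.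

Definition l2_scale t f := l2mk (l2_scale_subproof t f).

Lemma l2_scaleA a b f : l2_scale a (l2_scale b f) = l2_scale (a * b) f.
Proof. by apply: l2_inj => x /=; rewrite rmorphM mulrA. Qed.

Lemma l2_scale1 : left_id 1 l2_scale.
Proof. by move=> f; apply: l2_inj => x /=; rewrite mul1r. Qed.

Lemma l2_scaleDr : right_distributive l2_scale +%R.
Proof. by move=> a f g; apply: l2_inj => x /=; rewrite mulrDr. Qed.

Lemma l2_scaleDl f : {morph l2_scale^~ f : a b / a + b}.
Proof. by move=> a b; apply: l2_inj => x /=; rewrite rmorphD mulrDl. Qed.

HB.instance Definition _ := GRing.Zmodule_isLmodule.Build R (L2 w0)
  l2_scaleA l2_scale1 l2_scaleDr l2_scaleDl.

Lemma l2_muli_subproof (f : L2 w0) : l2 w (fun x => 'i%C * f x).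
Proof. by apply: l2Z => //; exact: l2val_l2. Qed.

(** [L2] is a module over [R] only; this map carries its complex structure. *)
Definition l2_muli f := l2mk (l2_muli_subproof f).

Definition l2_dot (f g : L2 w0) := rdot w f g.

Lemma l2_dot_complete u : hcauchy l2_dot u -> exists l, hcvg l2_dot u l.
Proof.
have dge (f : L2 w0) : 0 <= l2_dot f f.
  exact: rdot_ge0.
move=> cu; have [|e e0|l ll hl] := @l2_complete _ _ _ w0 (fun n => u n).
- by move=> n; exact: l2val_l2.
- have s0 : 0 < Num.sqrt e by rewrite sqrtr_gt0.
  have [N hN] := cu _ s0; exists N => n k Nn Nk.
  by have := ltW (hN n k Nn Nk); rewrite /hnorm ler_sqrt ?(ltW e0)// => h; exact: h.
exists (l2mk ll) => e e0.
have e2 : 0 < e / 2 by rewrite divr_gt0.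
have [N hN] := hl _ (exprn_gt0 2 e2); exists N => n /hN h.
apply: (@le_lt_trans _ _ (e / 2)); last lra.
rewrite -[e / 2]ger0_norm ?(ltW e2)// -sqrtr_sqr.
exact: (ler_wsqrtr h).
Qed.

(* Opaque, so that simplification keeps [l2_hilbert] folded. *)
Lemma l2_hilbert_subproof :
  {h : hilbert (L2 w0) | forall f g, h f g = rdot w f g}.
Proof.
unshelve eexists (@Hilbert _ _ l2_dot _ _ _ _ l2_dot_complete) => //.
- by move=> f g; exact: rdotC.
- by move=> f g h; apply: rdotDl => //; exact: l2val_l2.
- by move=> t f g; apply: rdotZl => //; exact: l2val_l2.
- by move=> f; exact: rdot_ge0.
Qed.

Definition l2_hilbert := sval l2_hilbert_subproof.

Lemma l2_dotE f g : l2_hilbert f g = rdot w f g.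
Proof. exact: (svalP l2_hilbert_subproof). Qed.

Lemma l2_subE (f g : L2 w0) x : (f - g) x = f x - g x. Proof. by []. Qed.
Lemma l2_def (f : L2 w0) : l2_hilbert f f = 0 -> forall x, 0 < w x -> f x = 0.
Proof.
move=> f0 x wx; apply: sqc_eq0; apply/eqP.
have := wsqc_le_rdot w0 x (l2val_l2 f); rewrite -l2_dotE f0 => h.
by rewrite eq_le sqc_ge0 andbT -(pmulr_rle0 _ wx).
Qed.

End L2Space.

Arguments l2_hilbert {R V w} w0.

(** * Square roots of operators on l^2 *)

Section L2Convergence.
Context {R : realType} {V : choiceType} {w : V -> R} (w0 : forall x, 0 <= w x).

Lemma l2sq_rdot f : l2 w f -> l2sq w f = (rdot w f f)%:E.
Proof.
move=> lf; rewrite rdot_fine// fineK// ge0_fin_numE//.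
by apply: esum_ge0 => x _; rewrite lee_fin mulr_ge0// sqr_ge0.
Qed.

Lemma l2cvgP (u : nat -> L2 w0) (f : L2 w0) :
  l2cvg w (fun n => u n) f <-> hcvg (l2_hilbert w0) u f.
Proof.
rewrite /l2cvg.
have -> : (fun n => l2sq w ((u n : V -> R[i]) \- f)) =
    (fun n => (l2_hilbert w0 (u n - f) (u n - f))%:E).
  by apply/funext => n; rewrite (l2sq_rdot (l2val_l2 (u n - f))) l2_dotE.
split=> [/fine_cvgP[_ /cvgrPdist_lt h] e e0|h].
  have [N _ hN] := h _ (exprn_gt0 2 e0); exists N => n Nn.
  have := hN n Nn; rewrite /= sub0r normrN ger0_norm ?dot_ge0//.
  by rewrite hnorm_lt ?(ltW e0).
apply: cvg_EFin; first by near=> n.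
apply/cvgrPdist_lt => e e0.
have s0 : 0 < Num.sqrt e by rewrite sqrtr_gt0.
have [N hN] := h _ s0; exists N => // n /= Nn.
rewrite sub0r normrN ger0_norm ?dot_ge0//.
by have := hN n Nn; rewrite hnorm_lt ?ltW// sqr_sqrtr ?ltW.
Unshelve. all: by end_near.
Qed.

Lemma l2cvg_bound (u : nat -> V -> R[i]) f (a : nat -> R) :
  (forall n, l2 w (fun x => u n x - f x)) ->
  (forall n, rdot w (fun x => u n x - f x) (fun x => u n x - f x) <= a n) ->
  a @ \oo --> 0 -> l2cvg w u f.
Proof.
move=> lu h a0; rewrite /l2cvg.
have -> : (fun n => l2sq w (u n \- f)) = (fun n =>
    (rdot w (fun x => u n x - f x) (fun x => u n x - f x))%:E).
  by apply/funext => n; rewrite -(l2sq_rdot (lu n)).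
apply: cvg_EFin; first by near=> n.
apply: (squeeze_cvgr _ (cvg_cst 0) a0); near=> n => /=; rewrite h andbT.
exact: rdot_ge0.
Unshelve. all: by end_near.
Qed.

Lemma rdot_muli (f g : L2 w0) :
  l2_hilbert w0 f (l2_muli g) = - l2_hilbert w0 (l2_muli f) g.
Proof.
rewrite !l2_dotE /rdot -rsumN; congr rsum; apply/funext => x /=.
by case: (f x) (g x) => [a a'] [b b']; rewrite /re2 /=; ring.
Qed.

Lemma l2_muli_linear : hlinear (@l2_muli R V w w0).
Proof.
split=> [f g|a f]; apply: l2_inj => x /=; first by rewrite mulrDr.
by rewrite mulrCA.
Qed.

Lemma l2_muliK (f : L2 w0) : l2_muli (l2_muli f) = - f.
Proof. by apply: l2_inj => x /=; rewrite mulrA -expr2 sqr_i mulN1r. Qed.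

Lemma hnorm_muli (f : L2 w0) :
  hnorm (l2_hilbert w0) (l2_muli f) = hnorm (l2_hilbert w0) f.
Proof.
congr Num.sqrt; rewrite !l2_dotE !rdot_tsum//; congr tsum; apply/funext => x /=.
by rewrite sqcM /sqc /= expr0n expr1n add0r mul1r.
Qed.

(** An identity between complex inner products thus splits into two real ones, for [g] and for
    [l2_muli g]. *)
Lemma inner_dot (f g : L2 w0) : inner w f g =
  Complex (l2_hilbert w0 f g) (l2_hilbert w0 f (l2_muli g)).
Proof. by rewrite inner_rdot !l2_dotE. Qed.

End L2Convergence.

Section OperatorSqrt.
Context {R : realType} {V : choiceType} {m : V -> R}.
Context (m0 : forall x, 0 <= m x) (mp : forall x, 0 < m x).

Local Notation H := (L2 m0).
Local Notation d := (l2_hilbert m0).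

Lemma l2_definite (f : H) : d f f = 0 -> f = 0.
Proof. by move=> f0; apply: l2_inj => x; exact: l2_def f0 x (mp x). Qed.

Lemma dot_eq (f g : H) : (forall h, d h f = d h g) -> f = g.
Proof.
move=> h; apply/eqP; rewrite -subr_eq0; apply/eqP/l2_definite.
by rewrite dotBr h subrr.
Qed.

Definition rel_of (A : op R V) : set (H * H) :=
  [set fg | A (l2val fg.1, l2val fg.2)].

(** For a self-adjoint relation, density of the domain amounts to single-valuedness, recorded by
    [possa_single]. [possa_muli] upgrades real to complex linearity. *)
Record positive_sa (A : op R V) : Prop := PositiveSa {
  possa_l2 : forall f g, A (f, g) -> l2 m f /\ l2 m g;
  possa_posop : positive_op d (rel_of A);
  possa_muli : forall f g : H, rel_of A (f, g) -> rel_of A (l2_muli f, l2_muli g);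
  possa_single : forall g : H, rel_of A (0, g) -> g = 0
}.

(** Multiplication by ['i] is passed to [posop_sqrt] as [J], so that both roots are complex
    linear. *)
Lemma op_sqrt_exists A : positive_sa A -> exists S, is_op_sqrt m A S.
Proof.
move=> [Al2 Apos AJ A1].
have [|Rr [Q [[Rlin Qlin] [Rsym Qsym] [RQ RQ0] [RJ QJ] [RQ1 AE]]]] :=
  posop_sqrt l2_definite Apos (@l2_muli_linear _ _ _ m0) _ AJ.
  by exists 1 => x; rewrite hnorm_muli mul1r.
(* [Q Rr^-1], parametrised by [k] so that [Rr] is never inverted. *)
pose S : op R V := [set fg | exists k : H, fg.1 = l2val (Rr k) /\ fg.2 = l2val (Q k)].
have R0 x : Rr x = 0 -> x = 0.
  move=> x0; apply: A1; rewrite AE add0r x0.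
  by rewrite (hlinear0 Rlin).
exists S; split.
- split; first split.
  + by move=> _ [_ [k [/= -> _]]]; exact: l2val_l2.
  + move=> f lf.
    have sR : subspace (range Rr).
      split; first by exists 0 => //; rewrite (hlinear0 Rlin).
        by move=> _ _ [x _ <-] [y _ <-]; exists (x + y); rewrite ?Rlin.1.
      by move=> a _ [x _ <-]; exists (a *: x); rewrite ?Rlin.2.
    have [p Mp hp] := projection (l2mk m0 lf) (subspace_closure d sR)
      (@hclosed_closure _ _ d (range Rr)).
    (* The orthogonal complement of the range of the symmetric map [Rr] is its kernel, which is
       zero; so the range is dense. *)
    have fp : l2mk m0 lf - p = 0.
      apply: R0; apply: dot_eq => h; rewrite dot0r -Rsym dotC.
      by apply: hp; apply: sub_hclosure; exists h.
    have [u [Mu up]] := hclosureP Mp.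
    exists (fun n => l2val (u n)); split=> [n|].
      by have [k _ <-] := Mu n; exists (Q k), k.
    have -> : f = l2val p by rewrite -(subr0_eq fp).
    exact/l2cvgP.
  + apply/seteqP; split=> [[f g] [k [/= -> ->]]|[f g] [/= lf lg h]].
      split=> /=; try exact: l2val_l2.
      move=> _ _ [k' [/= -> ->]]; rewrite !inner_dot -RJ -QJ.
      by rewrite -!Rsym -!Qsym !RQ.
    pose f' := l2mk m0 lf; pose g' := l2mk m0 lg.
    have QR : Q f' = Rr g'.
      apply: dot_eq => k; rewrite -Qsym -Rsym.
      have := h (Rr k) (Q k) (ex_intro _ k (conj erefl erefl)).
      by rewrite (inner_dot (Q k) f') (inner_dot (Rr k) g') => -[].
    (* By [Q f' = Rr g'] and [Rr^2 + Q^2 = 1], this vector is sent to [f'] by [Rr] and to [g'] by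
       [Q]. *)
    exists (Rr f' + Q g'); rewrite Rlin.1 Qlin.1; split.
      by rewrite RQ -QR RQ1.
    by rewrite -RQ QR RQ1.
- move=> _ _ [k [/= -> ->]]; rewrite inner_dot lecE /= -Rsym RQ0 andbT.
  (* The order on complex numbers also demands a zero imaginary part: [Rr Q] is symmetric and
     commutes with ['i], so that part equals its own opposite. *)
  rewrite -RJ -Rsym; apply/eqP.
  have : d (Rr (Q k)) (l2_muli k) = d k (l2_muli (Rr (Q k))).
    by rewrite Rsym RJ Qsym QJ RQ.
  by rewrite rdot_muli => /eqP; rewrite dotC rdot_muli opprK; lra.
- apply/seteqP; split=> [[f h] [g [[k /= [-> ->]] [k' /= [e ->]]]]|[f h] Afh].
    have {}e : Q k = Rr k' by exact: val_inj.
    have : rel_of A (Rr k, Q k').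
      apply/AE; rewrite Rlin.1; congr Rr.
      by rewrite RQ -e RQ1.
    by [].
  have [lf lh] := Al2 _ _ Afh.
  have : rel_of A (l2mk m0 lf, l2mk m0 lh) by exact: Afh.
  move=> /AE; set f' := l2mk m0 lf; set h' := l2mk m0 lh => e.
  exists (Q (Rr (f' + h'))); split; first by exists (Rr (f' + h')); split=> //;
    rewrite /= -e.
  exists (Q (f' + h')); rewrite /= -RQ; split=> //.
  have := RQ1 (f' + h'); rewrite -e => /addrI e'; by rewrite e'.
Qed.

Section SqrtDomain.
Variables (A S : op R V).
Hypothesis AS : is_op_sqrt m A S.
Hypothesis Apos : positive_sa A.

Lemma op_sqrt_dom (f : H) : op_dom S f <-> exists u g : nat -> H,
  [/\ forall n, rel_of A (u n, g n), hcvg d u f &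
     forall e : R, 0 < e -> exists N, forall n j, (N <= n)%N -> (N <= j)%N ->
       d (g n - g j) (u n - u j) < e].
Proof.
have [[[Sl2 _] Sadj] _ SSA] := AS.
have Sl2' a b : S (a, b) -> l2 m a /\ l2 m b by rewrite {1}Sadj => -[].
have SE (a b : H) : S (l2val a, l2val b) <->
    forall a' b' : H, S (l2val a', l2val b') ->
      inner m b' a = inner m a' b.
  have -> : S (l2val a, l2val b) = op_adjoint m S (l2val a, l2val b).
    by rewrite {1}Sadj.
  split=> [[_ _ h] a' b' h'|h]; first exact: h.
  split=> /=; try exact: l2val_l2.
  move=> a' b' h'; have [la lb] := Sl2' _ _ h'.
  exact: (h (l2mk m0 la) (l2mk m0 lb)).
have Ssym (a b a' b' : H) : S (l2val a, l2val b) -> S (l2val a', l2val b') ->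
    d b' a = d a' b.
  by move=> /SE h /h; rewrite !inner_dot => -[].
have Smuli (a b : H) : S (l2val a, l2val b) ->
    S (l2val (l2_muli a), l2val (l2_muli b)).
  move=> /SE h; apply/SE => a' b' /h; rewrite !inner_dot => -[e1 e2].
  by rewrite !l2_muliK !dotNr e1 e2.
(* The imaginary part of the adjoint identity is its real part tested on
   [(l2_muli a', l2_muli b')]. *)
have SE' (a b : H) : S (l2val a, l2val b) <->
    forall a' b' : H, S (l2val a', l2val b') -> d b' a = d a' b.
  split=> [h a' b' h'|h]; first exact: Ssym.
  apply/SE => a' b' h'; rewrite !inner_dot (h _ _ h') !rdot_muli.
  by rewrite (h _ _ (Smuli _ _ h')).
have [] := @posop_form_dom _ _ d l2_definite (rel_of A) (possa_posop Apos) H d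
  [set fg | S (l2val fg.1, l2val fg.2)] _ _ _ f.
- split=> [|[a b] [a' b'] h h'|t [a b] h]; apply/SE' => /= c e k.
  + by rewrite !dot0r.
  + by rewrite !dotDr (Ssym _ _ _ _ h k) (Ssym _ _ _ _ h' k).
  + by rewrite !dotZr (Ssym _ _ _ _ h k).
- move=> u v x y Suv ux vy; apply/SE' => c e k; rewrite dotC.
  apply: (hcvg_dot ux) => t t0.
  have c1 : 0 < hnorm d c + 1 by have := hnorm_ge0 d c; lra.
  have [N hN] := vy _ (divr_gt0 t0 c1); exists N => n /hN.
  rewrite ltr_pdivlMr// => h; rewrite dotC (Ssym _ _ _ _ (Suv n) k) -dotBr.
  apply: le_lt_trans (dot_le _ _ _) _.
  by have := hnorm_ge0 d c; have := hnorm_ge0 d (v n - y); nra.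
- move=> a b; rewrite /rel_of /= -SSA => -[c [/= Sac Scb]].
  have [_ lc] := Sl2' _ _ Sac.
  exists (l2mk m0 lc); first exact: Sac.
  move=> a' b' h; have := @Ssym (l2mk m0 lc) b a' b' Scb h.
  by rewrite dotC => ->; rewrite dotC.
move=> h1 h2; split=> [[g Sfg]|/h2[b Sfb]].
  by have [_ lg] := Sl2' _ _ Sfg; apply: h1; exists (l2mk m0 lg).
by exists (l2val b).
Qed.

End SqrtDomain.

(** One inclusion uses that the domain is the same for all roots, the other that a root exists. *)
Lemma sqrt_dom_form (A : op R V) (F : set (V -> R[i])) : positive_sa A ->
  (forall f, F f -> l2 m f) ->
  (forall f : H, F f <-> exists u g : nat -> H,
  [/\ forall n, rel_of A (u n, g n), hcvg d u f &
     forall e : R, 0 < e -> exists N, forall n j, (N <= n)%N -> (N <= j)%N ->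
       d (g n - g j) (u n - u j) < e]) ->
  sqrt_dom m A = F.
Proof.
move=> Apos Fl2 FE; apply/seteqP; split=> f.
  move=> [S [AS Sf]]; have [[[Sl2 _] _] _ _] := AS.
  have /FE := (op_sqrt_dom AS Apos (l2mk m0 (Sl2 _ Sf))).1 Sf; exact.
move=> Ff; have [S AS] := op_sqrt_exists Apos; exists S; split=> //.
exact: (op_sqrt_dom AS Apos (l2mk m0 (Fl2 _ Ff))).2 ((FE (l2mk m0 (Fl2 _ Ff))).1 Ff).
Qed.

End OperatorSqrt.

(** * The closed form and the Laplacian of a graph *)

Section FiniteSums.
Context {R : realType} {V : choiceType}.

Lemma fsbig_seqT (M : nmodType) (s : seq V) (F : V -> M) : uniq s ->
  (forall x, x \notin s -> F x = 0) ->
  \sum_(x \in [set: V]) F x = \sum_(x <- s) F x.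
Proof.
move=> us h; rewrite [RHS]fsbig_seq//; symmetry.
by apply: fsbig_widen => // x [_ /negP xs]; exact: h.
Qed.

Lemma csum_seq (s : seq V) (F : V -> R[i]) : uniq s ->
  (forall x, x \notin s -> F x = 0) -> csum F = \sum_(x <- s) F x.
Proof.
move=> us h; rewrite /csum.
rewrite (rsum_seq us) => [|x /h ->//]; rewrite (rsum_seq us) => [|x /h ->//].
apply/eqP; rewrite eq_complex /=.
by rewrite (raddf_sum (@complex.Re R)) (raddf_sum (@complex.Im R)) !eqxx.
Qed.

Lemma mem_pairs (W : choiceType) (s : seq V) (t : seq W) x y :
  ((x, y) \in [seq (a, b) | a <- s, b <- t]) = (x \in s) && (y \in t).
Proof.
apply/allpairsP/andP => [[[a b] /= [sa tb [-> ->]]] //|[sx ty]].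
by exists (x, y).
Qed.

End FiniteSums.

Section GraphForm.
Context {R : realType} {V : countType} {G : wgraph R V} (th : potential G).
Implicit Types (f h : V -> R[i]).

Let m := weight G.

Definition weight_ge0 x : 0 <= weight G x := ltW (weight_gt0 G x).

(** Ordered pairs count each edge twice, hence the half: the form becomes the squared norm of [dd f]
    for this weight. *)
Definition edgew (p : V * V) : R := edge G p.1 p.2 / 2.

Lemma edgew_ge0 p : 0 <= edgew p.
Proof. by rewrite divr_ge0 ?edge_ge0. Qed.

Definition dd f (p : V * V) : R[i] := f p.1 - cexp (th p.1 p.2) * f p.2.

Local Notation H := (L2 weight_ge0).
Local Notation K := (L2 edgew_ge0).
Local Notation d := (l2_hilbert weight_ge0).
Local Notation dK := (l2_hilbert edgew_ge0).

Lemma ddE f x y : dd f (x, y) = f x - cexp (th x y) * f y.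
Proof. by []. Qed.

Lemma CcP f : Cc f <-> exists s : seq V, uniq s /\ forall x, x \notin s -> f x = 0.
Proof.
split=> [/finite_seqP[s es]|[s [us h]]].
  exists (undup s); split; first exact: undup_uniq.
  move=> x; rewrite mem_undup => xs; apply/eqP; rewrite -[_ == _]negbK.
  apply/negP => fx; move/negP: xs; apply.
  by have : [set x | f x != 0] x by []; rewrite es.
apply: (@sub_finite_set _ _ [set` s]) => [x /= fx|]; last by apply/finite_seqP; exists s.
by apply: contraNT fx => /h ->.
Qed.

Lemma CcD f h : Cc f -> Cc h -> Cc (fun x => f x + h x).
Proof.
move=> /CcP[s [_ fs]] /CcP[s' [_ hs]]; apply/CcP; exists (undup (s ++ s')).
split=> [|x]; first exact: undup_uniq.
by rewrite mem_undup mem_cat negb_or => /andP[/fs -> /hs ->]; rewrite addr0.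
Qed.

Lemma neighbourhood (s : seq V) : exists t : seq V, [/\ uniq t,
  {subset s <= t} & forall x y, x \in s -> edge G x y != 0 -> y \in t].
Proof.
suff [t [st tN]] : exists t : seq V, {subset s <= t} /\
    forall x y, x \in s -> edge G x y != 0 -> y \in t.
  exists (undup t); split; first exact: undup_uniq.
    by move=> x /st; rewrite mem_undup.
  by move=> x y xs xy; rewrite mem_undup; exact: tN xs xy.
elim: s => [|a s [t [st tN]]]; first by exists [::].
have /finite_seqP[u eu] := edge_locally_finite G a.
exists (a :: u ++ t); split=> [x|x y].
  rewrite !inE mem_cat => /predU1P[->|/st ->]; first by rewrite eqxx.
  by rewrite !orbT.
rewrite !inE mem_cat => /predU1P[->|xs] xy; last by rewrite (tN _ _ xs xy) !orbT.
have : [set y | 0 < edge G a y] y by rewrite /= lt_neqAle eq_sym xy edge_ge0.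
by rewrite eu /= => ->; rewrite orbT.
Qed.

(** [t] contains the supports and all their neighbours. A pair not inside [t] is then a non-edge or
    has both ends outside the supports. *)
Lemma dd_support f h : Cc f -> Cc h -> exists t : seq V,
  [/\ uniq t, forall x, x \notin t -> f x = 0, forall x, x \notin t -> h x = 0 &
  forall x y, (x \notin t) || (y \notin t) -> edge G x y = 0 \/
   [/\ f x = 0, f y = 0, h x = 0 & h y = 0]].
Proof.
move=> /CcP[s [us fs]] /CcP[s' [us' hs]].
have [t [ut st tN]] := neighbourhood (s ++ s').
have out x : x \notin s ++ s' -> f x = 0 /\ h x = 0.
  by rewrite mem_cat negb_or => /andP[/fs -> /hs ->].
exists t; split=> // [x xt|x xt|x y xy].
- by have [] := out x (contra (@st x) xt).
- by have [] := out x (contra (@st x) xt).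
have [xs|xs] := boolP (x \in s ++ s').
  left; apply/eqP; apply: contraLR xy => xy; rewrite negb_or !negbK.
  by rewrite (st _ xs) (tN _ _ xs xy).
have [ys|ys] := boolP (y \in s ++ s').
  left; apply/eqP; apply: contraLR xy => xy; rewrite negb_or !negbK.
  by rewrite (st _ ys) andbT (tN _ _ ys)// edge_sym.
by right; have [-> ->] := out x xs; have [-> ->] := out y ys.
Qed.

Lemma Cc_l2 f : Cc f -> l2 m f.
Proof.
move=> /CcP[s [us fs]]; rewrite l2E.
apply: (@sumable_fin _ _ _ s) => x; first by rewrite mulr_ge0 ?weight_ge0 ?sqc_ge0.
by move=> /fs ->; rewrite sqc0 mulr0.
Qed.

Lemma dd0 f x y : f x = 0 -> f y = 0 -> dd f (x, y) = 0.
Proof. by rewrite /dd /= => -> ->; rewrite mulr0 subrr. Qed.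

Lemma Cc_ddl2 f : Cc f -> l2 edgew (dd f).
Proof.
move=> Cf; have [t [ut _ _ h]] := dd_support Cf Cf; rewrite l2E.
apply: (@sumable_fin _ _ _ [seq (x, y) | x <- t, y <- t]) => [[x y]|[x y]].
  by rewrite mulr_ge0 ?edgew_ge0 ?sqc_ge0.
rewrite mem_pairs negb_and => /h[e|[fx fy _ _]]; first by rewrite /edgew /= e !mul0r.
by rewrite dd0// sqc0 mulr0.
Qed.

Lemma formQE f h : Cc f -> Cc h -> formQ th f h = inner edgew (dd f) (dd h).
Proof.
move=> Cf Ch; have [t [ut _ _ sup]] := dd_support Cf Ch.
pose F x y : R[i] := (edge G x y)%:C%C * dd f (x, y) * (dd h (x, y))^*%C.
have F0 x y : (x \notin t) || (y \notin t) -> F x y = 0.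
  move=> /sup[e|[fx fy hx hy]]; first by rewrite /F e !mul0r.
  by rewrite /F dd0// mulr0 mul0r.
rewrite /formQ; transitivity (2^-1 * \sum_(x <- t) \sum_(y <- t) F x y).
  congr (_ * _).
  transitivity (\sum_(x \in [set: V]) \sum_(y <- t) F x y).
    by apply: eq_fsbigr => x _; apply: fsbig_seqT => // y yt;
      apply: F0; rewrite yt orbT.
  by apply: fsbig_seqT => // x xt; apply: big1 => y _; apply: F0; rewrite xt.
rewrite /inner (csum_seq (s := [seq (x, y) | x <- t, y <- t])).
- rewrite big_allpairs_dep mulr_sumr; apply: eq_bigr => x _.
  rewrite mulr_sumr; apply: eq_bigr => y _; rewrite /F /edgew rmorphM /=.
  have -> : (2^-1)%:C%C = 2^-1 :> R[i] by rewrite fmorphV rmorph_nat.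
  by ring.
- by rewrite allpairs_uniq// => -[? ?] [? ?].
- move=> [x y]; rewrite mem_pairs negb_and => /F0 e.
  have -> : (edgew (x, y))%:C%C * dd f (x, y) * (dd h (x, y))^*%C =
      (2^-1)%:C%C * F x y by rewrite /F /edgew rmorphM /=; ring.
  by rewrite e mulr0.
Qed.

Lemma CcZ (c : R[i]) f : Cc f -> Cc (fun x => c * f x).
Proof. by move=> /CcP[s [us h]]; apply/CcP; exists s; split=> // x /h ->; rewrite mulr0. Qed.

Lemma CcB f h : Cc f -> Cc h -> Cc (f \- h).
Proof.
move=> Cf Ch; have := CcD Cf (CcZ (-1) Ch).
by under eq_fun do rewrite mulN1r.
Qed.

Lemma ddD f h p : dd (fun x => f x + h x) p = dd f p + dd h p.
Proof. by rewrite /dd /=; ring. Qed.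

Lemma ddZ (c : R[i]) f p : dd (fun x => c * f x) p = c * dd f p.
Proof. by rewrite /dd /=; ring. Qed.

Lemma ddB f h p : dd (fun x => f x - h x) p = dd f p - dd h p.
Proof. by rewrite /dd /=; ring. Qed.

Definition dd_graph0 : set (H * K) := [set z : H * K |
  Cc (l2val z.1) /\ forall p, z.2 p = dd z.1 p].
(** The closure of [dd] as a relation. The form on [K] ignores non-edges, so [f] determines the
    second component only up to null vectors. *)
Definition dd_graph : set (H * K) := hclosure (prod_hilbert d dK) dd_graph0.

Lemma dd_graph_subspace : subspace dd_graph.
Proof.
apply: subspace_closure; split=> [|[f k] [f' k'] [/= Cf e] [/= Cf' e']|
  a [f k] [/= Cf e]].
- split; first by apply/CcP; exists [::].
  by move=> p /=; rewrite /dd mulr0 subr0.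
- by split; [exact: CcD|move=> p;
    transitivity (k p + k' p); rewrite // e e' -ddD].
- by split; [exact: CcZ|move=> p;
    transitivity (a%:C%C * k p); rewrite // e -ddZ].
Qed.

Lemma dd_graphB (f : H) (k : K) (f' : H) (k' : K) : dd_graph (f, k) -> dd_graph (f', k') ->
  dd_graph (f - f', k - k').
Proof.
have [_ BD BZ] := dd_graph_subspace => h h'.
rewrite -(scaleN1r f') -(scaleN1r k'); exact: BD _ _ h (BZ (-1) _ h').
Qed.

Lemma dd_graphP (f : H) (k : K) : dd_graph (f, k) <-> exists (u : nat -> H) v,
  [/\ forall n, dd_graph0 (u n, v n), hcvg d u f & hcvg dK v k].
Proof.
split=> [/hclosureP[z [Mz zf]]|[u [v [h uf vk]]]].
  have [uf vk] := prod_hcvg zf.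
  by exists (fun n => (z n).1), (fun n => (z n).2); split=> // n; case: (z n) (Mz n).
move=> e e0; have [N1 h1] := uf _ (divr_gt0 e0 (ltr0Sn _ 1)).
have [N2 h2] := vk _ (divr_gt0 e0 (ltr0Sn _ 1)).
exists (u (maxn N1 N2), v (maxn N1 N2)); first exact: h.
rewrite (hnormB _ (f, k)); apply: le_lt_trans (prod_hnorm_le _ _ _) _ => /=.
by have := h1 _ (leq_maxl N1 N2); have := h2 _ (leq_maxr N1 N2); lra.
Qed.

Lemma dd_graph_closed (u : nat -> H) (v : nat -> K) (f : H) (k : K) : (forall n, dd_graph (u n, v n)) ->
  hcvg d u f -> hcvg dK v k -> dd_graph (f, k).
Proof.
move=> h uf vk; apply: (@hclosed_closure _ _ _ _ (fun n => (u n, v n))) => //.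
move=> e e0; have [N1 h1] := uf _ (divr_gt0 e0 (ltr0Sn _ 1)).
have [N2 h2] := vk _ (divr_gt0 e0 (ltr0Sn _ 1)).
exists (maxn N1 N2) => n; rewrite geq_max => /andP[/h1 a /h2 b].
by apply: le_lt_trans (prod_hnorm_le _ _ _) _ => /=; lra.
Qed.

Lemma hcvg_sqc (W : choiceType) (w : W -> R) (w0 : forall x, 0 <= w x)
    (u : nat -> L2 w0) (f : L2 w0) (x : W) : hcvg (l2_hilbert w0) u f -> 0 < w x ->
  forall e, 0 < e -> exists N, forall n, (N <= n)%N -> sqc (u n x - f x) < e.
Proof.
move=> uf wx e e0.
have s0 : 0 < Num.sqrt (w x * e) by rewrite sqrtr_gt0 mulr_gt0.
have [N hN] := uf _ s0; exists N => n /hN.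
rewrite hnorm_lt ?sqrtr_ge0// sqr_sqrtr; last by rewrite mulr_ge0 ?ltW.
move=> h; rewrite -(ltr_pM2l wx); apply: le_lt_trans h; rewrite l2_dotE.
exact: (wsqc_le_rdot w0 x (l2val_l2 (u n - f))).
Qed.

(** Convergence in both spaces is pointwise at positive weight, so the closure still evaluates to
    [dd f] on edges: [dd] is closable. *)
Lemma dd_graph_dd (f : H) (k : K) : dd_graph (f, k) ->
  forall p, 0 < edgew p -> k p = dd f p.
Proof.
move=> /dd_graphP[u [v [h uf vk]]] [x y] wp; apply/eqP; rewrite -subr_eq0.
apply/eqP/sqc_eq0/eqP; rewrite eq_le sqc_ge0 andbT.
apply/ler_addgt0Pr => e e0; rewrite add0r.
(* Two uses of [|a - b|^2 <= 2 |a|^2 + 2 |b|^2] add up to at most [4 + 4 + 2] times this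
   quantity. *)
have e4 : 0 < e / 12 by rewrite divr_gt0.
have [N1 h1] := hcvg_sqc uf (weight_gt0 G x) e4.
have [N2 h2] := hcvg_sqc uf (weight_gt0 G y) e4.
have [N3 h3] := hcvg_sqc vk wp e4.
pose n := maxn N1 (maxn N2 N3).
have := h1 n (leq_maxl _ _).
have := h2 n (leq_trans (leq_maxl _ _) (leq_maxr _ _)).
have := h3 n (leq_trans (leq_maxr _ _) (leq_maxr _ _)).
have [_ /= e1] := h n.
rewrite e1 => a b c.
have -> : k (x, y) - dd f (x, y) = dd (fun x => u n x - f x) (x, y) -
    (dd (u n) (x, y) - k (x, y)) by rewrite ddB; ring.
apply: le_trans (sqcB_le _ _) _.
have := sqcB_le (u n x - f x) (cexp (th x y) * (u n y - f y)).
by rewrite sqcM sqc_cexp mul1r -/(dd (fun x => u n x - f x) (x, y)); lra.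
Qed.

Lemma dd_graph_l2 (f : H) (k : K) : dd_graph (f, k) -> l2 edgew (dd f) /\
  rdot edgew (dd f) (dd f) = dK k k.
Proof.
move=> h; have e p : edgew p * sqc (dd f p) = edgew p * sqc (k p).
  have := edgew_ge0 p; rewrite le_eqVlt => /predU1P[<-|wp]; first by rewrite !mul0r.
  by rewrite (dd_graph_dd h wp).
split; first by rewrite l2E; apply: sumable_le (l2_sumable (l2val_l2 k)) => p; rewrite e.
by rewrite l2_dotE !rdot_tsum//; try exact: edgew_ge0; congr tsum; apply/funext.
Qed.

Lemma null_dot (k k' : K) : dK k k = 0 -> dK k k' = 0.
Proof.
move=> k0; apply/eqP; rewrite -sqrf_eq0 eq_le sqr_ge0 andbT.
by apply: le_trans (dot_sqr_le _ _ _) _; rewrite k0 mul0r.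
Qed.

Lemma dd_graph0_null (k : K) : dd_graph (0, k) -> dK k k = 0.
Proof.
move=> /dd_graph_l2[_ <-]; rewrite rdot_tsum; last exact: edgew_ge0.
rewrite (@tsum_fin _ _ _ [::]) ?big_nil// => p.
  by rewrite mulr_ge0 ?edgew_ge0 ?sqc_ge0.
by move=> _; rewrite /dd /= mulr0 subrr sqc0 mulr0.
Qed.

Lemma dd_graph_muli (f : H) (k : K) : dd_graph (f, k) -> dd_graph (l2_muli f, l2_muli k).
Proof.
move=> /dd_graphP[u [v [h uf vk]]]; apply/dd_graphP.
exists (fun n => l2_muli (u n)), (fun n => l2_muli (v n)); split=> [n|e e0|e e0].
- by have [/= Cu e] := h n; split=> [|p] /=; [exact: CcZ|rewrite e -ddZ].
- have [N hN] := uf _ e0; exists N => n /hN.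
  by rewrite -(hlinearB _ _ (l2_muli_linear _)) hnorm_muli.
- have [N hN] := vk _ e0; exists N => n /hN.
  by rewrite -(hlinearB _ _ (l2_muli_linear _)) hnorm_muli.
Qed.

End GraphForm.

Arguments edgew {R V} G p.
Arguments edgew_ge0 {R V} G p.
Arguments weight_ge0 {R V} G x.

Lemma hcvg_dot2 (R : realType) (H : lmodType R) (d : hilbert H) u v x y :
  hcvg d u x -> hcvg d v y -> (fun n => d (u n) (v n)) @ \oo --> d x y.
Proof.
move=> ux vy; apply/cvgrPdist_lt => e e0.
have x1 : 0 < 2 * (hnorm d x + hnorm d y + 1).
  by have := hnorm_ge0 d x; have := hnorm_ge0 d y; lra.
have a0 : 0 < Num.min 1 (e / (2 * (hnorm d x + hnorm d y + 1))).
  by rewrite lt_min ltr01 divr_gt0.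
have [N1 h1] := ux _ a0; have [N2 h2] := vy _ a0.
exists (maxn N1 N2) => // n; rewrite /= geq_max => /andP[/h1 + /h2].
rewrite !lt_min !ltr_pdivlMr// => /andP[a1 a2] /andP[b1 b2].
rewrite distrC.
have -> : d (u n) (v n) - d x y =
    d (u n - x) (v n - y) + (d (u n - x) y + d x (v n - y)).
  by rewrite !dotE; ring.
have n1 := hnorm_ge0 d (u n - x); have n2 := hnorm_ge0 d (v n - y).
apply: le_lt_trans (ler_normD _ _) _.
apply: le_lt_trans (lerD (lexx _) (ler_normD _ _)) _.
have := dot_le d (u n - x) (v n - y); have := dot_le d (u n - x) y.
have := dot_le d x (v n - y); have := hnorm_ge0 d x; have := hnorm_ge0 d y.
by nra.
Qed.

Section ComplexExponential.
Context {R : realType}.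
Implicit Types (s t : R) (z : R[i]).

Lemma cexpD s t : cexp (s + t) = cexp s * cexp t :> R[i].
Proof.
by apply/eqP; rewrite eq_complex /= cosD sinD; apply/andP; split; apply/eqP; ring.
Qed.

Lemma cexp0 : cexp 0 = 1 :> R[i].
Proof. by rewrite /cexp cos0 sin0. Qed.

Lemma cexpN t : cexp (- t) = (cexp t)^*%C.
Proof. by rewrite /cexp cosN sinN. Qed.

Lemma cexp_nat2pi (n : nat) : cexp (n%:R * (2 * pi)) = 1 :> R[i].
Proof.
elim: n => [|n IH]; first by rewrite mul0r cexp0.
rewrite -natr1 mulrDl mul1r cexpD IH mul1r /cexp.
by rewrite mulr_natl cos2pi sin2pi.
Qed.

Lemma cexp_int2pi (k : int) : cexp (k%:~R * (2 * pi)) = 1 :> R[i].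
Proof.
case: k => n; first exact: cexp_nat2pi.
by rewrite NegzE mulrNz mulNr cexpN cexp_nat2pi conjc1.
Qed.

Lemma cexp_eq2pi s t : eq2pi s t -> cexp s = cexp t.
Proof. by move=> [k e]; rewrite -(subrK t s) e cexpD cexp_int2pi mul1r. Qed.

(** Reduce [t] to [s] in [[0, 2 pi)]; then [cos s = 1 - 2 sin (s / 2)^2] excludes [s > 0], where
    [sin (s / 2)] is positive. *)
Lemma cexp_eq1 t : cexp t = 1 -> eq2pi t 0.
Proof.
pose k := Num.floor (t / (2 * pi)); pose s := t - k%:~R * (2 * pi).
have pi2 : 0 < 2 * pi :> R by rewrite mulr_gt0 ?pi_gt0.
have s0 : 0 <= s.
  by rewrite subr_ge0 -ler_pdivlMr// floor_le.
have s1 : s < 2 * pi.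
  rewrite ltrBlDr -[X in X + _]mul1r -mulrDl -ltr_pdivrMr// addrC.
  by rewrite -[1]/(1%:~R) -intrD floorD1_gt.
move=> et; have : cexp s = 1.
  by rewrite /s cexpD -mulNr -mulrNz cexp_int2pi et mulr1.
move=> [cs _]; exists k; rewrite subr0.
suff s00 : s = 0 by apply/eqP; rewrite -subr_eq0 -/s s00.
apply/eqP; rewrite eq_le s0 andbT leNgt; apply/negP => sp.
have : 0 < sin (s / 2) by apply: sin_gt0_pi; rewrite divr_gt0//= ltr_pdivrMr// mulrC.
have : cos s = 1 - 2 * sin (s / 2) ^+ 2.
  rewrite {1}(splitr s) cosD -!expr2; have := cos2Dsin2 (s / 2); lra.
by rewrite cs => e1 e2; have := exprn_gt0 2 e2; lra.
Qed.

End ComplexExponential.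

Section NormcConvergence.
Context {R : realType}.

Lemma normc_nneg (z : R[i]) : 0 <= Normc.normc z.
Proof. by case: z => a b; exact: sqrtr_ge0. Qed.

Lemma Re_le_normc (z : R[i]) : `|complex.Re z| <= Normc.normc z.
Proof.
by case: z => a b /=; rewrite -sqrtr_sqr ler_wsqrtr// lerDl sqr_ge0.
Qed.

Lemma Im_le_normc (z : R[i]) : `|complex.Im z| <= Normc.normc z.
Proof. by case: z => a b /=; rewrite -sqrtr_sqr ler_wsqrtr// lerDr sqr_ge0. Qed.

Lemma normc_le (z : R[i]) : Normc.normc z <= `|complex.Re z| + `|complex.Im z|.
Proof.
case: z => a b /=; rewrite -ler_sqr ?nnegrE ?sqrtr_ge0 ?addr_ge0//.
rewrite sqr_sqrtr ?addr_ge0 ?sqr_ge0// sqrrD !real_normK ?num_real//.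
by have := normr_ge0 a; have := normr_ge0 b; nra.
Qed.

Lemma cvg_normcP (a : nat -> R[i]) z :
  Normc.normc (a n - z) @[n --> \oo] --> (0 : R) <->
  (complex.Re (a n) @[n --> \oo] --> complex.Re z /\
   complex.Im (a n) @[n --> \oo] --> complex.Im z).
Proof.
have reB (x y : R[i]) : complex.Re (x - y) = complex.Re x - complex.Re y by exact: raddfB.
have imB (x y : R[i]) : complex.Im (x - y) = complex.Im x - complex.Im y by exact: raddfB.
split=> [h|[h1 h2]].
  split; apply/cvgrPdist_lt => e e0;
    move/cvgrPdist_lt : h => /(_ e e0)[N _ hN]; exists N => // n /hN;
    rewrite /= sub0r normrN (ger0_norm (normc_nneg _)) distrC => k.
  - by rewrite -reB; apply: le_lt_trans k; exact: Re_le_normc.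
  - by rewrite -imB; apply: le_lt_trans k; exact: Im_le_normc.
apply: (@squeeze_cvgr _ _ _ _ (fun=> 0)
  (fun n => `|complex.Re (a n) - complex.Re z| + `|complex.Im (a n) - complex.Im z|)).
- by near=> n; rewrite -reB -imB normc_le andbT; exact: normc_nneg.
- exact: cvg_cst.
- rewrite -(addr0 0); apply: cvgD; rewrite -(@normr0 _ R).
    by apply: cvg_norm; rewrite -(subrr (complex.Re z)); apply: cvgB => //; exact: cvg_cst.
  by apply: cvg_norm; rewrite -(subrr (complex.Im z)); apply: cvgB => //; exact: cvg_cst.
Unshelve. all: by end_near.
Qed.

End NormcConvergence.

Section GraphLaplacian.
Context {R : realType} {V : countType} {G : wgraph R V} (th : potential G).
Implicit Types (f h : V -> R[i]).

Local Notation H := (L2 (@weight_ge0 R V G)).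
Local Notation K := (L2 (@edgew_ge0 R V G)).
Local Notation d := (l2_hilbert (@weight_ge0 R V G)).
Local Notation dK := (l2_hilbert (@edgew_ge0 R V G)).
Local Notation m := (weight G).
Local Notation dd := (dd th).

(** A form-Cauchy sequence has Cauchy images under [dd], which converge because [K] is complete. *)
Lemma form_approxP (u : nat -> V -> R[i]) (f : H) : form_approx th u f ->
  exists (U : nat -> H) (W : nat -> K) (k : K),
  [/\ forall n, u n = l2val (U n), forall n, dd_graph0 th (U n, W n),
    hcvg d U f & hcvg dK W k].
Proof.
move=> [Cu lf uf cu].
pose U n : H := l2mk (@weight_ge0 R V G) (Cc_l2 (Cu n)).
pose W n : K := l2mk (@edgew_ge0 R V G) (Cc_ddl2 th (Cu n)).
have cW : hcauchy dK W.
  move=> e e0; have [N hN] := cu _ (exprn_gt0 2 e0); exists N => n k Nn Nk.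
  have := hN n k Nn Nk; rewrite hnorm_lt ?(ltW e0)// l2_dotE.
  rewrite (formQE th (CcB (Cu n) (Cu k)) (CcB (Cu n) (Cu k))) inner_rdot /=.
  have -> // : dd (u n \- u k) = (W n - W k).
  by apply/funext => p; exact: ddB.
have [k Wk] := dot_complete cW.
by exists U, W, k; split=> //; [move=> n; split=> //; exact: Cu|exact/l2cvgP].
Qed.

Lemma form_approx_intro (u : nat -> H) (v : nat -> K) (f : H) (k : K) :
  (forall n, dd_graph0 th (u n, v n)) -> hcvg d u f -> hcvg dK v k ->
  form_approx th (fun n => l2val (u n)) f.
Proof.
move=> h uf vk; split=> [n| | |e e0].
- by have [] := h n.
- exact: l2val_l2.
- exact/l2cvgP.
- have s0 : 0 < Num.sqrt e by rewrite sqrtr_gt0.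
  have [N hN] := hcvg_cauchy vk s0; exists N => n j Nn Nj.
  have := hN n j Nn Nj; rewrite hnorm_lt ?sqrtr_ge0// sqr_sqrtr ?(ltW e0)//.
  have [[/= Cn en] [/= Cj ej]] := (h n, h j).
  rewrite (formQE th (CcB Cn Cj) (CcB Cn Cj)) inner_rdot /= l2_dotE.
  have -> // : dd (l2val (u n) \- u j) = (v n - v j).
  by apply/funext => p; transitivity (v n p - v j p); rewrite // en ej -ddB.
Qed.

Lemma form_domP (f : H) : form_dom th f <-> exists k, dd_graph th (f, k).
Proof.
split=> [[u /form_approxP[U [W [k [_ h Uf Wk]]]]]|[k /dd_graphP[u [v [h uf vk]]]]].
  by exists k; apply/dd_graphP; exists U, W.
by exists (fun n => l2val (u n)); exact: form_approx_intro h uf vk.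
Qed.

Lemma dd_graph_unique (f : H) (k k' j : K) :
  dd_graph th (f, k) -> dd_graph th (f, k') -> dK k j = dK k' j.
Proof.
move=> h h'; have := dd_graphB h h'; rewrite subrr => /dd_graph0_null e.
by apply/eqP; rewrite -subr_eq0 -dotBl (null_dot _ e).
Qed.

(** The value is independent of the approximating sequences, because two lifts of one function
    differ by a null vector. *)
Lemma form_closureP (f h : H) (k k' : K) z :
  dd_graph th (f, k) -> dd_graph th (h, k') ->
  form_closure th f h z <-> z = inner (@edgew R V G) k k'.
Proof.
move=> fk hk.
have inK (a b : K) : inner (@edgew R V G) a b = Complex (dK a b) (dK a (l2_muli b)).
  exact: inner_dot.
have mulicvg (W : nat -> K) a : hcvg dK W a ->
    hcvg dK (fun n => l2_muli (W n)) (l2_muli a).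
  move=> Wa e e0; have [N hN] := Wa e e0; exists N => n /hN.
  by rewrite -(hlinearB _ _ (l2_muli_linear _)) hnorm_muli.
have key (a b : nat -> K) (a' b' : K) : hcvg dK a a' -> hcvg dK b b' ->
    (complex.Re (inner (@edgew R V G) (a n) (b n)) @[n --> \oo] -->
      complex.Re (inner (@edgew R V G) a' b') /\
    complex.Im (inner (@edgew R V G) (a n) (b n)) @[n --> \oo] -->
      complex.Im (inner (@edgew R V G) a' b')).
  move=> aa bb; rewrite inK /=; split.
    have -> : (fun n => complex.Re (inner (@edgew R V G) (a n) (b n))) =
        (fun n => dK (a n) (b n)) by apply/funext => n; rewrite inK.
    exact: hcvg_dot2.
  have -> : (fun n => complex.Im (inner (@edgew R V G) (a n) (b n))) =
      (fun n => dK (a n) (l2_muli (b n))) by apply/funext => n; rewrite inK.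
  by apply: hcvg_dot2 => //; exact: mulicvg.
have formE (U : nat -> H) (W : nat -> K) (U' : nat -> H) (W' : nat -> K) n :
    dd_graph0 th (U n, W n) -> dd_graph0 th (U' n, W' n) ->
    formQ th (U n) (U' n) = inner (@edgew R V G) (W n) (W' n).
  move=> [/= C e] [/= C' e']; rewrite formQE//.
  have -> : dd (U n) = l2val (W n) by apply/funext => p; rewrite e.
  by have -> : dd (U' n) = l2val (W' n) by apply/funext => p; rewrite e'.
split=> [[u [v [/form_approxP[U [W [k1 [uU UW Uf Wk]]]]
    /form_approxP[U' [W' [k1' [vU UW' Uh Wk']]]]]]]|->].
  have -> : (fun n => Normc.normc (formQ th (u n) (v n) - z)) =
      (fun n => Normc.normc (inner (@edgew R V G) (W n) (W' n) - z)).
    by apply/funext => n; rewrite uU vU (formE U W U' W').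
  move=> /cvg_normcP[c1 c2]; have [c3 c4] := key _ _ _ _ Wk Wk'.
  have fk1 : dd_graph th (f, k1) by apply/dd_graphP; exists U, W.
  have hk1 : dd_graph th (h, k1') by apply/dd_graphP; exists U', W'.
  transitivity (inner (@edgew R V G) k1 k1').
    by apply/eqP; rewrite eq_complex; apply/andP; split; apply/eqP;
      [exact: cvg_unique c1 c3|exact: cvg_unique c2 c4].
  rewrite !inK (dd_graph_unique _ fk1 fk) (dd_graph_unique _ fk1 fk).
  rewrite ![dK k _]dotC (dd_graph_unique _ hk1 hk).
  by rewrite (dd_graph_unique _ (dd_graph_muli hk1) (dd_graph_muli hk)).
have [U [W [UW Uf Wk]]] := (dd_graphP th f k).1 fk.
have [U' [W' [UW' Uh Wk']]] := (dd_graphP th h k').1 hk.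
exists (fun n => l2val (U n)), (fun n => l2val (U' n)); split.
- exact: form_approx_intro UW Uf Wk.
- exact: form_approx_intro UW' Uh Wk'.
- have -> : (fun n => Normc.normc (formQ th (U n) (U' n) -
        inner (@edgew R V G) k k')) = (fun n => Normc.normc
      (inner (@edgew R V G) (W n) (W' n) - inner (@edgew R V G) k k')).
    by apply/funext => n; rewrite (formE U W U' W').
  by apply/cvg_normcP; exact: key.
Qed.

Lemma form_dom_l2 f : form_dom th f -> l2 m f.
Proof. by move=> [u []]. Qed.

Lemma laplacianP (f g : H) : laplacian th (l2val f, l2val g) <->
  exists2 k, dd_graph th (f, k) &
    forall (h : H) (k' : K), dd_graph th (h, k') -> d g h = dK k k'.
Proof.
split=> [[/= /form_domP[k fk] _ h]|[k fk h]].
  exists k => // h' k' hk'.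
  have /(form_closureP _ fk hk') : form_closure th f h' (inner m g h').
    by apply: h; apply/form_domP; exists k'.
  rewrite (inner_dot g h') (inner_dot k k'); by case.
split=> /=; [by apply/form_domP; exists k|exact: l2val_l2|].
move=> h' fh'; have lh' := form_dom_l2 fh'.
have /(form_domP (l2mk (@weight_ge0 R V G) lh'))[k' hk'] := fh'.
apply/(form_closureP (h := l2mk (@weight_ge0 R V G) lh') _ fk hk').
rewrite (inner_dot g (l2mk (@weight_ge0 R V G) lh')) (inner_dot k k').
by rewrite (h _ _ hk') (h _ _ (dd_graph_muli hk')).
Qed.

Lemma rel_laplacianP (f g : H) : rel_of (laplacian th) (f, g) <->
  exists2 k, dd_graph th (f, k) &
    forall (h : H) (k' : K), dd_graph th (h, k') -> d g h = dK k k'.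
Proof. exact: laplacianP. Qed.

Lemma delta_Cc x (c : R[i]) : Cc (fun y : V => if y == x then c else 0).
Proof.
apply/CcP; exists [:: x]; split=> // y; by rewrite inE => /negbTE ->.
Qed.

Lemma Cc_dd_graph0 f (Cf : Cc f) :
  dd_graph0 th (l2mk (@weight_ge0 R V G) (Cc_l2 Cf),
                l2mk (@edgew_ge0 R V G) (Cc_ddl2 th Cf)).
Proof. by split. Qed.

Lemma laplacian_positive : positive_sa (@weight_ge0 R V G) (laplacian th).
Proof.
have [D0 DD DZ] := dd_graph_subspace th.
split.
- by move=> f g [/= ff lg _]; split=> //; exact: form_dom_l2 ff.
- split.
  + split.
    * suff : rel_of (laplacian th) ((0, 0) : H * H) by [].
      apply/rel_laplacianP; exists 0 => // h k' _; by rewrite !dot0l.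
    * move=> [f g] [f' g'] /rel_laplacianP[k fk h] /rel_laplacianP[k' fk' h'].
      suff : rel_of (laplacian th) (f + f', g + g') by [].
      apply/rel_laplacianP; exists (k + k'); first exact: DD _ _ fk fk'.
      by move=> x y xy; rewrite !dotDl (h _ _ xy) (h' _ _ xy).
    * move=> a [f g] /rel_laplacianP[k fk h].
      suff : rel_of (laplacian th) (a *: f, a *: g) by [].
      apply/rel_laplacianP; exists (a *: k); first exact: DZ a _ fk.
      by move=> x y xy; rewrite !dotZl (h _ _ xy).
  + move=> f g f' g' /rel_laplacianP[k fk h] /rel_laplacianP[k' fk' h'].
    by rewrite (h _ _ fk') [RHS]dotC (h' _ _ fk) dotC.
  + by move=> f g /rel_laplacianP[k fk h]; rewrite (h _ _ fk) dot_ge0.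
  (* Projecting [(u, 0)] onto the closed graph leaves the residual [(u - f, - k)], whose
     orthogonality to the graph is the weak equation [Delta f = u - f]. *)
  + move=> u; have [[f k] fk hp] := projection (d := prod_hilbert d dK) (u, 0)
      (dd_graph_subspace th) (@hclosed_closure _ _ _ _).
    exists f, (u - f); split; last by rewrite subrKC.
    apply/rel_laplacianP; exists k => // h k' hk'.
    have e : d (u - f) h + dK (0 - k) k' = 0 := hp _ hk'.
    by move: e; rewrite sub0r dotNl => /eqP; rewrite subr_eq0 => /eqP.
- move=> f g /rel_laplacianP[k fk h]; apply/rel_laplacianP.
  exists (l2_muli k); first exact: dd_graph_muli.
  move=> x y xy; have := h _ _ (dd_graph_muli xy); rewrite !rdot_muli.
  exact: oppr_inj.
- move=> g /rel_laplacianP[k gk h]; apply: l2_inj => x.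
  (* [k] is null, so [g] is orthogonal to the form domain; a point mass with value [g x] isolates
     the coordinate. *)
  have C := delta_Cc x (g x).
  have := h _ _ (sub_hclosure _ (Cc_dd_graph0 C)).
  rewrite (null_dot _ (dd_graph0_null gk)) l2_dotE /rdot.
  rewrite (rsum_seq (s := [:: x])) //= => [|y]; last first.
    by rewrite inE => /negbTE ->; rewrite re2C /re2 /= !mul0r addr0 mulr0.
  by rewrite big_seq1 eqxx re2zz => /eqP; rewrite mulf_eq0 gt_eqF ?weight_gt0//=
    => /eqP/sqc_eq0.
Qed.

(** With [B] the closure of [dd], [posop_form_dom] gives the form domain the same description that
    it gave the domain of a square root. *)
Lemma sqrt_dom_laplacian : sqrt_dom m (laplacian th) = form_dom th.
Proof.
have [D0 DD DZ] := dd_graph_subspace th.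
apply: (sqrt_dom_form (@weight_gt0 R V G) laplacian_positive).
  by move=> f; exact: form_dom_l2.
move=> f; rewrite form_domP.
apply: (posop_form_dom (@l2_definite _ _ _ (@weight_ge0 R V G) (@weight_gt0 R V G))
  (possa_posop laplacian_positive) (B := dd_graph th)).
- exact: dd_graph_subspace.
- by move=> u v x y; exact: dd_graph_closed.
- by move=> a b /rel_laplacianP[k ak h]; exists k.
Qed.

Definition lapfun f (x : V) : R[i] :=
  ((m x)^-1)%:C%C * \sum_(y \in [set: V]) (edge G x y)%:C%C * dd f (x, y).

Lemma Cc_lapfun f : Cc f -> Cc (lapfun f).
Proof.
move=> Cf; have [t [ut ft _ h]] := dd_support (G := G) Cf Cf.
apply/CcP; exists t; split=> // x xt.
rewrite /lapfun fsbig1 ?mulr0// => y _.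
have [|->|[fx fy _ _]] := h x y; rewrite ?xt ?mul0r//.
by rewrite dd0// mulr0.
Qed.

Lemma re2_sum (T : Type) (s : seq T) (F : T -> R[i]) z :
  re2 (\sum_(x <- s) F x) z = \sum_(x <- s) re2 (F x) z.
Proof.
elim/big_rec2: _ => [|x a b _ <-]; first by rewrite /re2 /= !mul0r addr0.
by rewrite re2Dl.
Qed.

(** The phase is unimodular and antisymmetric, so [dd f (x, y)] is [- cexp (th x y)] times
    [dd f (y, x)]. *)
Lemma dd_flip f h x y :
  re2 (dd f (x, y)) (cexp (th x y) * h y) = - re2 (dd f (y, x)) (h y).
Proof.
rewrite !ddE (cexp_eq2pi (theta_antisym th y x)) cexpN.
have := sqc_cexp (th x y); case: (cexp (th x y)) => a b; rewrite /sqc /=.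
case: (f x) (f y) (h y) => [c c'] [e e'] [g g']; rewrite /re2 /= => ab.
transitivity ((a * c + b * c') * g + (a * c' - b * c) * g' -
  (a ^+ 2 + b ^+ 2) * (e * g + e' * g')); first by ring.
by rewrite ab; ring.
Qed.

Lemma green_Cc f h : Cc f -> Cc h ->
  rdot m (lapfun f) h = rdot (@edgew R V G) (dd f) (dd h).
Proof.
move=> Cf Ch; have [t [ut ft ht sup]] := dd_support (G := G) Cf Ch.
have Fsup x y : (x \notin t) || (y \notin t) ->
    (edge G x y)%:C%C * dd f (x, y) = 0.
  by move=> /sup[->|[fx fy _ _]]; rewrite ?mul0r// dd0// mulr0.
pose T x y := edge G x y * re2 (dd f (x, y)) (h x).
have Tsup x y : (x \notin t) || (y \notin t) ->
    (@edgew R V G) (x, y) * re2 (dd f (x, y)) (dd h (x, y)) = 0.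
  move=> /sup[e|[fx fy hx hy]]; first by rewrite /edgew /= e !mul0r.
  by rewrite (dd0 th fx fy) /re2 /= !mul0r addr0 mulr0.
transitivity (\sum_(x <- t) \sum_(y <- t) T x y).
  rewrite /rdot (rsum_seq ut) => [|x xt]; last first.
    by rewrite ht// re2C /re2 /= !mul0r addr0 mulr0.
  apply: eq_bigr => x _; rewrite /lapfun (fsbig_seqT ut) => [|y yt]; last first.
    by apply: Fsup; rewrite yt orbT.
  rewrite re2Zl mulrA mulfV ?gt_eqF ?weight_gt0// mul1r re2_sum.
  by apply: eq_bigr => y _; rewrite re2Zl.
rewrite /rdot (rsum_seq (s := [seq (x, y) | x <- t, y <- t])).
- rewrite big_allpairs_dep /=.
  (* Half of the sum is re-indexed by exchanging [x] and [y], so that [dd_flip] matches the two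
     orientations of each edge. *)
  transitivity (2^-1 * (\sum_(x <- t) \sum_(y <- t) T x y) +
      2^-1 * (\sum_(x <- t) \sum_(y <- t) T y x)).
    rewrite [X in _ + _ * X]exchange_big /=.
    by field.
  rewrite !mulr_sumr -big_split; apply: eq_bigr => x _ /=.
  rewrite !mulr_sumr -big_split; apply: eq_bigr => y _ /=.
  rewrite /edgew /T /= (edge_sym G y x).
  have -> : re2 (dd f (x, y)) (dd h (x, y)) =
      re2 (dd f (x, y)) (h x) + re2 (dd f (y, x)) (h y).
    rewrite -[re2 (dd f (y, x)) (h y)]opprK -dd_flip re2C re2Dl; congr (_ + _).
      by rewrite re2C.
    by rewrite re2C /re2 /=; ring.
  by ring.
- by rewrite allpairs_uniq// => -[? ?] [? ?].
- by move=> [x y]; rewrite mem_pairs negb_and => /Tsup.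
Qed.

Lemma Cc_laplacian f : Cc f -> laplacian th (f, lapfun f).
Proof.
move=> Cf; have CL := Cc_lapfun Cf.
apply: (laplacianP (l2mk (@weight_ge0 R V G) (Cc_l2 Cf))
  (l2mk (@weight_ge0 R V G) (Cc_l2 CL))).2.
exists (l2mk (@edgew_ge0 R V G) (Cc_ddl2 th Cf)).
  exact: sub_hclosure (Cc_dd_graph0 Cf).
move=> h k' /dd_graphP[u [v [uv uh vk]]].
have cst (L : lmodType R) (e : hilbert L) a : hcvg e (fun=> a) a.
  by move=> t t0; exists 0%N => n _; rewrite subrr hnorm0.
have c1 := hcvg_dot2 (cst _ d (l2mk (@weight_ge0 R V G) (Cc_l2 CL))) uh.
have c2 := hcvg_dot2 (cst _ dK (l2mk (@edgew_ge0 R V G) (Cc_ddl2 th Cf))) vk.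
suff e : (fun n => d (l2mk (@weight_ge0 R V G) (Cc_l2 CL)) (u n)) =
    (fun n => dK (l2mk (@edgew_ge0 R V G) (Cc_ddl2 th Cf)) (v n)).
  by rewrite e in c1; exact: cvg_unique c1 c2.
apply/funext => n; rewrite !l2_dotE /= (green_Cc Cf (uv n).1).
have -> // : dd (l2val (u n)) = l2val (v n).
by apply/funext => p; rewrite (uv n).2.
Qed.

End GraphLaplacian.

(** * Finite graphs and holonomy *)

Lemma sum_subset_le (R : realType) (T : eqType) (s t : seq T) (F : T -> R) :
  (forall x, 0 <= F x) -> uniq s -> {subset s <= t} ->
  \sum_(x <- s) F x <= \sum_(x <- t) F x.
Proof.
move=> F0 us st; apply: (@le_trans _ _ (\sum_(x <- undup t) F x)).
  rewrite [leRHS](bigID (fun x => x \in s)) /= -[X in _ <= X + _]big_filter.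
  rewrite (perm_big [seq x <- undup t | x \in s]) ?lerDl ?sumr_ge0//.
  apply: uniq_perm; rewrite ?filter_uniq ?undup_uniq// => x.
  rewrite mem_filter mem_undup; case: (boolP (x \in s)) => //= /st ->.
  by [].
elim: t {st} => [|a t IH] /=; first by [].
case: ifP => _; rewrite big_cons; first by apply: le_trans IH _; rewrite lerDr.
by rewrite big_cons lerD2l.
Qed.

Lemma sum_ge1 (R : realType) (T : eqType) (s : seq T) (F : T -> R) x :
  (forall x, 0 <= F x) -> x \in s -> F x <= \sum_(y <- s) F y.
Proof.
move=> F0 xs; have := @sum_subset_le R T [:: x] s F F0 isT.
by rewrite big_seq1; apply=> y; rewrite inE => /eqP ->.
Qed.

Lemma uniform_bound (R : realType) (T : eqType) (X : Type) (s : seq T)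
    (A : T -> X -> R) (B : X -> R) : (forall g, 0 <= B g) ->
  (forall y, exists2 C : R, 0 <= C & forall g, A y g <= C * B g) ->
  exists2 C : R, 0 <= C & forall y g, y \in s -> A y g <= C * B g.
Proof.
move=> B0 h.
elim: s => [|a s [C C0 hC]]; first by exists 0.
have [D D0 hD] := h a; exists (C + D); first by rewrite addr_ge0.
move=> y g; rewrite inE mulrDl => /predU1P[->|ys].
  by apply: le_trans (hD g) _; rewrite lerDr mulr_ge0.
by apply: le_trans (hC y g ys) _; rewrite lerDl mulr_ge0.
Qed.

Section FiniteGraph.
Context {R : realType} {V : countType} {G : wgraph R V} (th : potential G).
Context (s : seq V) (us : uniq s) (sV : forall y, y \in s).
Implicit Types (g : V -> R[i]).

Definition energy g : R :=
  \sum_(y <- s) \sum_(z <- s) edgew G (y, z) * sqc (dd th g (y, z)).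

Let term_ge0 g p : 0 <= edgew G p * sqc (dd th g p).
Proof. by rewrite mulr_ge0 ?edgew_ge0 ?sqc_ge0. Qed.

Lemma energy_ge0 g : 0 <= energy g.
Proof. by apply: sumr_ge0 => y _; apply: sumr_ge0 => z _. Qed.

Lemma energy_ge_edge g y z : edgew G (y, z) * sqc (dd th g (y, z)) <= energy g.
Proof.
apply: le_trans (sum_ge1 (F := fun z => edgew G (y, z) * sqc (dd th g (y, z)))
  _ (sV z)) _ => //.
apply: (sum_ge1 (F := fun y => \sum_(z <- s) edgew G (y, z) * sqc (dd th g (y, z))))
  => // x; exact: sumr_ge0.
Qed.

(** Transported differences telescope: each edge enters the constant through the inverse of its
    weight, and the square inequality doubles what the rest of the path contributes. *)
Lemma energy_path x (p : seq V) : path (adj G) x p ->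
  exists2 C : R, 0 <= C &
    forall g, sqc (g x - cexp (holonomy th x p) * g (last x p)) <= C * energy g.
Proof.
elim: p x => [|y p IH] x /=.
  by move=> _; exists 0 => // g; rewrite /holonomy big_nil cexp0 mul1r subrr sqc0 mul0r.
move=> /andP[xy /IH[C C0 hC]].
have w0 : 0 < edgew G (x, y) by rewrite divr_gt0.
exists (2 / edgew G (x, y) + 2 * C).
  by rewrite addr_ge0 ?mulr_ge0// invr_ge0 ltW.
move=> g; rewrite /holonomy /= big_cons cexpD -/(holonomy th y p).
have -> : g x - cexp (th x y) * cexp (holonomy th y p) * g (last y p) =
   dd th g (x, y) + cexp (th x y) * (g y - cexp (holonomy th y p) * g (last y p)).
  by rewrite ddE; ring.
apply: le_trans (sqcD_le _ _) _; rewrite sqcM sqc_cexp mul1r [leRHS]mulrDl.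
apply: lerD; last by rewrite -mulrA ler_wpM2l// hC.
rewrite -mulrA ler_wpM2l// mulrC ler_pdivlMr// mulrC; exact: energy_ge_edge.
Qed.

Lemma energy_le : exists2 C : R, 0 <= C &
  forall g, energy g <= C * \sum_(y <- s) sqc (g y).
Proof.
pose D := \sum_(y <- s) \sum_(z <- s) edge G y z.
have D0 : 0 <= D by do 2 (apply: sumr_ge0 => ? _); exact: edge_ge0.
exists (2 * D); first by rewrite mulr_ge0.
move=> g; rewrite /D -mulrA mulr_suml mulr_sumr; apply: ler_sum => y _.
rewrite mulr_suml mulr_sumr; apply: ler_sum => z _.
have := sum_ge1 (fun y => sqc_ge0 (g y)) (sV y).
have := sum_ge1 (fun y => sqc_ge0 (g y)) (sV z).
have := sqcB_le (g y) (cexp (th y z) * g z); rewrite -ddE sqcM sqc_cexp mul1r.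
rewrite /edgew /=; have := edge_ge0 G y z.
set S := \sum_(_ <- s) _; move=> a b c d.
by rewrite mulrCA -[leLHS]mulrA ler_wpM2l//; lra.
Qed.

(** Around a closed walk at [x] with phase different from 1, the energy controls [g x] times a
    non-zero factor, hence [g x]; paths then carry the bound to every vertex. *)
Lemma energy_poincare : ~ hol_zero th -> exists2 C : R, 0 <= C &
  forall g, \sum_(y <- s) sqc (g y) <= C * energy g.
Proof.
move=> /existsNP[x] /existsNP[p] /not_implyP[px] /not_implyP[lx hx].
have c1 : 0 < sqc (1 - cexp (holonomy th x p)).
  apply: sqc_gt0; rewrite subr_eq0; apply/eqP => /esym e.
  by apply: hx; exact: cexp_eq1.
have [C C0 hC] := energy_path px; rewrite lx in hC.
have gx g : sqc (g x) <= C / sqc (1 - cexp (holonomy th x p)) * energy g.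
  rewrite mulrAC ler_pdivlMr// -sqcM mulrBr mulr1 [g x * _]mulrC.
  exact: hC.
have [D D0 hD] : exists2 D : R, 0 <= D &
    forall y g, y \in s -> sqc (g y) <= D * energy g.
  apply: (@uniform_bound _ _ _ s (fun y g => sqc (g y)) _ energy_ge0) => y.
  have [q [qy lq]] := edge_connected G y x.
  have [E E0 hE] := energy_path qy; rewrite lq in hE.
  exists (2 * E + 2 * (C / sqc (1 - cexp (holonomy th x p)))).
    by rewrite addr_ge0 ?mulr_ge0// invr_ge0 ltW.
  move=> g; have := hE g; have := gx g.
  have := sqcD_le (g y - cexp (holonomy th y q) * g x)
    (cexp (holonomy th y q) * g x).
  by rewrite subrK sqcM sqc_cexp mul1r; lra.
exists (\sum_(y <- s) D); first by apply: sumr_ge0.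
move=> g; rewrite mulr_suml big_seq [leRHS]big_seq; apply: ler_sum => y ys.
exact: hD.
Qed.

(** [phi] transports 1 from a base vertex along chosen paths; zero holonomy removes the dependence
    on the choice. The factor [edgew] restricts parallelism to edges. *)
Lemma parallel_section (x0 : V) : hol_zero th -> exists phi : V -> R[i],
  [/\ forall y, sqc (phi y) = 1, 
      forall y z, edgew G (y, z) * sqc (dd th phi (y, z)) = 0 &
  exists2 C : R, 0 <= C & forall g, exists a,
    \sum_(y <- s) sqc (g y - a * phi y) <= C * energy g].
Proof.
move=> hol.
have /choice[q hq] y : exists p, path (adj G) y p /\ last y p = x0.
  exact: edge_connected.
exists (fun y => cexp (holonomy th y (q y))); split.
- by move=> y; exact: sqc_cexp.
- move=> y z; have := edge_ge0 G y z; rewrite le_eqVlt => /predU1P[e|yz].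
    by rewrite /edgew /= -e !mul0r.
  have [r [py ly]] := edge_connected G x0 y.
  have cat (u v : seq V) x : holonomy th x (u ++ v) =
      holonomy th x u + holonomy th (last x u) v.
    elim: u x => [|b u IH] x /=; first by rewrite /holonomy big_nil add0r.
    by rewrite /holonomy /= !big_cons -!/(holonomy th b _) IH addrA.
  (* A common path [r] from [x0] to [y] closes both the chosen path of [y] and the detour through
     [z] into cycles; cancelling its phase compares the two. *)
  have h1 : cexp (holonomy th y (q y)) * cexp (holonomy th x0 r) = 1 :> R[i].
    rewrite -cexpD -(hq y).2 -cat (cexp_eq2pi (t := 0)) ?cexp0//.
    by apply: hol; rewrite ?cat_path ?last_cat (hq y).2 ?(hq y).1.
  have h2 : cexp (th y z) * cexp (holonomy th z (q z)) * cexp (holonomy th x0 r)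
      = 1 :> R[i].
    have e : holonomy th y (z :: q z ++ r) =
        th y z + holonomy th z (q z) + holonomy th x0 r.
      by rewrite /holonomy /= big_cons -/(holonomy th z (q z ++ r)) cat (hq z).2 addrA.
    rewrite -!cexpD -e (cexp_eq2pi (t := 0)) ?cexp0//.
    apply: hol; rewrite /= ?cat_path ?last_cat (hq z).2 ?(hq z).1 ?andbT//.
    by apply/andP.
  rewrite ddE.
  have r0 : cexp (holonomy th x0 r) != 0 :> R[i].
    by apply/eqP => e; move: h1; rewrite e mulr0 => /eqP; rewrite eq_sym oner_eq0.
  have -> : cexp (holonomy th y (q y)) = cexp (th y z) * cexp (holonomy th z (q z)).
    by apply: (mulIf r0); rewrite h1 h2.
  by rewrite subrr sqc0 mulr0.
- have [C C0 hC] := @uniform_bound R V _ s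
    (fun y g => sqc (g y - cexp (holonomy th y (q y)) * g x0)) energy energy_ge0
    (fun y => ltac:(by have [E E0 hE] := energy_path (hq y).1; exists E => // g;
       have := hE g; rewrite (hq y).2)).
  exists (\sum_(y <- s) C); first by apply: sumr_ge0.
  (* The chosen paths all end at [x0], so [energy_path] compares each [g y] with [phi y] times this
     value. *)
  move=> g; exists (g x0).
  rewrite mulr_suml big_seq [leRHS]big_seq; apply: ler_sum => y ys.
  by rewrite mulrC; exact: hC.
Qed.

End FiniteGraph.

(** * Discrete cusps *)

Section DegreeBound.
Context {R : realType} {V : countType} {G : wgraph R V} (th : potential G).

Lemma l2norm_hnorm (f : L2 (weight_ge0 G)) :
  l2norm (weight G) f = hnorm (l2_hilbert (weight_ge0 G)) f.
Proof. by rewrite l2norm_sqrt; [rewrite -l2_dotE|exact: weight_ge0]. Qed.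

Lemma rdot_delta x (c : R[i]) :
  let f := fun y : V => if y == x then c else 0 in
  rdot (weight G) f f = weight G x * sqc c.
Proof.
rewrite /= /rdot (rsum_seq (s := [:: x])) //= => [|y].
  by rewrite big_seq1 eqxx re2zz.
by rewrite inE => /negbTE ->; rewrite /re2 /= !mul0r addr0 mulr0.
Qed.

(** Tested on the point mass at [x], the form is at most [|C|] times [weight G x]. Only pairs
    issuing from [x] are kept, each with half its edge weight, hence the factor 2. *)
Lemma degree_bound : op_bounded (weight G) (laplacian th) ->
  exists2 C : R, 0 <= C & forall x (t : seq V), uniq t ->
    \sum_(y <- t) edge G x y <= C * weight G x.
Proof.
move=> [C hC]; exists (2 * `|C|); first by rewrite mulr_ge0.
move=> x t ut.
pose f y : R[i] := if y == x then 1 else 0.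
have Cf : Cc f := delta_Cc x 1.
have CL := Cc_lapfun th Cf.
have := hC _ _ (Cc_laplacian th Cf).
pose F := l2mk (weight_ge0 G) (Cc_l2 Cf).
pose L := l2mk (weight_ge0 G) (Cc_l2 CL).
rewrite (l2norm_hnorm L) (l2norm_hnorm F) => LF.
have gr : l2_hilbert _ L F = rdot (edgew G) (dd th f) (dd th f).
  by rewrite l2_dotE; exact: green_Cc.
have FF : l2_hilbert _ F F = weight G x.
  by rewrite l2_dotE (rdot_delta x 1) /sqc /= expr0n expr1n addr0 mulr1.
have up : rdot (edgew G) (dd th f) (dd th f) <= `|C| * weight G x.
  rewrite -gr -FF; apply: le_trans (ler_norm _) _.
  apply: le_trans (dot_le _ _ _) _; rewrite -sqr_hnorm expr2 mulrA.
  rewrite ler_wpM2r ?hnorm_ge0//; apply: le_trans LF _.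
  by rewrite ler_wpM2r ?hnorm_ge0// ler_norm.
have ge0 p : 0 <= edgew G p * sqc (dd th f p).
  by rewrite mulr_ge0 ?edgew_ge0 ?sqc_ge0.
rewrite -mulrA -ler_pdivrMl// mulr_sumr; apply: le_trans up.
rewrite rdot_tsum; last exact: edgew_ge0.
apply: (@le_trans _ _ (\sum_(p <- [seq (x, y) | y <- t]) edgew G p * sqc (dd th f p))).
  rewrite big_map; apply: ler_sum => y _; rewrite ddE /edgew /= /f eqxx.
  have [->|yx] := eqVneq y x; first by rewrite edge_loopless mulr0 !mul0r.
  by rewrite mulr0 subr0 /sqc /= expr0n expr1n addr0 mulr1 mulrC.
apply: tsum_ge_seq => //; first exact: (l2_sumable (Cc_ddl2 th Cf)).
by rewrite map_inj_uniq// => a b [].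
Qed.

Lemma energy_degree_le (C : R) (t : seq V) (g : V -> R[i]) : uniq t ->
  (forall x (t : seq V), uniq t -> \sum_(y <- t) edge G x y <= C * weight G x) ->
  \sum_(x <- t) \sum_(y <- t) edgew G (x, y) * sqc (dd th g (x, y)) <=
    2 * C * \sum_(x <- t) weight G x * sqc (g x).
Proof.
move=> ut hC.
apply: (@le_trans _ _ (\sum_(x <- t) \sum_(y <- t)
    (edge G x y * sqc (g x) + edge G y x * sqc (g y)))).
  apply: ler_sum => x _; apply: ler_sum => y _; rewrite (edge_sym G y x) -mulrDr.
  rewrite /edgew /= -mulrA ler_wpM2l ?edge_ge0//.
  have := sqcB_le (g x) (cexp (th x y) * g y); rewrite -ddE sqcM sqc_cexp mul1r.
  by lra.
under eq_bigr do rewrite big_split.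
rewrite big_split /= [X in _ + X]exchange_big /=.
rewrite -[leLHS]mulr2n -[leLHS]mulr_natl -[leRHS]mulrA ler_wpM2l// mulr_sumr.
apply: ler_sum => x _; rewrite -mulr_suml mulrA.
by rewrite ler_wpM2r ?sqc_ge0// hC.
Qed.

End DegreeBound.

Lemma sum_delta (R : realType) (T : eqType) (s : seq T) (F : T -> R) x :
  uniq s -> x \in s -> \sum_(y <- s) (x == y)%:R * F y = F x.
Proof.
move=> us xs; rewrite (bigD1_seq x)//= eqxx mul1r big1 ?addr0// => y.
by rewrite eq_sym => /negbTE ->; rewrite mul0r.
Qed.

(** * Horizontal and vertical energy of the product *)

Section ProductEnergy.
Context {R : realType} {V1 V2 : countType}.
Context {G1 : wgraph R V1} {G2 : wgraph R V2} (th1 : potential G1) (th2 : potential G2).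
Context {I : set V2} (I0 : I !=set0).
Context (s2 : seq V2) (us2 : uniq s2) (s2V : forall y, y \in s2).
Context (C1 : R) (C1_ge0 : 0 <= C1) (degC1 : forall x (t : seq V1), uniq t ->
    \sum_(y <- t) edge G1 x y <= C1 * weight G1 x).

Local Notation G := (prod_graph G1 G2 I0).
Local Notation th := (prod_potential I0 th1 th2).
Local Notation m := (weight G).
Implicit Types (f : V1 * V2 -> R[i]).

Definition fibre f (x : V1) : V2 -> R[i] := fun y => f (x, y).

(** Without loops, an edge is either horizontal or vertical. Where the edge weight is zero,
    [prod_theta] takes its default value and the factor [edgew] hides it. *)
Lemma prod_energy_split f x y x' y' :
  edgew G ((x, y), (x', y')) * sqc (dd th f ((x, y), (x', y'))) =
  (y == y')%:R * ((y \in I)%:R *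
    (edgew G1 (x, x') * sqc (dd th1 (fun a => f (a, y)) (x, x')))) +
  (x == x')%:R * (edgew G2 (y, y') * sqc (dd th2 (fibre f x) (y, y'))).
Proof.
have -> : dd th f ((x, y), (x', y')) =
    f (x, y) - cexp (@prod_theta R V1 V2 G1 G2 I th1 th2 (x, y) (x', y')) * f (x', y').
  by [].
rewrite /edgew /= /prod_theta /prod_edge /= !ddE /fibre.
have [<-|xx] := eqVneq x x'; have [<-|yy] := eqVneq y y'.
- by rewrite !edge_loopless !(mul0r, mulr0, addr0).
- rewrite edge_loopless !(mul0r, mulr0, mul1r, add0r).
  have := edge_ge0 G2 y y'; rewrite le_eqVlt => /predU1P[<-|->]; last by [].
  by rewrite !mul0r.
- rewrite !(mul0r, mul1r, mulr1, addr0).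
  have := edge_ge0 G1 x x'; rewrite le_eqVlt => /predU1P[<-|xx'].
    by rewrite !(mul0r, mulr0).
  by case: (y \in I); rewrite !(mulr1, mulr0, mul0r, mul1r)// xx'.
- by rewrite !(mul0r, mulr0, addr0).
Qed.

Definition fibre_energy f (x : V1) : R := energy th2 s2 (fibre f x).

Lemma fibre_energy_ge0 f x : 0 <= fibre_energy f x.
Proof. exact: energy_ge0. Qed.

Let term_ge0 f p : 0 <= edgew G p * sqc (dd th f p).
Proof. by rewrite mulr_ge0 ?edgew_ge0 ?sqc_ge0. Qed.

Lemma fibre_energy_le f : l2 (edgew G) (dd th f) ->
  sumable (fibre_energy f) /\
  tsum (fibre_energy f) <= rdot (edgew G) (dd th f) (dd th f).
Proof.
move=> lf.
have key (t : seq V1) : uniq t ->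
    \sum_(x <- t) fibre_energy f x <= rdot (edgew G) (dd th f) (dd th f).
  move=> ut; pose h (x : V1) (w : V2 * V2) := ((x, w.1), (x, w.2)).
  pose W := [seq (y, z) | y <- s2, z <- s2].
  have uW : uniq W by rewrite allpairs_uniq// => -[? ?] [? ?].
  have -> : \sum_(x <- t) fibre_energy f x =
      \sum_(p <- [seq h x w | x <- t, w <- W]) edgew G p * sqc (dd th f p).
    rewrite big_allpairs_dep /=; apply: eq_bigr => x _.
    rewrite big_allpairs_dep /=; apply: eq_bigr => y _; apply: eq_bigr => z _.
    rewrite prod_energy_split eqxx mul1r /edgew /= edge_loopless !mul0r !mulr0.
    by rewrite add0r.
  rewrite rdot_tsum; last exact: edgew_ge0.
  apply: tsum_ge_seq => //; first exact: l2_sumable.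
  by rewrite allpairs_uniq// => -[a [b c]] [a' [b' c']] _ _ /= [-> -> _ ->].
split; first exact: sumable_bound key.
by apply: tsum_le => //; exact: fibre_energy_ge0.
Qed.

(** An upper bound for every [1 / m2]. The horizontal degree bound involves [m1] only, and this
    constant restores the factor [m2] of the product mass. *)
Let D2 : R := \sum_(y <- s2) (weight G2 y)^-1.

Let D2P y : 1 <= D2 * weight G2 y.
Proof.
rewrite -ler_pdivrMr ?weight_gt0// mul1r.
apply: (sum_ge1 (F := fun y => (weight G2 y)^-1)) => // z.
by rewrite invr_ge0 weight_ge0.
Qed.

Let D2_ge0 : 0 <= D2.
Proof. by apply: sumr_ge0 => y _; rewrite invr_ge0 weight_ge0. Qed.

Definition energy_const : R := 2 * C1 * D2.

Lemma energy_const_ge0 : 0 <= energy_const.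
Proof. by rewrite !mulr_ge0. Qed.

Lemma prod_energy_le f : l2 m f -> sumable (fibre_energy f) ->
  l2 (edgew G) (dd th f) /\
  rdot (edgew G) (dd th f) (dd th f) <=
    energy_const * rdot m f f + tsum (fibre_energy f).
Proof.
move=> lf sf.
have key (s : seq ((V1 * V2) * (V1 * V2))) : uniq s ->
    \sum_(p <- s) edgew G p * sqc (dd th f p) <=
    energy_const * rdot m f f + tsum (fibre_energy f).
  move=> us.
  (* First coordinates of both ends, so that [s] lies in the square of the product list [P], where
     sums can be reordered. *)
  pose t := undup ([seq p.1.1 | p <- s] ++ [seq p.2.1 | p <- s]).
  have ut : uniq t by exact: undup_uniq.
  pose P := [seq (x, y) | x <- t, y <- s2].
  have uP : uniq P by rewrite allpairs_uniq// => -[? ?] [? ?].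
  apply: (@le_trans _ _ (\sum_(p <- [seq (p, q) | p <- P, q <- P])
      edgew G p * sqc (dd th f p))).
    apply: sum_subset_le => // -[[x y] [x' y']] ps.
    rewrite !mem_pairs !s2V !andbT /t !mem_undup !mem_cat; apply/andP; split.
      by apply/orP; left; apply/mapP; exists ((x, y), (x', y')).
    by apply/orP; right; apply/mapP; exists ((x, y), (x', y')).
  rewrite big_allpairs_dep /= big_allpairs_dep /=.
  under eq_bigr => x _ do under eq_bigr => y _ do rewrite big_allpairs_dep /=.
  under eq_bigr => x _ do under eq_bigr => y _ do under eq_bigr => x' _ do
    under eq_bigr => y' _ do rewrite prod_energy_split.
  under eq_bigr => x _ do under eq_bigr => y _ do under eq_bigr => x' _ do
    rewrite big_split /=.
  under eq_bigr => x _ do under eq_bigr => y _ do rewrite big_split /=.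
  under eq_bigr => x _ do rewrite big_split /=.
  rewrite big_split /=; apply: lerD.
    rewrite exchange_big /=.
    apply: (@le_trans _ _ (\sum_(y <- s2) 2 * C1 *
        \sum_(x <- t) weight G1 x * sqc (f (x, y)))).
      apply: ler_sum => y _.
      apply: le_trans (energy_degree_le th1 (fun a => f (a, y)) ut degC1).
      apply: ler_sum => x _; apply: ler_sum => x' _.
      rewrite (sum_delta (fun=> _))//; case: (y \in I); rewrite ?mul1r// mul0r.
      by rewrite mulr_ge0 ?edgew_ge0 ?sqc_ge0.
    rewrite -mulr_sumr /energy_const -[leRHS]mulrA ler_wpM2l ?mulr_ge0//.
    apply: (@le_trans _ _ (D2 * \sum_(p <- P) m p * sqc (f p))).
      rewrite big_allpairs_dep /= exchange_big /= mulr_sumr.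
      apply: ler_sum => x _; rewrite mulr_sumr; apply: ler_sum => y _.
      rewrite /prod_weight /= [leRHS](_ : _ =
        (D2 * weight G2 y) * (weight G1 x * sqc (f (x, y)))); last by ring.
      by rewrite ler_peMl ?D2P// mulr_ge0 ?weight_ge0 ?sqc_ge0.
    rewrite ler_wpM2l// (rdot_tsum (weight_ge0 G)).
    by apply: tsum_ge_seq => //; [move=> p; rewrite mulr_ge0 ?weight_ge0 ?sqc_ge0|
      exact: l2_sumable].
  apply: (@le_trans _ _ (\sum_(x <- t) fibre_energy f x)).
    rewrite [leLHS]big_seq [leRHS]big_seq; apply: ler_sum => x xt.
    apply: ler_sum => y _.
    under eq_bigr => x' _ do rewrite -mulr_sumr.
    by rewrite (sum_delta (fun=> _)).
  by apply: tsum_ge_seq => //; exact: fibre_energy_ge0.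
split; first by rewrite l2E; exact: sumable_bound key.
rewrite rdot_tsum; last exact: edgew_ge0.
exact: tsum_le.
Qed.

End ProductEnergy.

Section ProductForm.
Context {R : realType} {V1 V2 : countType}.
Context {G1 : wgraph R V1} {G2 : wgraph R V2} (th1 : potential G1) (th2 : potential G2).
Context {I : set V2} (I0 : I !=set0).
Context (s2 : seq V2) (us2 : uniq s2) (s2V : forall y, y \in s2).
Context (C1 : R) (C1_ge0 : 0 <= C1) (degC1 : forall x (t : seq V1), uniq t ->
    \sum_(y <- t) edge G1 x y <= C1 * weight G1 x).

Local Notation G := (prod_graph G1 G2 I0).
Local Notation th := (prod_potential I0 th1 th2).
Local Notation m := (weight G).
Implicit Types (f : V1 * V2 -> R[i]) (a : V1 * V2 -> R).

Lemma sumable_fibre a : (forall p, 0 <= a p) ->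
  sumable a <-> sumable (fun x => \sum_(y <- s2) a (x, y)).
Proof.
move=> a0; have b0 x : 0 <= \sum_(y <- s2) a (x, y) by exact: sumr_ge0.
split=> sa.
  apply: (@sumable_bound _ _ _ (tsum a)) => s us.
  have := @tsum_ge_seq _ _ a [seq (x, y) | x <- s, y <- s2] a0 sa.
  rewrite big_allpairs_dep /=; apply.
  by rewrite allpairs_uniq// => -[? ?] [? ?].
apply: (@sumable_bound _ _ _ (tsum (fun x => \sum_(y <- s2) a (x, y)))) => s us.
apply: le_trans (tsum_ge_seq b0 sa (undup_uniq [seq p.1 | p <- s])).
apply: (@le_trans _ _ (\sum_(p <- [seq (x, y) | x <- undup [seq p.1 | p <- s],
    y <- s2]) a p)); last by rewrite big_allpairs_dep.
apply: sum_subset_le => // -[x y] xy; rewrite mem_pairs s2V andbT mem_undup.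
by apply/mapP; exists (x, y).
Qed.

(** Truncation is along whole fibres: each vertical energy is kept or removed entirely, and the cut
    edges are horizontal, where the norm controls the energy. *)
Lemma form_domE f : form_dom th f <->
  l2 m f /\ sumable (fibre_energy th2 s2 f).
Proof.
split=> [ff|[lf sf]].
  have lf := form_dom_l2 ff; split=> //.
  have [k /dd_graph_l2[lk _]] := (form_domP th (l2mk (weight_ge0 G) lf)).1 ff.
  by have [] := fibre_energy_le us2 lk.
have [ldf _] := prod_energy_le th1 us2 s2V C1_ge0 degC1 lf sf.
apply/(form_domP th (l2mk (weight_ge0 G) lf)); exists (l2mk (edgew_ge0 G) ldf).
move=> e e0.
pose C := energy_const (G2 := G2) s2 C1.
have C0 : 0 <= C by exact: energy_const_ge0.
(* The squared graph norm of the remainder is at most [C + 1] times its squared norm plus its fibre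
   energy; each part receives half of [e^2]. *)
have e1 : 0 < e ^+ 2 / 2 / (C + 1).
  by rewrite divr_gt0 ?divr_gt0 ?exprn_gt0//; lra.
have a0 p : 0 <= m p * sqc (f p) by rewrite mulr_ge0 ?weight_ge0 ?sqc_ge0.
have [s [_ hs]] := tsum_tail a0 (l2_sumable lf) e1.
have e2 : 0 < e ^+ 2 / 2 by rewrite divr_gt0 ?exprn_gt0.
have [s' [_ hs']] := tsum_tail (fibre_energy_ge0 th2 s2 f) sf e2.
pose t := [seq p.1 | p <- s] ++ s'.
pose u p := if p.1 \in t then f p else 0.
pose r p := if p.1 \in t then 0 else f p.
have fur p : f p - u p = r p.
  by rewrite /u /r; case: ifP; rewrite ?subrr ?subr0.
have Cu : Cc u.
  apply/CcP; exists (undup [seq (x, y) | x <- t, y <- s2]).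
  split=> [|[x y]]; first exact: undup_uniq.
  by rewrite mem_undup mem_pairs s2V andbT /u /= => /negbTE ->.
exists (l2mk (weight_ge0 G) (Cc_l2 Cu), l2mk (edgew_ge0 G) (Cc_ddl2 th Cu)).
  exact: Cc_dd_graph0.
have lr : l2 m r by have := l2B (weight_ge0 G) lf (Cc_l2 Cu); under eq_fun do rewrite fur.
have er x : fibre_energy th2 s2 r x = if x \in t then 0 else fibre_energy th2 s2 f x.
  rewrite /fibre_energy /fibre /r /=; case: ifP => // _.
  rewrite /energy big1// => y _; rewrite big1// => z _.
  by rewrite dd0// sqc0 mulr0.
have sr : sumable (fibre_energy th2 s2 r).
  by apply: sumable_le sf => x; rewrite er; case: ifP => // _; exact: fibre_energy_ge0.
have [lr' hr] := prod_energy_le th1 us2 s2V C1_ge0 degC1 lr sr.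
have A : rdot m r r < e ^+ 2 / 2 / (C + 1).
  rewrite (rdot_tsum (weight_ge0 G)).
  have -> : (fun p => m p * sqc (r p)) = (fun p =>
      if p \in [seq (x, y) | x <- t, y <- s2] then 0 else m p * sqc (f p)).
    apply/funext => -[x y]; rewrite mem_pairs s2V andbT /r /=.
    by case: ifP; rewrite ?sqc0 ?mulr0.
  apply: hs => -[x y] xys; rewrite mem_pairs s2V andbT mem_cat.
  by apply/orP; left; apply/mapP; exists (x, y).
have B : tsum (fibre_energy th2 s2 r) < e ^+ 2 / 2.
  have -> : fibre_energy th2 s2 r =
      (fun x => if x \in t then 0 else fibre_energy th2 s2 f x) by apply/funext.
  by apply: hs' => x xs; rewrite mem_cat xs orbT.
rewrite hnorm_lt ?(ltW e0)//.
set z := (_, _) - _.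
have -> : prod_hilbert (l2_hilbert (weight_ge0 G)) (l2_hilbert (edgew_ge0 G)) z z =
    rdot m r r + rdot (edgew G) (dd th r) (dd th r).
  transitivity (l2_hilbert (weight_ge0 G) z.1 z.1 + l2_hilbert (edgew_ge0 G) z.2 z.2).
    by [].
  rewrite !l2_dotE; congr (_ + _).
    by have -> : l2val z.1 = r by apply/funext => p; rewrite -fur.
  have -> // : l2val z.2 = dd th r.
  apply/funext => p; transitivity (dd th f p - dd th u p) => //.
  by rewrite -ddB; congr (dd _ _ _); apply/funext => q; rewrite fur.
move: A; rewrite ltr_pdivlMr; last lra.
by rewrite -/C in hr; lra.
Qed.

(** This is weight times degree, the density that multiplies [|f|^2] in the squared norm of the
    square root of the degree applied to [f]. *)
Definition weighted_degree (p : V1 * V2) : R := \sum_(q \in [set: V1 * V2]) edge G p q.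

Definition degree2 (y : V2) : R := \sum_(z <- s2) edge G2 y z.

Lemma degree2_ge0 y : 0 <= degree2 y.
Proof. by apply: sumr_ge0 => z _; exact: edge_ge0. Qed.

Lemma weighted_degree_bounds x y :
  degree2 y <= weighted_degree (x, y) <= C1 * weight G1 x + degree2 y.
Proof.
have [t [ut xt tN]] := neighbourhood (G := G1) [:: x].
have xt' : x \in t by apply: xt; rewrite inE.
have -> : weighted_degree (x, y) =
    (y \in I)%:R * (\sum_(x' <- t) edge G1 x x') + degree2 y.
  rewrite /weighted_degree (fsbig_seqT (s := [seq (u, v) | u <- t, v <- s2])).
  - rewrite big_allpairs_dep /= /prod_edge /=.
    under eq_bigr => x' _ do rewrite big_split /=.
    rewrite big_split /=; congr (_ + _).
      rewrite mulr_sumr; apply: eq_bigr => x' _.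
      rewrite -(sum_delta (fun=> (y \in I)%:R * edge G1 x x') us2 (s2V y)).
      by apply: eq_bigr => z _; rewrite [edge G1 x x' * _]mulrC -mulrA [edge G1 x x' * _]mulrC.
    under eq_bigr => x' _ do rewrite -mulr_sumr.
    by rewrite (sum_delta (fun=> _) ut xt').
  - by rewrite allpairs_uniq// => -[? ?] [? ?].
  - move=> [x' z]; rewrite mem_pairs s2V andbT => x't.
    rewrite /= /prod_edge /=; have [e|xx] := eqVneq x x'.
      by rewrite -e xt' in x't.
    have -> : edge G1 x x' = 0.
      by apply/eqP; apply: contraNT x't; apply: tN; rewrite inE.
    by rewrite !mul0r addr0.
have e0 : 0 <= \sum_(x' <- t) edge G1 x x' by apply: sumr_ge0 => z _; exact: edge_ge0.
have := degC1 x ut; case: (y \in I); rewrite ?mul1r ?mul0r => h.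
  by rewrite lerDr e0 lerD2r.
rewrite add0r lexx lerDr mulr_ge0 ?weight_ge0//.
Qed.

(** The horizontal part of [weighted_degree] is at most [C1 * m1], already controlled by [l2 m f];
    the degree in [G2] decides. *)
Lemma degree_domE f :
  op_dom (mult_op m (fun p => Num.sqrt (deg G p))) f <->
  l2 m f /\ sumable (fun p => degree2 p.2 * sqc (f p)).
Proof.
have degE p : m p * sqc ((Num.sqrt (deg G p))%:C%C * f p) =
    weighted_degree p * sqc (f p).
  have d0 : 0 <= weighted_degree p.
    case: p => x y; have /andP[h _] := weighted_degree_bounds x y.
    by apply: le_trans h; exact: degree2_ge0.
  rewrite sqcM sqc_real sqr_sqrtr; last first.
    by rewrite /deg mulr_ge0// invr_ge0 weight_ge0.
  by rewrite mulrA /deg mulrA mulfV ?mul1r// gt_eqF// weight_gt0.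
pose D := \sum_(y <- s2) (weight G2 y)^-1.
have D0 : 0 <= D by apply: sumr_ge0 => y _; rewrite invr_ge0 weight_ge0.
have DP y : 1 <= D * weight G2 y.
  rewrite -ler_pdivrMr ?weight_gt0// mul1r.
  apply: (sum_ge1 (F := fun y => (weight G2 y)^-1)) => // z.
  by rewrite invr_ge0 weight_ge0.
split=> [[g [/= lf lg ge]]|[lf sf]].
  split=> //; apply: sumable_le (l2_sumable lg) => -[x y]; rewrite ge degE.
  have /andP[h _] := weighted_degree_bounds x y.
  by rewrite ler_wpM2r ?sqc_ge0.
exists (fun p => (Num.sqrt (deg G p))%:C%C * f p); split=> //=.
rewrite l2E; under eq_fun do rewrite degE.
have mf0 p : 0 <= m p * sqc (f p) by rewrite mulr_ge0 ?weight_ge0 ?sqc_ge0.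
have df0 (p : V1 * V2) : 0 <= degree2 p.2 * sqc (f p).
  by rewrite mulr_ge0 ?degree2_ge0 ?sqc_ge0.
have CD : 0 <= C1 * D by rewrite mulr_ge0.
have h := sumableD (fun p => mulr_ge0 CD (mf0 p)) df0
  (sumableZ CD mf0 (l2_sumable lf)) sf.
apply: sumable_le h => -[x y] /=.
have /andP[_ h] := weighted_degree_bounds x y.
apply: le_trans (ler_wpM2r (sqc_ge0 (f (x, y))) h) _.
rewrite mulrDl lerD2r /prod_weight /= !mulrA ler_wpM2r ?sqc_ge0//.
rewrite [leRHS](_ : _ = (D * weight G2 y) * (C1 * weight G1 x)); last by ring.
by rewrite ler_peMl ?DP// mulr_ge0 ?weight_ge0.
Qed.

(** The first edge of a path to another vertex has positive weight; this is where a second vertex of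
    [G2] enters. *)
Lemma degree2_gt0 y : (exists z z' : V2, z <> z') -> 0 < degree2 y.
Proof.
move=> [z [z' zz']].
have [w yw] : exists w, y <> w.
  by have [->|/eqP] := eqVneq y z; [exists z'|exists z].
have [[|b p] [/= py ly]] := edge_connected G2 y w; first by case: yw.
have /andP[yb _] := py; apply: lt_le_trans yb _.
by apply: (sum_ge1 (F := fun z => edge G2 y z)) => // c; exact: edge_ge0.
Qed.

Lemma form_dom_sqc f : ~ hol_zero th2 -> form_dom th f <->
  l2 m f /\ sumable (fun p => sqc (f p)).
Proof.
move=> hol; have [C C0 hC] := energy_poincare s2V hol.
have [C' C0' hC'] := energy_le th2 s2V.
have h0 x : 0 <= \sum_(y <- s2) sqc (f (x, y)).
  by apply: sumr_ge0 => y _; exact: sqc_ge0.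
rewrite form_domE (sumable_fibre (fun p => sqc_ge0 (f p))).
split=> -[lf sf]; split=> //.
  apply: sumable_le (sumableZ C0 (fibre_energy_ge0 th2 s2 f) sf) => x; exact: hC.
apply: sumable_le (sumableZ C0' h0 sf) => x; exact: hC'.
Qed.

Lemma degree_dom_sqc f : (exists z z' : V2, z <> z') ->
  op_dom (mult_op m (fun p => Num.sqrt (deg G p))) f <->
  l2 m f /\ sumable (fun p => sqc (f p)).
Proof.
move=> zz; rewrite degree_domE.
pose D := \sum_(y <- s2) degree2 y.
have D0 : 0 <= D by apply: sumr_ge0 => y _; exact: degree2_ge0.
pose E := \sum_(y <- s2) (degree2 y)^-1.
have E0 : 0 <= E by apply: sumr_ge0 => y _; rewrite invr_ge0 degree2_ge0.
split=> -[lf sf]; split=> //.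
  have df0 (p : V1 * V2) : 0 <= degree2 p.2 * sqc (f p).
    by rewrite mulr_ge0 ?degree2_ge0 ?sqc_ge0.
  apply: sumable_le (sumableZ E0 df0 sf) => -[x y] /=.
  rewrite mulrA ler_peMl ?sqc_ge0//.
  rewrite -ler_pdivrMr ?degree2_gt0// mul1r.
  apply: (sum_ge1 (F := fun y => (degree2 y)^-1)) => // z.
  by rewrite invr_ge0 degree2_ge0.
apply: sumable_le (sumableZ D0 (fun p => sqc_ge0 (f p)) sf) => -[x y] /=.
rewrite ler_wpM2r ?sqc_ge0//; apply: (sum_ge1 (F := degree2)) => //.
exact: degree2_ge0.
Qed.

End ProductForm.

Section SmallWeights.
Context {R : realType} {V : countType} {G : wgraph R V} (o : V).
Hypothesis vanish : forall eps : R, 0 < eps -> exists N : nat, forall x : V,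
  (N <= gdist G o x)%N -> weight G x < eps.

(** By local finiteness each radius adds finitely many neighbours. Decay in the distance thus
    becomes smallness off a finite set. *)
Lemma ball_finite (N : nat) : exists t : seq V,
  forall x, (gdist G o x < N)%N -> x \in t.
Proof.
have [t tP] : exists t : seq V, forall p, path (adj G) o p -> (size p < N)%N ->
    last o p \in t.
  elim: N => [|N [t tP]]; first by exists [::].
  have [u [_ tu uN]] := neighbourhood (G := G) (o :: t).
  exists u; elim/last_ind => [|p x _]; first by move=> _ _; apply: tu; rewrite inE eqxx.
  rewrite rcons_path size_rcons last_rcons ltnS => /andP[px xy] sp.
  apply: (uN (last o p)); first by rewrite inE tP ?orbT.
  by rewrite gt_eqF.
exists t => x; rewrite /gdist; case: ex_minnP => n /asboolP[p [px lx sp]] _ nN.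
by rewrite -lx; apply: tP; rewrite ?sp.
Qed.

Lemma weight_small (e : R) : 0 < e -> exists t : seq V,
  forall x, x \notin t -> weight G x < e.
Proof.
move=> /vanish[N hN]; have [t tP] := ball_finite N; exists t => x xt.
by apply: hN; rewrite leqNgt; apply: contra xt; exact: tP.
Qed.

Hypothesis infV : infinite_set [set: V].

(** Geometric decay gives infinitely many points of finite total mass, which separates weighted from
    unweighted summability. *)
Lemma sparse_sequence : exists g : nat -> V,
  injective g /\ forall n, weight G (g n) < 2^-1 ^+ n.
Proof.
have pick (z : seq V * nat) : exists x, x \notin z.1 /\ weight G x < 2^-1 ^+ z.2.
  have [|t tP] := @weight_small (2^-1 ^+ z.2); first by rewrite exprn_gt0.
  have [x xz] : exists x, x \notin z.1 ++ t.
    apply: contrapT => h; apply: infV; apply/finite_seqP; exists (z.1 ++ t).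
    apply/seteqP; split=> // x _ /=; apply/negPn/negP => xz.
    by apply: h; exists x.
  by move: xz; rewrite mem_cat negb_or => /andP[xz /tP]; exists x.
have /choice[next hn] := pick.
(* [L n] lists the points chosen at indices below [n], which the next choice avoids. *)
pose L := fix L n := if n is n'.+1 then next (L n', n') :: L n' else [::].
exists (fun n => next (L n, n)); split=> [i j|n]; last by have [] := hn (L n, n).
have sub a b : (a < b)%N -> next (L a, a) \in L b.
  elim: b => // b IH; rewrite ltnS leq_eqVlt => /predU1P[->|/IH h] /=.
    by rewrite inE eqxx.
  by rewrite inE h orbT.
move=> e; case: (ltngtP i j) => // ij; have := sub _ _ ij.
  by rewrite e; have [/= /negbTE ->] := hn (L j, j).
by rewrite -e; have [/= /negbTE ->] := hn (L i, i).
Qed.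

End SmallWeights.

Lemma fmap_ultra (T T' : Type) (f : T -> T') (F : set_system T) :
  UltraFilter F -> UltraFilter (f @ F).
Proof.
move=> FU; have FP : ProperFilter F by exact: ultra_proper.
split=> [|F' F'P sF]; first exact: fmap_proper_filter.
apply/seteqP; split=> // A F'A.
have [//|FnA] := in_ultra_setVsetC (f @^-1` A) FU.
have F'nA : F' (~` A) by apply: sF.
have := filterI F'A F'nA; rewrite setICr => /(_ _) F'0.
by have := @filter_not_empty _ F' F'P F'0.
Qed.

(** * Compactness from unweighted bounds and vanishing weights *)

Section Compactness.
Context {R : realType} {V : choiceType} {w : V -> R} (w0 : forall x, 0 <= w x).

Lemma geometric_half_le (N : nat) : \sum_(0 <= n < N) 2^-1 ^+ n <= 2 :> R.
Proof.
suff -> : \sum_(0 <= n < N) 2^-1 ^+ n = 2 - 2 * 2^-1 ^+ N :> R.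
  by rewrite gerBl mulr_ge0// exprn_ge0.
elim: N => [|N IH]; first by rewrite big_geq// expr0; ring.
by rewrite big_nat_recr//= IH exprS; field.
Qed.

(* Limits along an ultrafilter replace the diagonal extraction. *)
Lemma compact_embedding (v : nat -> V -> R[i]) (C : R) :
  (forall e : R, 0 < e -> exists s : seq V, forall x, x \notin s -> w x < e) ->
  (forall n (s : seq V), uniq s -> \sum_(x <- s) sqc (v n x) <= C) ->
  exists (phi : nat -> nat) (f : V -> R[i]),
    [/\ {homo phi : i j / (i < j)%N}, l2 w f & l2cvg w (v \o phi) f].
Proof.
move=> wsmall vC.
have C0 : 0 <= C by have := vC 0%N [::] isT; rewrite big_nil.
have vx n x : sqc (v n x) <= C by have := vC n [:: x] isT; rewrite big_seq1.
have [U [UU sU]] := ultraFilterLemma (F := nbhs (\oo : set_system nat)) _.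
have PU : ProperFilter U by exact: ultra_proper.
have lims (p : R[i] -> R) : (forall a, p a ^+ 2 <= sqc a) ->
    forall x, exists l : R, (fun n => p (v n x)) @ U --> l.
  move=> ps x.
  have cK : compact `[- (C + 1), C + 1]%classic by exact: segment_compact.
  have UK : ((fun n => p (v n x)) @ U) `[- (C + 1), C + 1]%classic.
    apply: (@filterE _ U) => n; rewrite /= in_itv /=.
    have := vx n x; have := ps (v n x); move: (p _) => t h1 h2.
    have : t ^+ 2 <= C by exact: le_trans h2.
    by move=> h3; apply/andP; split; nra.
  have UI : UltraFilter ((fun n => p (v n x)) @ U) by exact: fmap_ultra.
  move: cK; rewrite compact_ultra => /(_ _ UI UK)[l [_ hl]].
  by exists l.
have /choice[lr hr] := lims (@complex.Re R) (fun a => ltac:(by rewrite lerDl sqr_ge0)).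
have /choice[li hi] := lims (@complex.Im R) (fun a => ltac:(by rewrite lerDr sqr_ge0)).
pose f x := Complex (lr x) (li x).
have near1 x e : 0 < e -> U [set n | sqc (v n x - f x) < e].
  move=> e0; have s0 : 0 < Num.sqrt (e / 2) by rewrite sqrtr_gt0 divr_gt0.
  move/cvgrPdist_lt : (hr x) => /(_ _ s0) n1.
  move/cvgrPdist_lt : (hi x) => /(_ _ s0) n2.
  apply: filterS2 n1 n2 => n /= h1 h2.
  have h1' : (lr x - complex.Re (v n x)) ^+ 2 < e / 2.
    rewrite -(sqr_sqrtr (a := e / 2)) ?divr_ge0 ?(ltW e0)//.
    by rewrite -real_normK ?num_real// ltr_sqr ?nnegrE ?sqrtr_ge0.
  have h2' : (li x - complex.Im (v n x)) ^+ 2 < e / 2.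
    rewrite -(sqr_sqrtr (a := e / 2)) ?divr_ge0 ?(ltW e0)//.
    by rewrite -real_normK ?num_real// ltr_sqr ?nnegrE ?sqrtr_ge0.
  by move: h1' h2'; rewrite /sqc /f; case: (v n x) => a b /=; nra.
have nears (s : seq V) e : 0 < e ->
    U [set n | forall x, x \in s -> sqc (v n x - f x) < e].
  move=> e0; elim: s => [|y s IH]; first exact: (@filterE _ U).
  apply: filterS2 (near1 y e e0) IH => n /= h1 h2 x.
  by rewrite inE => /predU1P[->|/h2].
(* On a list [s], compare [f] with a [v n] within [e = 1 / (size s + 1)] at each entry: the sum of
   [2 * e] over [s] stays below 2. *)
pose D := 2 * C + 2.
have fD (s : seq V) : uniq s -> \sum_(x <- s) sqc (f x) <= D.
  move=> us; have [e [e0 e1]] : exists e : R, 0 < e /\ \sum_(x <- s) 2 * e <= 2.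
    exists (size s).+1%:R^-1; split; first by rewrite invr_gt0.
    rewrite big_const_seq count_predT iter_addr_0 -[_ *+ size s]mulr_natl mulrCA.
    by rewrite ger_pMr// ler_pdivrMr// mul1r ler_nat.
  have [n hn] := @filter_ex _ _ PU _ (nears s _ e0).
  apply: (@le_trans _ _ (\sum_(x <- s) (2 * sqc (v n x) + 2 * e))).
    rewrite big_seq [leRHS]big_seq; apply: ler_sum => x /hn /= h.
    have := sqcB_le (v n x) (v n x - f x).
    by rewrite subKr; lra.
  rewrite big_split /= -mulr_sumr /D.
  by have := vC n s us; lra.
have D0 : 0 <= D by rewrite /D; lra.
have [W [W0 hW]] : exists W : R, 0 <= W /\ forall x, w x <= W.
  have [s hs] := wsmall 1 ltr01.
  have S0 : 0 <= \sum_(x <- s) w x by apply: sumr_ge0.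
  exists (1 + \sum_(x <- s) w x); split; first by rewrite addr_ge0.
  move=> x; have [xs|/hs/ltW h] := boolP (x \in s); last by rewrite ler_wpDr.
  by rewrite ler_wpDl//; exact: (sum_ge1 w0).
have sl2 (h : V -> R[i]) B : (forall s, uniq s -> \sum_(x <- s) sqc (h x) <= B) -> l2 w h.
  move=> hB; rewrite l2E; apply: (@sumable_bound _ _ _ (W * B)) => s us.
  apply: le_trans (ler_wpM2l W0 (hB s us)); rewrite mulr_sumr.
  by apply: ler_sum => x _; rewrite ler_wpM2r ?sqc_ge0.
have lf : l2 w f by exact: sl2 fD.
have lv n : l2 w (fun x => v n x - f x) by apply: l2B => //; exact: sl2 (vC n).
have close e : 0 < e ->
    U [set n | rdot w (fun x => v n x - f x) (fun x => v n x - f x) <= e].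
  (* [B] bounds the unweighted sum of [|v n - f|^2]. Off the list [s] the weights are small; on it
     the ultrafilter makes the coordinates close. *)
  move=> e0; pose B := 2 * C + 2 * D.
  have B0 : 0 <= B by rewrite /B; lra.
  have eB : 0 < e / 2 / (B + 1) by rewrite !divr_gt0//; lra.
  have [s0 hs0] := wsmall _ eB; pose s := undup s0.
  have hs x : x \notin s -> w x < e / 2 / (B + 1) by rewrite mem_undup; exact: hs0.
  pose T := \sum_(x <- s) w x.
  have T0 : 0 <= T by apply: sumr_ge0.
  have eT : 0 < e / 2 / (T + 1) by rewrite !divr_gt0//; lra.
  apply: filterS (nears s _ eT) => n /= hn; rewrite rdot_tsum//.
  apply: tsum_le => [x|t ut]; first by rewrite mulr_ge0 ?sqc_ge0.
  rewrite (bigID (fun x => x \in s)) /=.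
  have h1 : \sum_(x <- t | x \in s) w x * sqc (v n x - f x) <= e / 2.
    rewrite -big_filter.
    apply: (@le_trans _ _ (\sum_(x <- s) w x * sqc (v n x - f x))).
      apply: sum_subset_le => [x||x].
      - by rewrite mulr_ge0 ?sqc_ge0.
      - exact: filter_uniq.
      - by rewrite mem_filter => /andP[].
    apply: (@le_trans _ _ (T * (e / 2 / (T + 1)))).
      rewrite /T mulr_suml big_seq [leRHS]big_seq; apply: ler_sum => x xs.
      by rewrite ler_wpM2l// ltW// hn.
    by rewrite mulrA ler_pdivrMr; nra.
  have h2 : \sum_(x <- t | x \notin s) w x * sqc (v n x - f x) <= e / 2.
    apply: (@le_trans _ _ (\sum_(x <- t) e / 2 / (B + 1) *
        (2 * sqc (v n x) + 2 * sqc (f x)))).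
      rewrite big_mkcond; apply: ler_sum => x _; case: ifPn => xs.
        rewrite ler_pM ?sqc_ge0 ?sqcB_le//; exact/ltW/hs.
      by rewrite mulr_ge0 ?(ltW eB)// addr_ge0 ?mulr_ge0 ?sqc_ge0.
    rewrite -mulr_sumr big_split /= -!mulr_sumr.
    have := vC n t ut; have := fD t ut => a b.
    apply: (@le_trans _ _ (e / 2 / (B + 1) * B)).
      by rewrite ler_wpM2l ?(ltW eB)// /B; lra.
    by rewrite mulrAC ler_pdivrMr; nra.
  by lra.
have pick (z : nat * nat) : exists n, (z.1 < n)%N /\
    rdot w (fun x => v n x - f x) (fun x => v n x - f x) <= z.2.+1%:R^-1.
  have Ug : U [set n | (z.1 < n)%N] by apply: sU; exists z.1.+1.
  have e0 : 0 < z.2.+1%:R^-1 :> R by rewrite invr_gt0.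
  by have [n [n1 n2]] := @filter_ex _ _ PU _ (filterI Ug (close _ e0)); exists n.
have /choice[next hn] := pick.
(* Each index exceeds the previous one and achieves error at most [1 / (k + 1)]. *)
pose phi := fix phi k := if k is k'.+1 then next (phi k', k) else next (0%N, 0%N).
exists phi, f; split=> //.
  by apply: homo_ltn => [? ? ?|k]; [exact: ltn_trans|exact: (hn (phi k, k.+1)).1].
apply: (@l2cvg_bound _ _ _ w0 _ _ (fun k => k.+1%:R^-1)) => [k|k|].
- exact: lv.
- by case: k => [|k]; [exact: (hn (0%N, 0%N)).2|exact: (hn (phi k, k.+1)).2].
- exact: cvg_harmonic.
Qed.

End Compactness.

Section Resolvent.
Context {R : realType} {V : countType} {G : wgraph R V} (th : potential G).

Lemma resolventN1 (g f : V -> R[i]) :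
  resolvent (laplacian th) (-1) (g, f) ->
  exists F H : L2 (weight_ge0 G), [/\ f = l2val F, laplacian th (l2val F, l2val H) &
    g = l2val (F + H)].
Proof.
move=> [h [/= Afh e]].
have [lf lh] := possa_l2 (laplacian_positive th) Afh.
exists (l2mk (weight_ge0 G) lf), (l2mk (weight_ge0 G) lh); split=> //.
by apply/funext => x; rewrite e mulN1r opprK addrC.
Qed.

(** By non-negativity -1 works: [1 + Delta] is onto by [posop_range], with contractive inverse by
    [posop_bound]. *)
Lemma in_resolvent_setN1 : in_resolvent_set (weight G) (laplacian th) (-1).
Proof.
have pA := possa_posop (laplacian_positive th).
have def := @l2_definite _ _ _ (weight_ge0 G) (weight_gt0 G).
split.
  move=> g lg; have [F [H [A e]]] := posop_range pA (l2mk (weight_ge0 G) lg).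
  exists (l2val F); split.
    exists (l2val H); split; first exact: A.
    move=> x; rewrite mulN1r opprK addrC; have := congr1 (fun K : L2 _ => K x) e.
    by [].
  move=> f' /resolventN1[F' [H' [-> A' e']]]; congr l2val.
  apply: (posop_inj def pA A A'); rewrite -e; apply: l2_inj => x.
  by rewrite /= e'.
exists 1 => g f /resolventN1[F [H [-> A ->]]]; rewrite mul1r !l2norm_hnorm.
by have [] := posop_bound pA A.
Qed.

End Resolvent.

Section CuspSpectrum.
Context {R : realType} {V1 V2 : countType}.
Context {G1 : wgraph R V1} {G2 : wgraph R V2} (th1 : potential G1) (th2 : potential G2).
Context {I : set V2} (I0 : I !=set0) (o : V1).
Context (s2 : seq V2) (us2 : uniq s2) (s2V : forall y, y \in s2).
Context (C1 : R) (C1_ge0 : 0 <= C1) (degC1 : forall x (t : seq V1), uniq t ->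
    \sum_(y <- t) edge G1 x y <= C1 * weight G1 x).
Hypothesis vanish : forall eps : R, 0 < eps -> exists N : nat, forall x : V1,
  (N <= gdist G1 o x)%N -> weight G1 x < eps.

Local Notation G := (prod_graph G1 G2 I0).
Local Notation th := (prod_potential I0 th1 th2).
Local Notation m := (weight G).

Lemma prod_weight_small (e : R) : 0 < e -> exists s : seq (V1 * V2),
  forall p, p \notin s -> m p < e.
Proof.
move=> e0; pose M := \sum_(y <- s2) weight G2 y.
have M0 : 0 <= M by apply: sumr_ge0 => y _; exact: weight_ge0.
have M1 : 0 < M + 1 by lra.
have [t ht] := weight_small vanish (divr_gt0 e0 M1).
exists [seq (x, y) | x <- t, y <- s2] => -[x y].
rewrite mem_pairs s2V andbT => /ht; rewrite ltr_pdivlMr// /prod_weight /= => h.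
apply: le_lt_trans h; rewrite ler_wpM2l ?weight_ge0//.
have := sum_ge1 (F := weight G2) (weight_ge0 G2) (s2V y); rewrite -/M; lra.
Qed.

(** For [v = (1 + Delta)^-1 u] the form at [v] is at most the squared norm of [u]. Non-trivial
    holonomy converts this into a bound on the unweighted sum of [|v|^2]. *)
Lemma holonomy_compact_resolvent : ~ hol_zero th2 ->
  compact_resolvent m (laplacian th).
Proof.
move=> hol; exists (-1); split; first exact: in_resolvent_setN1.
have pA := possa_posop (laplacian_positive th).
move=> u v C uv uC.
have [K K0 hK] := energy_poincare s2V hol.
apply: (compact_embedding (weight_ge0 G) (C := K * C ^+ 2) prod_weight_small).
move=> n s us.
have [F [H [vF A uE]]] := resolventN1 (uv n).
have [k Fk Fh] := (laplacianP th F H).1 A.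
have [lk ek] := dd_graph_l2 Fk.
have [sE hE] := fibre_energy_le us2 lk.
have en : tsum (fibre_energy th2 s2 (v n)) <= C ^+ 2.
  rewrite vF; apply: le_trans hE _; rewrite ek -(Fh _ _ Fk).
  have := uC n; rewrite uE l2norm_hnorm => nC.
  have [b1 b2] := posop_bound pA A.
  apply: le_trans (ler_norm _) _; apply: le_trans (dot_le _ _ _) _.
  rewrite expr2; apply: ler_pM; rewrite ?hnorm_ge0//; exact: le_trans nC.
have hs x : \sum_(y <- s2) sqc (v n (x, y)) <= K * fibre_energy th2 s2 (v n) x.
  exact: (hK (fibre (v n) x)).
apply: (@le_trans _ _ (\sum_(x <- undup [seq p.1 | p <- s]) \sum_(y <- s2)
    sqc (v n (x, y)))).
  rewrite -(big_allpairs_dep (F := fun p => sqc (v n p)) (h := pair) )/=.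
  apply: sum_subset_le => // [p|[x y] xy]; first exact: sqc_ge0.
  rewrite mem_pairs s2V andbT mem_undup; by apply/mapP; exists (x, y).
apply: le_trans (ler_wpM2l K0 en).
apply: (@le_trans _ _ (K * \sum_(x <- undup [seq p.1 | p <- s])
    fibre_energy th2 s2 (v n) x)).
  by rewrite mulr_sumr; apply: ler_sum => x _.
rewrite ler_wpM2l//; apply: tsum_ge_seq; rewrite ?undup_uniq//.
  exact: fibre_energy_ge0.
by rewrite vF.
Qed.

Section TrivialHolonomy.
Context (phi : V2 -> R[i]) (phi1 : forall y, sqc (phi y) = 1)
  (phi_par : forall y z, edgew G2 (y, z) * sqc (dd th2 phi (y, z)) = 0).
Context (g : nat -> V1) (g_inj : injective g)
  (g_small : forall n, weight G1 (g n) < 2^-1 ^+ n).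

Lemma energy_scaled_phi (c : R[i]) : energy th2 s2 (fun y => c * phi y) = 0.
Proof.
rewrite /energy big1// => y _; rewrite big1// => z _.
by rewrite ddZ sqcM mulrCA phi_par mulr0.
Qed.

(** Take the indicator of the sparse points times [phi]: its fibres are parallel, its mass is finite
    by geometric decay, and its unweighted sum counts infinitely many points. *)
Lemma form_dom_not_degree_dom : exists2 f, form_dom th f &
  ~ (l2 m f /\ sumable (fun p => sqc (f p))).
Proof.
pose S x := `[< exists n, g n = x >].
pose f (p : V1 * V2) : R[i] := (S p.1)%:R * phi p.2.
have fE p : sqc (f p) = (S p.1)%:R.
  rewrite /f sqcM phi1 mulr1; case: (S p.1); last by rewrite sqc0.
  by rewrite /sqc /= expr0n expr1n addr0.
have sw : sumable (fun x => (S x)%:R * weight G1 x).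
  apply: (@sumable_bound _ _ _ 2) => s us.
  (* The entries of [s] on the sequence are among its first [N] terms, which reduces to a geometric
     sum. *)
  have [N hN] : exists N, forall x, x \in s -> S x -> x \in [seq g n | n <- iota 0 N].
    elim: s {us} => [|a s [N hN]]; first by exists 0%N.
    have [/asboolP[n na]|nS] := boolP (S a); last first.
      by exists N => x; rewrite inE => /predU1P[->|]; [rewrite (negbTE nS)|exact: hN].
    exists (maxn n.+1 N) => x; rewrite inE => /predU1P[-> _|xs Sx].
      by apply/mapP; exists n; rewrite ?mem_iota //= leq_max ltnSn.
    have /mapP[j] := hN x xs Sx; rewrite mem_iota add0n => jN ->.
    by apply/mapP; exists j; rewrite // mem_iota add0n leq_max; move: jN => /= ->; rewrite orbT.
  apply: (@le_trans _ _ (\sum_(x <- [seq g n | n <- iota 0 N]) weight G1 x)).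
    rewrite (bigID S) /= [X in _ + X]big1 ?addr0; last first.
      by move=> x /negbTE ->; rewrite mul0r.
    rewrite -big_filter.
    apply: (@le_trans _ _ (\sum_(x <- [seq x <- s | S x]) weight G1 x)).
      apply: ler_sum => x _; rewrite ler_piMl ?weight_ge0//.
      by case: (S x).
    apply: sum_subset_le => [x||x].
    - exact: weight_ge0.
    - exact: filter_uniq.
    - by rewrite mem_filter => /andP[Sx xs]; exact: hN.
  rewrite big_map; apply: le_trans (geometric_half_le N).
  by rewrite /index_iota subn0; apply: ler_sum => n _; exact/ltW.
exists f.
  apply/(form_domE th1 th2 I0 us2 s2V C1_ge0 degC1); split.
    rewrite l2E; apply/(sumable_fibre us2 s2V).
      by move=> p; rewrite mulr_ge0 ?weight_ge0 ?sqc_ge0.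
    have M0 : 0 <= \sum_(y <- s2) weight G2 y.
      by apply: sumr_ge0 => y _; exact: weight_ge0.
    apply: sumable_le (sumableZ M0 _ sw) => x; last by rewrite mulr_ge0 ?weight_ge0.
    rewrite mulr_suml; apply: ler_sum => y _; rewrite fE /= /prod_weight /=.
    by rewrite le_eqVlt; apply/orP; left; apply/eqP; ring.
  apply: (@sumable_fin _ _ _ [::]) => x; first exact: fibre_energy_ge0.
  by move=> _; exact: (energy_scaled_phi (S x)%:R).
move=> [_ sf]; have [y0 _] := I0.
pose T := tsum (fun p => sqc (f p)).
(* More points than the supposed sum [T] allows, each contributing 1. *)
pose N := (Num.truncn T).+1.
have := @tsum_ge_seq _ _ _ [seq (g n, y0) | n <- iota 0 N]
  (fun p => sqc_ge0 (f p)) sf.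
rewrite map_inj_uniq ?iota_uniq; last by move=> i j [] /g_inj.
move=> /(_ isT); rewrite big_map.
under eq_bigr => n _.
  rewrite fE /= (_ : S (g n) = true); last by apply/asboolP; exists n.
  over.
rewrite big_const_seq count_predT size_iota iter_addr_0 -/T.
by rewrite leNgt truncnS_gt.
Qed.

(** Vertical terms vanish because [phi] is parallel, and horizontal edges exist only over [I];
    dividing by the product weight leaves [1 / m2]. *)
Lemma prod_lapfun (f1 : V1 -> R[i]) x y : Cc f1 ->
  lapfun th (fun p => f1 p.1 * phi p.2) (x, y) =
  (y \in I)%:R * ((weight G2 y)^-1)%:C%C * phi y * lapfun th1 f1 x.
Proof.
move=> Cf; have [t [ut ft _ sup]] := dd_support (G := G1) Cf Cf.
pose f p := f1 p.1 * phi p.2.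
pose B x' : R[i] := (y \in I)%:R * phi y * ((edge G1 x x')%:C%C * dd th1 f1 (x, x')).
have edd z : (edge G2 y z)%:C%C * dd th2 phi (y, z) = 0.
  have /eqP := phi_par y z; rewrite /edgew /= !mulf_eq0 invr_eq0.
  rewrite pnatr_eq0 orbF => /orP[/eqP->|/eqP/sqc_eq0 ->]; first by rewrite mul0r.
  by rewrite mulr0.
have term x' z : (edge G (x, y) (x', z))%:C%C * dd th f ((x, y), (x', z)) =
    (y == z)%:R * B x'.
  have -> : dd th f ((x, y), (x', z)) =
      f (x, y) - cexp (@prod_theta R V1 V2 G1 G2 I th1 th2 (x, y) (x', z)) * f (x', z).
    by [].
  rewrite /prod_theta /= /prod_edge /= /f /= /B.
  have [<-|xx] := eqVneq x x'; have [<-|yy] := eqVneq y z.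
  - by rewrite !edge_loopless !(mul0r, mulr0, addr0).
  - rewrite edge_loopless !(mul0r, mulr0, mul1r, add0r).
    have := edge_ge0 G2 y z; rewrite le_eqVlt => /predU1P[<-|yz].
      by rewrite mul0r.
    rewrite yz [X in _ * X](_ : _ = f1 x * dd th2 phi (y, z)); last by rewrite ddE; ring.
    by rewrite mulrCA edd mulr0.
  - rewrite !(mul0r, mul1r, mulr1, addr0).
    have := edge_ge0 G1 x x'; rewrite le_eqVlt => /predU1P[<-|xx'].
      by rewrite !(mul0r, mulr0).
    case: (y \in I); rewrite !(mulr1, mulr0, mul0r, mul1r)// xx' ddE.
    by ring.
  - by rewrite !(mul0r, mulr0, addr0).
rewrite /lapfun (fsbig_seqT (s := [seq (u, v) | u <- t, v <- s2])).
- rewrite big_allpairs_dep /=.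
  under eq_bigr => x' _ do under eq_bigr => z _ do rewrite term.
  under eq_bigr => x' _.
    rewrite (bigD1_seq y)//= eqxx mul1r big1 ?addr0 => [|z]; last first.
      by rewrite eq_sym => /negbTE ->; rewrite mul0r.
    over.
  rewrite -mulr_sumr (fsbig_seqT ut) => [|x' x't]; last first.
    have [|->|[fx fx' _ _]] := sup x x'; rewrite ?x't ?orbT ?mul0r//.
    by rewrite dd0// mulr0.
  rewrite /prod_weight /= invfM rmorphM /=; ring.
- by rewrite allpairs_uniq// => -[? ?] [? ?].
- move=> [x' z]; rewrite mem_pairs s2V andbT => x't.
  rewrite term /B; have [|->|[fx fx' _ _]] := sup x x'; rewrite ?x't ?orbT//.
    by rewrite mul0r !mulr0.
  by rewrite dd0// !mulr0.
Qed.

Lemma rdot_prod (f1 : V1 -> R[i]) (f2 : V2 -> R[i]) (C : R) : l2 (weight G1) f1 ->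
  (\sum_(y <- s2) weight G2 y * sqc (f2 y)) <= C ->
  rdot m (fun p => f1 p.1 * f2 p.2) (fun p => f1 p.1 * f2 p.2) <=
    C * rdot (weight G1) f1 f1.
Proof.
move=> l1 fC; rewrite (rdot_tsum (weight_ge0 G)).
rewrite (rdot_tsum (weight_ge0 G1)).
apply: tsum_le => [p|s us]; first by rewrite mulr_ge0 ?weight_ge0 ?sqc_ge0.
pose t := undup [seq p.1 | p <- s].
have m1_0 x : 0 <= weight G1 x * sqc (f1 x) by rewrite mulr_ge0 ?weight_ge0 ?sqc_ge0.
apply: (@le_trans _ _ (\sum_(p <- [seq (x, y) | x <- t, y <- s2])
    m p * sqc (f1 p.1 * f2 p.2))).
  apply: sum_subset_le => // [p|[x y] xy].
    by rewrite mulr_ge0 ?weight_ge0 ?sqc_ge0.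
  by rewrite mem_pairs s2V andbT mem_undup; apply/mapP; exists (x, y).
rewrite big_allpairs_dep /=.
have C0 : 0 <= C.
  by apply: le_trans fC; apply: sumr_ge0 => y _; rewrite mulr_ge0 ?weight_ge0 ?sqc_ge0.
apply: (@le_trans _ _ (C * \sum_(x <- t) weight G1 x * sqc (f1 x))).
  rewrite mulr_sumr; apply: ler_sum => x _.
  apply: le_trans (ler_wpM2r (m1_0 x) fC); rewrite mulr_suml.
  apply: ler_sum => y _; rewrite sqcM /prod_weight /=.
  by rewrite le_eqVlt; apply/orP; left; apply/eqP; ring.
rewrite ler_wpM2l//; apply: tsum_ge_seq => //; last exact: undup_uniq.
exact: l2_sumable.
Qed.

(** Normalised point masses at the sparse vertices times [phi] are bounded with disjoint supports,
    and [prod_lapfun] bounds their images under [Delta]. So for any [z] they are resolvent images of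
    a bounded sequence, yet have no convergent subsequence. *)
Lemma trivial_holonomy_not_compact : op_bounded (weight G1) (laplacian th1) ->
  ~ compact_resolvent m (laplacian th).
Proof.
move=> [C hC] [z [_ cR]].
pose a k : R[i] := ((Num.sqrt (weight G1 (g k)))^-1)%:C%C.
have sqa k : weight G1 (g k) * sqc (a k) = 1.
  rewrite sqc_real exprVn sqr_sqrtr ?weight_ge0// mulfV//.
  by rewrite gt_eqF ?weight_gt0.
pose f1 k (x : V1) : R[i] := if x == g k then a k else 0.
have Cf1 k : Cc (f1 k) by exact: delta_Cc.
pose f k p := f1 k p.1 * phi p.2.
have Cf k : Cc (f k).
  apply/CcP; exists (undup [seq (u, v) | u <- [:: g k], v <- s2]).
  split=> [|[x y]]; first exact: undup_uniq.
  by rewrite mem_undup mem_pairs s2V andbT inE /f /f1 /= => /negbTE ->; rewrite mul0r.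
pose h k := lapfun th (f k).
have Afh k : laplacian th (f k, h k) by exact: Cc_laplacian.
have lf k : l2 m (f k) by exact: Cc_l2.
have lh k : l2 m (h k) by exact: (Cc_l2 (Cc_lapfun th (Cf k))).
pose M := \sum_(y <- s2) weight G2 y.
have nf1 k : rdot (weight G1) (f1 k) (f1 k) = 1 by rewrite rdot_delta.
have nf k : rdot m (f k) (f k) <= M.
  have := @rdot_prod (f1 k) phi M (Cc_l2 (Cf1 k)); rewrite nf1 mulr1; apply.
  by rewrite /M le_eqVlt; apply/orP; left; apply/eqP; apply: eq_bigr => y _;
    rewrite phi1 mulr1.
pose E := \sum_(y <- s2) (weight G2 y)^-1.
have E0 : 0 <= E by apply: sumr_ge0 => y _; rewrite invr_ge0 weight_ge0.
have nh k : rdot m (h k) (h k) <= E * C ^+ 2.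
  pose f2 y : R[i] := (y \in I)%:R * ((weight G2 y)^-1)%:C%C * phi y.
  have -> : h k = fun p => lapfun th1 (f1 k) p.1 * f2 p.2.
    by apply/funext => -[x y]; rewrite /h /f prod_lapfun// mulrC.
  have lL := Cc_l2 (Cc_lapfun th1 (Cf1 k)).
  apply: (@le_trans _ _ (E * rdot (weight G1) (lapfun th1 (f1 k)) (lapfun th1 (f1 k)))).
    apply: rdot_prod => //; apply: ler_sum => y _.
    rewrite /f2 !sqcM phi1 mulr1 sqc_real.
    have w0 := weight_gt0 G2 y.
    case: (y \in I); last by rewrite sqc0 mul0r mulr0 invr_ge0 weight_ge0.
    by rewrite /sqc /= expr0n expr1n addr0 mul1r expr2 mulrA mulfV ?mul1r// gt_eqF.
  rewrite ler_wpM2l//.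
  have := hC _ _ (Cc_laplacian th1 (Cf1 k)).
  rewrite (l2norm_sqrt (weight_ge0 G1)) (l2norm_sqrt (weight_ge0 G1)) nf1 sqrtr1 mulr1.
  move=> hle; rewrite -[leLHS]sqr_sqrtr ?rdot_ge0//; last exact: weight_ge0.
  have C0 : 0 <= C by apply: le_trans hle; exact: sqrtr_ge0.
  by rewrite ler_sqr ?nnegrE ?sqrtr_ge0.
pose u k x := h k x - z * f k x.
pose K := 2 * (E * C ^+ 2) + 2 * (sqc z * M).
have lu k : l2 m (u k).
  by apply: l2B => //; [exact: weight_ge0|apply: l2Z => //; exact: weight_ge0].
have nu k : l2norm m (u k) <= Num.sqrt K.
  rewrite (l2norm_sqrt (weight_ge0 G)) ler_wsqrtr//.
  rewrite (rdot_tsum (weight_ge0 G)).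
  apply: tsum_le => [p|s us]; first by rewrite mulr_ge0 ?weight_ge0 ?sqc_ge0.
  apply: (@le_trans _ _ (2 * \sum_(p <- s) m p * sqc (h k p) +
      2 * (sqc z * \sum_(p <- s) m p * sqc (f k p)))).
    rewrite !mulr_sumr -big_split; apply: ler_sum => p _.
    apply: le_trans (ler_wpM2l (weight_ge0 G p) (sqcB_le (h k p) (z * f k p))) _.
    suff -> : m p * (2 * sqc (h k p) + 2 * sqc (z * f k p)) =
      2 * (m p * sqc (h k p)) + 2 * (sqc z * (m p * sqc (f k p))) by [].
    by rewrite (sqcM z (f k p)); ring.
  have sle (q : V1 * V2 -> R[i]) : l2 m q -> \sum_(p <- s) m p * sqc (q p) <= rdot m q q.
    move=> lq; rewrite (rdot_tsum (weight_ge0 G)); apply: tsum_ge_seq => //.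
      by move=> p; rewrite mulr_ge0 ?weight_ge0 ?sqc_ge0.
    exact: l2_sumable.
  have b1 := le_trans (sle _ (lh k)) (nh k).
  have b2 := ler_wpM2l (sqc_ge0 z) (le_trans (sle _ (lf k)) (nf k)).
  by rewrite /K; lra.
have [|psi [F [psi_mono lF cF]]] := cR u f (Num.sqrt K) _ nu.
  by move=> k; exists (h k); split; [exact: Afh|].
pose fL k : L2 (weight_ge0 G) := l2mk (weight_ge0 G) (lf (psi k)).
have /hcvg_cauchy cau : hcvg (l2_hilbert (weight_ge0 G)) fL (l2mk (weight_ge0 G) lF).
  exact/l2cvgP.
have M0 : 0 < M.
  have [y0 _] := I0; apply: lt_le_trans (weight_gt0 G2 y0) _.
  by apply: (sum_ge1 (F := weight G2)) => //; exact: weight_ge0.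
(* [M] is the squared norm of each [f k]; the difference of two of them reaches it on a single fibre
   already. *)
have s0 : 0 < Num.sqrt M by rewrite sqrtr_gt0.
have [N hN] := cau _ s0.
have := hN N N.+1 (leqnn _) (leqnSn _).
rewrite hnorm_lt ?sqrtr_ge0// sqr_sqrtr ?(ltW M0)// ltNge => /negP; apply.
rewrite l2_dotE (rdot_tsum (weight_ge0 G)).
apply: (@le_trans _ _ (\sum_(p <- [seq (g (psi N), y) | y <- s2])
    m p * sqc ((fL N - fL N.+1) p))); last first.
  apply: tsum_ge_seq.
  - by move=> p; rewrite mulr_ge0 ?weight_ge0 ?sqc_ge0.
  - exact: (l2_sumable (l2val_l2 (fL N - fL N.+1))).
  - by rewrite map_inj_uniq// => y y' [].
rewrite big_map; apply: ler_sum => y _.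
have -> : (fL N - fL N.+1) (g (psi N), y) = a (psi N) * phi y.
  rewrite l2_subE /= /f /f1 /= eqxx.
  have [e|_] := eqVneq (g (psi N)) (g (psi N.+1)); last by rewrite mul0r subr0.
  by have := psi_mono N N.+1 (ltnSn N); rewrite (g_inj e) ltnn.
by rewrite sqcM phi1 mulr1 /= /prod_weight /= mulrAC sqa mul1r.
Qed.

End TrivialHolonomy.

End CuspSpectrum.

(** * The kernel projection and the tensor product *)

Section KernelProjection.
Context {R : realType} {V : countType} {G : wgraph R V} (th : potential G).
Context (s : seq V) (us : uniq s) (sV : forall y, y \in s) (y0 : V).
Context (phi : V -> R[i]) (phi1 : forall y, sqc (phi y) = 1)
  (phi_par : forall y z, edgew G (y, z) * sqc (dd th phi (y, z)) = 0).
Context (C : R) (C_ge0 : 0 <= C) (poincare : forall g : V -> R[i], exists a,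
  \sum_(y <- s) sqc (g y - a * phi y) <= C * energy th s g).
Implicit Types (g h : V -> R[i]).
Local Notation m := (weight G).

Lemma finite_Cc g : Cc g.
Proof. by apply/CcP; exists s; split=> // x; rewrite sV. Qed.

Lemma inner_seq g h : inner m g h = \sum_(y <- s) (m y)%:C%C * g y * (h y)^*%C.
Proof. by apply: csum_seq => // y; rewrite sV. Qed.

(** The projection coefficient along [phi], whose squared norm is the total mass because
    [|phi| = 1]. *)
Definition coeff g : R[i] :=
  (\sum_(y <- s) m y)^-1%:C%C * \sum_(y <- s) (m y)%:C%C * g y * (phi y)^*%C.

Definition kproj g (y : V) : R[i] := g y - coeff g * phi y.

Lemma total_gt0 : 0 < \sum_(y <- s) m y.
Proof.
apply: lt_le_trans (weight_gt0 G y0) _.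
by apply: (sum_ge1 (F := m)) => // y; exact: weight_ge0.
Qed.

Lemma phi_conj y : phi y * (phi y)^*%C = 1.
Proof.
apply/eqP; rewrite eq_complex; have := phi1 y; case: (phi y) => a b.
rewrite /sqc /= => e; apply/andP; split; apply/eqP; last by ring.
by rewrite -e; ring.
Qed.

Lemma coeffD g h : coeff (fun y => g y + h y) = coeff g + coeff h.
Proof.
by rewrite /coeff -mulrDr -big_split; congr (_ * _); apply: eq_bigr => y _ /=; ring.
Qed.

Lemma coeffZ (c : R[i]) g : coeff (fun y => c * g y) = c * coeff g.
Proof.
rewrite /coeff [RHS]mulrCA; congr (_ * _); rewrite mulr_sumr; apply: eq_bigr => y _; ring.
Qed.

Lemma coeff_phi : coeff phi = 1.
Proof.
rewrite /coeff.
have -> : \sum_(y <- s) (m y)%:C%C * phi y * (phi y)^*%C = \sum_(y <- s) (m y)%:C%C.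
  by apply: eq_bigr => y _; rewrite -mulrA phi_conj mulr1.
rewrite -(raddf_sum (real_complex R)) -rmorphM /= mulVf ?rmorph1//.
by rewrite gt_eqF// total_gt0.
Qed.

Lemma kprojD g h y : kproj (fun y => g y + h y) y = kproj g y + kproj h y.
Proof. by rewrite /kproj coeffD; ring. Qed.

Lemma kprojZ (c : R[i]) g y : kproj (fun y => c * g y) y = c * kproj g y.
Proof. by rewrite /kproj coeffZ; ring. Qed.

Lemma kproj_phi (c : R[i]) y : kproj (fun y => c * phi y) y = 0.
Proof. by rewrite kprojZ /kproj coeff_phi mul1r subrr mulr0. Qed.

Lemma coeff_kproj g : coeff (kproj g) = 0.
Proof.
have := coeffD (kproj g) (fun y => coeff g * phi y).
rewrite coeffZ coeff_phi mulr1.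
have -> : (fun y => kproj g y + coeff g * phi y) = g.
  by apply/funext => y; rewrite /kproj subrK.
by move=> /eqP; rewrite -subr_eq0 opprD addrCA subrr addr0 oppr_eq0 => /eqP.
Qed.

Lemma inner_phi g (c : R[i]) : inner m g (fun y => c * phi y) =
  c^*%C * (\sum_(y <- s) m y)%:C%C * coeff g.
Proof.
rewrite inner_seq /coeff mulrA -[_ * _ * (_^-1)%:C%C]mulrA -rmorphM /=.
rewrite mulfV ?gt_eqF ?total_gt0// rmorph1 mulr1 mulr_sumr.
by apply: eq_bigr => y _; rewrite rmorphM; ring.
Qed.

(** A kernel element has zero energy, so [poincare] makes it a multiple of [phi]; conversely
    [lapfun] kills parallel sections. *)
Lemma kernelP f : op_ker (laplacian th) f <-> exists c, f = (fun y => c * phi y).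
Proof.
pose F := l2mk (weight_ge0 G) (Cc_l2 (G := G) (finite_Cc f)).
split=> [kf|[c ->]].
  have [k Fk h] := (laplacianP th F 0).1 kf.
  have := h _ _ Fk; rewrite dot0l => /esym k0.
  have [lk ek] := dd_graph_l2 Fk; rewrite k0 in ek.
  have e0 : energy th s f = 0.
    rewrite /energy big1// => y _; rewrite big1// => z _.
    apply/eqP; rewrite eq_le mulr_ge0 ?edgew_ge0 ?sqc_ge0// andbT -ek.
    exact: (wsqc_le_rdot (edgew_ge0 G) (y, z) lk).
  have [a ha] := poincare f; exists a; apply/funext => y.
  apply/eqP; rewrite -subr_eq0; apply/eqP/sqc_eq0/eqP.
  rewrite eq_le sqc_ge0 andbT; rewrite e0 mulr0 in ha; apply: le_trans ha.
  apply: (sum_ge1 (F := fun y => sqc (f y - a * phi y))) => // z.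
  exact: sqc_ge0.
have e : (cst 0 : V -> R[i]) = lapfun th (fun y => c * phi y).
  apply/funext => y; rewrite /lapfun fsbig1 ?mulr0// => z _.
  rewrite ddZ; have /eqP := phi_par y z; rewrite /edgew /= !mulf_eq0 invr_eq0.
  rewrite pnatr_eq0 orbF => /orP[/eqP->|/eqP/sqc_eq0 ->]; first by rewrite mul0r.
  by rewrite !mulr0.
by rewrite /op_ker /= e; exact: Cc_laplacian (finite_Cc _).
Qed.

Lemma orthP g : orth m (op_ker (laplacian th)) g <-> coeff g = 0.
Proof.
have N0 : (\sum_(y <- s) m y)%:C%C != 0 :> R[i].
  by rewrite (fmorph_eq0 (real_complex R)) gt_eqF// total_gt0.
split=> [[_ h]|c0].
  have k1 : op_ker (laplacian th) (fun y => 1 * phi y) by apply/kernelP; exists 1.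
  have /eqP := h _ k1; rewrite inner_phi rmorph1 mul1r mulf_eq0 (negbTE N0).
  by move=> /eqP.
split; first exact: (Cc_l2 (finite_Cc g)).
by move=> f /kernelP[c ->]; rewrite inner_phi c0 mulr0.
Qed.

Lemma orth_projP f g :
  orth_proj m (orth m (op_ker (laplacian th))) (f, g) <-> g = kproj f.
Proof.
have innB a b h : inner m (fun y => a y + b y) h = inner m a h + inner m b h.
  by rewrite !inner_seq -big_split; apply: eq_bigr => y _ /=; ring.
have phiinn c h : coeff h = 0 -> inner m (fun y => c * phi y) h = 0.
  move=> h0; have := inner_phi h c; rewrite h0 mulr0 !inner_seq => e.
  apply: (can_inj (@conjcK _)); rewrite rmorph0 -[RHS]e rmorph_sum.
  apply: eq_bigr => y _; move: (m y) (c * phi y) (h y) => r [a b] [a' b'].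
  by apply/eqP; rewrite eq_complex /=; apply/andP; split; apply/eqP; ring.
split=> [[/= _ /orthP g0 h]|->]; last first.
  split=> /=; [exact: (Cc_l2 (finite_Cc f))|by apply/orthP; exact: coeff_kproj|].
  move=> h /orthP h0.
  have -> : f \- kproj f = fun y => coeff f * phi y.
    by apply/funext => y; rewrite /kproj /= subKr.
  exact: phiinn.
(* The defect [r] is itself an admissible test function. As [f - g] is [r] plus a multiple of [phi],
   the test yields the squared norm of [r]. *)
pose r y := kproj f y - g y.
have r0 : coeff r = 0.
  have := coeffD r g; rewrite g0 addr0 => <-.
  have -> : (fun y => r y + g y) = kproj f by apply/funext => y; rewrite /r subrK.
  exact: coeff_kproj.
have := h r ((orthP r).2 r0).
have -> : f \- g = fun y => r y + coeff f * phi y.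
  by apply/funext => y; rewrite /r /kproj /=; ring.
rewrite innB phiinn// addr0 inner_rdot => -[rr _].
apply/funext => y; apply/esym/eqP; rewrite -subr_eq0; apply/eqP/sqc_eq0/eqP.
rewrite eq_le sqc_ge0 andbT -(pmulr_rle0 _ (weight_gt0 G y)) -rr.
exact: (wsqc_le_rdot (weight_ge0 G) y (Cc_l2 (finite_Cc r))).
Qed.

Lemma sqc_sum_le (t : seq V) : exists2 K : R, 0 <= K &
  forall F : V -> R[i], sqc (\sum_(y <- t) F y) <= K * \sum_(y <- t) sqc (F y).
Proof.
elim: t => [|b t [K K0 hK]].
  by exists 0 => // F; rewrite !big_nil sqc0 mulr0.
exists (2 + 2 * K); first by rewrite addr_ge0 ?mulr_ge0.
move=> F; rewrite !big_cons; apply: le_trans (sqcD_le _ _) _.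
have := hK F; have := sqc_ge0 (F b).
have : 0 <= \sum_(y <- t) sqc (F y) by apply: sumr_ge0 => y _; exact: sqc_ge0.
by move: (\sum_(_ <- _) _) (sqc (\sum_(_ <- _) _)) => S T; nra.
Qed.

Lemma kproj_le : exists2 K : R, 0 <= K &
  forall g y, sqc (kproj g y) <= K * \sum_(z <- s) sqc (g z).
Proof.
have [K K0 hK] := sqc_sum_le s.
pose N := \sum_(y <- s) m y; pose M := \sum_(y <- s) m y ^+ 2.
have M0 : 0 <= M by apply: sumr_ge0 => y _; exact: sqr_ge0.
exists (2 + 2 * (N^-1 ^+ 2 * (K * M))).
  apply: addr_ge0 => //; apply: mulr_ge0 => //.
  by apply: mulr_ge0; [exact: sqr_ge0|exact: mulr_ge0].
move=> g y; set S := \sum_(z <- s) sqc (g z).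
have S0 : 0 <= S by apply: sumr_ge0 => z _; exact: sqc_ge0.
apply: le_trans (sqcB_le _ _) _; rewrite sqcM phi1 mulr1.
have h1 : sqc (g y) <= S.
  by apply: (sum_ge1 (F := fun z => sqc (g z))) => // z; exact: sqc_ge0.
have h2 : sqc (coeff g) <= N^-1 ^+ 2 * (K * (M * S)).
  rewrite /coeff sqcM sqc_real ler_wpM2l ?sqr_ge0//.
  apply: le_trans (hK _) _; rewrite ler_wpM2l// /M mulr_suml.
  apply: ler_sum => z _; rewrite !sqcM sqc_real.
  have -> : sqc (phi z)^*%C = 1.
    by rewrite -(phi1 z); case: (phi z) => a b; rewrite /sqc /= sqrrN.
  rewrite mulr1 ler_wpM2l ?sqr_ge0//.
  by apply: (sum_ge1 (F := fun z => sqc (g z))) => // w; exact: sqc_ge0.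
by lra.
Qed.

Lemma energy_kproj g : energy th s (kproj g) = energy th s g.
Proof.
apply: eq_bigr => y _; apply: eq_bigr => z _.
have /eqP := phi_par y z; rewrite mulf_eq0 => /orP[/eqP->|/eqP/sqc_eq0 e].
  by rewrite !mul0r.
have -> // : dd th (kproj g) (y, z) = dd th g (y, z).
transitivity (dd th g (y, z) - coeff g * dd th phi (y, z)).
  by rewrite !ddE /kproj; ring.
by rewrite e mulr0 subr0.
Qed.

Definition wnorm2 g : R := \sum_(y <- s) m y * sqc (g y).

Lemma wnorm2_ge0 g : 0 <= wnorm2 g.
Proof. by apply: sumr_ge0 => y _; rewrite mulr_ge0 ?weight_ge0 ?sqc_ge0. Qed.

Lemma wnorm2_kproj_le : exists2 K : R, 0 <= K &
  forall g, wnorm2 (kproj g) <= K * energy th s g.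
Proof.
have [K K0 hK] := kproj_le; pose M := \sum_(y <- s) m y.
have M0 : 0 <= M by exact/ltW/total_gt0.
exists (M * (K * C)); first by rewrite !mulr_ge0.
move=> g; have [a ha] := poincare g.
rewrite /wnorm2 -mulrA /M mulr_suml; apply: ler_sum => y _.
rewrite ler_wpM2l ?weight_ge0// -mulrA.
(* The projection ignores multiples of [phi], so [g] may be replaced by its difference with the
   section supplied by [poincare]. *)
have -> : kproj g y = kproj (fun z => g z + (- a) * phi z) y.
  by rewrite kprojD kproj_phi addr0.
apply: le_trans (hK _ _) _; rewrite ler_wpM2l//; apply: le_trans ha.
by under eq_bigr => z _ do rewrite mulNr.
Qed.

Lemma energy_le_wnorm2 : exists2 K : R, 0 <= K &
  forall g, energy th s g <= K * wnorm2 (kproj g).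
Proof.
have [K K0 hK] := energy_le th sV.
pose D := \sum_(y <- s) (m y)^-1.
have D0 : 0 <= D by apply: sumr_ge0 => y _; rewrite invr_ge0 weight_ge0.
exists (K * D); first by rewrite mulr_ge0.
move=> g; rewrite -energy_kproj; apply: le_trans (hK _) _.
rewrite -mulrA ler_wpM2l// mulr_sumr; apply: ler_sum => y _.
rewrite mulrA ler_peMl ?sqc_ge0// -ler_pdivrMr ?weight_gt0// mul1r.
by apply: (sum_ge1 (F := fun y => (m y)^-1)) => // z; rewrite invr_ge0 weight_ge0.
Qed.

End KernelProjection.

Lemma l2cvg_pointwise (R : realType) (V : choiceType) (w : V -> R)
    (w0 : forall x, 0 <= w x) (u : nat -> V -> R[i]) f x : l2cvg w u f -> 0 < w x ->
  forall e, 0 < e -> exists N, forall n, (N <= n)%N -> sqc (u n x - f x) < e.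
Proof.
move=> /fine_cvgP[fin /cvgrPdist_lt cv] wx e e0.
have [N _ hN] := filterI fin (cv _ (mulr_gt0 wx e0)).
exists N => n /hN[/= fn]; rewrite sub0r normrN => /(le_lt_trans (ler_norm _)) h.
rewrite -(ltr_pM2l wx); apply: le_lt_trans h; rewrite -lee_fin fineK// l2sqE.
have := esum_ge_seq (fun x => w x * sqc ((u n \- f) x)) (s := [:: x]) isT.
by rewrite big_seq1.
Qed.

Lemma uniform_threshold (T : eqType) (s : seq T) (P : T -> nat -> Prop) :
  (forall x, exists N, forall n, (N <= n)%N -> P x n) ->
  exists N, forall n x, (N <= n)%N -> x \in s -> P x n.
Proof.
move=> h; elim: s => [|a s [N hN]]; first by exists 0%N.
have [M hM] := h a; exists (maxn M N) => n x; rewrite geq_max inE.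
by move=> /andP[Mn Nn] /predU1P[->|xs]; [exact: hM|exact: hN].
Qed.

Section TensorDomain.
Context {R : realType} {V1 V2 : countType}.
Context {G1 : wgraph R V1} {G2 : wgraph R V2} (th1 : potential G1) (th2 : potential G2).
Context {I : set V2} (I0 : I !=set0).
Context (s2 : seq V2) (us2 : uniq s2) (s2V : forall y, y \in s2).
Context (C1 : R) (C1_ge0 : 0 <= C1) (degC1 : forall x (t : seq V1), uniq t ->
    \sum_(y <- t) edge G1 x y <= C1 * weight G1 x).
Context (y0 : V2) (phi : V2 -> R[i]) (phi1 : forall y, sqc (phi y) = 1)
  (phi_par : forall y z, edgew G2 (y, z) * sqc (dd th2 phi (y, z)) = 0).
Context (C : R) (C_ge0 : 0 <= C) (poincare : forall g : V2 -> R[i], exists a,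
  \sum_(y <- s2) sqc (g y - a * phi y) <= C * energy th2 s2 g).

Local Notation G := (prod_graph G1 G2 I0).
Local Notation th := (prod_potential I0 th1 th2).
Local Notation m := (weight G).
Local Notation P := (kproj (G := G2) s2 phi).
Local Notation A := (mult_op (weight G1) (fun x => (Num.sqrt (weight G1 x))^-1)).
Local Notation B := (orth_proj (weight G2) (orth (weight G2) (op_ker (laplacian th2)))).

Let c (x : V1) : R[i] := ((Num.sqrt (weight G1 x))^-1)%:C%C.

Let sqc_c x : weight G1 x * sqc (c x) = 1.
Proof.
rewrite sqc_real exprVn sqr_sqrtr ?weight_ge0// mulfV//.
by rewrite gt_eqF ?weight_gt0.
Qed.

Lemma kproj_sum (T : Type) (r : seq T) (a : T -> R[i]) (b : T -> V2 -> R[i]) y :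
  P (fun y => \sum_(i <- r) a i * b i y) y = \sum_(i <- r) a i * P (b i) y.
Proof.
elim: r => [|i r IH].
  have -> : (fun y => \sum_(i <- [::]) a i * b i y) = (fun y => 0 * phi y).
    by apply/funext => z; rewrite big_nil mul0r.
  by rewrite kprojZ mul0r big_nil.
have -> : (fun y => \sum_(i <- i :: r) a i * b i y) =
    (fun y => a i * b i y + \sum_(i <- r) a i * b i y).
  by apply/funext => z; rewrite big_cons.
by rewrite kprojD kprojZ IH big_cons.
Qed.

Lemma alg_tensorE u v : alg_tensor A B (u, v) ->
  forall x y, v (x, y) = c x * P (fibre u x) y.
Proof.
move=> [n [a [a' [b [b' [Aa Bb /= ue ve]]]]]] x y.
have -> : fibre u x = fun y => \sum_(i < n) a i x * b i y.
  by apply/funext => z; rewrite /fibre ue.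
rewrite kproj_sum ve mulr_sumr; apply: eq_bigr => i _ /=.
have [_ _ /= ->] := Aa i.
have /(orth_projP us2 s2V y0 phi1 phi_par poincare) -> := Bb i.
by rewrite mulrA.
Qed.

(** The square of [m1^(-1/2)] cancels [m1], which leaves the sum over [x] of the squared norms of
    the projected fibres. Pointwise limits identify the image of [f]; conversely, fibrewise
    truncations lie in the algebraic tensor product. *)
Lemma tensor_domE f : op_dom (op_tensor (weight G1) (weight G2) A B) f <->
  l2 m f /\ sumable (fun x => wnorm2 (G := G2) s2 (P (fibre f x))).
Proof.
have fibre_sum g x : (forall y, g (x, y) = c x * P (fibre f x) y) ->
    \sum_(y <- s2) m (x, y) * sqc (g (x, y)) = wnorm2 (G := G2) s2 (P (fibre f x)).
  move=> gE; apply: eq_bigr => y _; rewrite gE sqcM /= /prod_weight /=.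
  rewrite [LHS](_ : _ = (weight G1 x * sqc (c x)) * (weight G2 y *
    sqc (P (fibre f x) y))); last by ring.
  by rewrite sqc_c mul1r.
have term0 g (p : V1 * V2) : 0 <= m p * sqc (g p).
  by rewrite mulr_ge0 ?weight_ge0 ?sqc_ge0.
split=> [[g [/= lf lg [u [v [uv uf vg]]]]]|[lf sf]].
  split=> //.
  have [K K0 hK] := kproj_le (G := G2) s2V phi1.
  have gE x y : g (x, y) = c x * P (fibre f x) y.
    apply/eqP; rewrite -subr_eq0; apply/eqP/sqc_eq0/eqP.
    rewrite eq_le sqc_ge0 andbT; apply/ler_addgt0Pr => e e0; rewrite add0r.
    have e4 : 0 < e / 4 by rewrite divr_gt0.
    have [N1 h1] := l2cvg_pointwise (weight_ge0 G) vg (weight_gt0 G (x, y)) e4.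
    (* [E] bounds the image at [(x, y)] by the largest square on the fibre of [u n - f]; each of the
       two errors is doubled, hence [e / 4]. *)
    have [E [E0 EE]] : exists E, 0 <= E /\ E = sqc (c x) * (K * (size s2)%:R).
      by exists (sqc (c x) * (K * (size s2)%:R)); rewrite !mulr_ge0 ?sqc_ge0.
    have eE : 0 < e / 4 / (E + 1) by rewrite divr_gt0//; lra.
    have [N2 h2] := uniform_threshold s2
      (fun z => l2cvg_pointwise (weight_ge0 G) uf (weight_gt0 G (x, z)) eE).
    pose n := maxn N1 N2.
    have := h1 n (leq_maxl _ _) => a1.
    have a2 z : z \in s2 -> sqc (u n (x, z) - f (x, z)) < e / 4 / (E + 1).
      by apply: h2; rewrite leq_maxr.
    rewrite (_ : g (x, y) - _ = c x * P (fun z => u n (x, z) + (- 1) * f (x, z)) y -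
        (v n (x, y) - g (x, y))); last first.
      by rewrite kprojD kprojZ (alg_tensorE (uv n)); rewrite /fibre; ring.
    apply: le_trans (sqcB_le _ _) _; rewrite sqcM.
    have a3 := hK (fun z => u n (x, z) + (- 1) * f (x, z)) y.
    have a4 : \sum_(z <- s2) sqc (u n (x, z) + (- 1) * f (x, z)) <=
        (size s2)%:R * (e / 4 / (E + 1)).
      rewrite mulr_natl -[X in _ <= _ *+ X]count_predT -iter_addr_0 -big_const_seq.
      rewrite big_seq [leRHS]big_seq; apply: ler_sum => z /a2/ltW.
      by rewrite mulN1r.
    have a5 : sqc (c x) * sqc (P (fun z => u n (x, z) + (- 1) * f (x, z)) y) <=
        E * (e / 4 / (E + 1)).
      rewrite {1}EE -(mulrA (sqc (c x))) -(mulrA K) ler_wpM2l ?sqc_ge0//.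
      by apply: le_trans a3 _; rewrite ler_wpM2l.
    have a6 : E * (e / 4 / (E + 1)) <= e / 4.
      by rewrite mulrA ler_pdivrMr; nra.
    by lra.
  have /(sumable_fibre us2 s2V (term0 g)) sg := l2_sumable lg.
  by apply: sumable_le sg => x; rewrite fibre_sum.
pose g p := c p.1 * P (fibre f p.1) p.2.
have lg : l2 m g.
  rewrite l2E; apply/(sumable_fibre us2 s2V (term0 g)).
  by apply: sumable_le sf => x; rewrite fibre_sum.
have /choice[t ht] n : exists t : seq V1, uniq t /\
   (tsum (fun p => if p \in [seq (x, y) | x <- t, y <- s2] then 0
     else m p * sqc (f p)) < n.+1%:R^-1 /\
   tsum (fun p => if p \in [seq (x, y) | x <- t, y <- s2] then 0
     else m p * sqc (g p)) < n.+1%:R^-1).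
  have n0 : 0 < n.+1%:R^-1 :> R by rewrite invr_gt0.
  have [a [_ ha]] := tsum_tail (term0 f) (l2_sumable lf) n0.
  have [b [_ hb]] := tsum_tail (term0 g) (l2_sumable lg) n0.
  exists (undup ([seq p.1 | p <- a] ++ [seq p.1 | p <- b])).
  split; first exact: undup_uniq.
  split; [apply: ha|apply: hb] => -[x y] xy;
    rewrite mem_pairs s2V andbT mem_undup mem_cat; apply/orP; [left|right];
    by apply/mapP; exists (x, y).
pose u n p := if p.1 \in t n then f p else 0.
pose v n p := if p.1 \in t n then g p else 0.
have cut (h : V1 * V2 -> R[i]) : l2 m h ->
    (forall n, tsum (fun p => if p \in [seq (x, y) | x <- t n, y <- s2] then 0
      else m p * sqc (h p)) < n.+1%:R^-1) ->
    l2cvg m (fun n p => if p.1 \in t n then h p else 0) h.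
  move=> lh hh.
  have e n p : m p * sqc ((if p.1 \in t n then h p else 0) - h p) =
      if p \in [seq (x, y) | x <- t n, y <- s2] then 0 else m p * sqc (h p).
    case: p => x y; rewrite mem_pairs s2V andbT /=; case: ifP => _.
      by rewrite subrr sqc0 mulr0.
    by rewrite sub0r sqcN.
  apply: (@l2cvg_bound _ _ _ (weight_ge0 G) _ _ (fun k => k.+1%:R^-1)) => [n|n|].
  - rewrite l2E; apply: sumable_le (l2_sumable lh) => p; rewrite e.
    by case: ifP.
  - rewrite (rdot_tsum (weight_ge0 G)); apply: le_trans (ltW (hh n)).
    have -> // : (fun p => m p * sqc ((if p.1 \in t n then h p else 0) - h p)) =
      (fun p => if p \in [seq (x, y) | x <- t n, y <- s2] then 0 else m p * sqc (h p)).
    by apply/funext => p; rewrite e.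
  - exact: cvg_harmonic.
exists g; split; [exact: lf|exact: lg|exists u, v; split].
- move=> n; have [ut _] := ht n.
  (* The truncation is a finite sum of point masses at the entries of [t n], each tensored with the
     fibre of [f] there. *)
  pose x_ (i : 'I_(size (t n))) := tnth (in_tuple (t n)) i.
  exists (size (t n)), (fun i x => if x == x_ i then 1 else 0),
    (fun i x => c x * (if x == x_ i then 1 else 0)),
    (fun i => fibre f (x_ i)), (fun i => P (fibre f (x_ i))).
  have sumE (F : V1 -> R[i]) x :
      \sum_(i < size (t n)) (if x == x_ i then 1 else 0) * F (x_ i) =
      if x \in t n then F x else 0.
    rewrite -(big_tnth _ _ (t n) xpredT (fun z => (if x == z then 1 else 0) * F z)).
    case: ifP => xt.
      rewrite (bigD1_seq x)//= eqxx mul1r big1 ?addr0// => z.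
      by rewrite eq_sym => /negbTE ->; rewrite mul0r.
    rewrite big_seq big1// => z zt; case: eqP => [e|_]; last by rewrite mul0r.
    by rewrite e zt in xt.
  split=> [i|i|[x y]|[x y]] /=.
  + have Cd : Cc (fun x => if x == x_ i then 1 else 0 : R[i]) by exact: delta_Cc.
    split=> //=; first exact: (Cc_l2 Cd).
    apply: (Cc_l2 (G := G1)); apply/CcP; exists [:: x_ i]; split=> // x.
    by rewrite inE => /negbTE ->; rewrite mulr0.
  + exact/(orth_projP us2 s2V y0 phi1 phi_par poincare).
  + rewrite /u /=; have := sumE (fun z => f (z, y)) x; by move=> <-.
  + rewrite /v /g /=; have := sumE (fun z => c z * P (fibre f z) y) x => <-.
    apply: eq_bigr => i _; case: eqP => [->|_]; first by ring.
    by ring.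
- by apply: cut => // n; have [_ []] := ht n.
- by apply: cut => // n; have [_ []] := ht n.
Qed.

Lemma form_dom_tensor f : form_dom th f <->
  op_dom (op_tensor (weight G1) (weight G2) A B) f.
Proof.
rewrite (form_domE th1 th2 I0 us2 s2V C1_ge0 degC1) tensor_domE.
have [K K0 hK] := wnorm2_kproj_le s2V y0 phi1 C_ge0 poincare.
have [D D0 hD] := energy_le_wnorm2 s2V phi_par.
have w0 x : 0 <= wnorm2 (G := G2) s2 (P (fibre f x)) by exact: wnorm2_ge0.
split=> -[lf sf]; split=> //.
  apply: sumable_le (sumableZ K0 (fibre_energy_ge0 th2 s2 f) sf) => x.
  exact: hK.
apply: sumable_le (sumableZ D0 w0 sf) => x; exact: hD.
Qed.

End TensorDomain.

(** The side conditions exclude degenerate cases: if [V1] is finite or [G2] has one vertex, both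
    form domains are all of [l2 m] whatever the holonomy; if [V1] is finite, the resolvent is always
    compact. *)
Theorem mainTheorem3 (R : realType) (V1 V2 : countType)
    (G1 : wgraph R V1) (G2 : wgraph R V2)
    (th1 : potential G1) (th2 : potential G2)
    (I : set V2) (I0 : I !=set0) (o : V1) :
  discrete_cusp th1 o G2 ->
  let G := prod_graph G1 G2 I0 in
  let th := prod_potential I0 th1 th2 in
  let m := weight G in
  let m1 := weight G1 in
  let m2 := weight G2 in
  let formdom_lap := sqrt_dom m (laplacian th) in
  let formdom_deg := op_dom (mult_op m (fun p => Num.sqrt (deg G p))) in
  (hol_zero th2 ->
    formdom_lap =
    op_dom (op_tensor m1 m2
      (mult_op m1 (fun x => (Num.sqrt (m1 x))^-1))
      (orth_proj m2 (orth m2 (op_ker (laplacian th2)))))) /\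
  (infinite_set [set: V1] ->
    ((exists y y' : V2, y <> y') ->
      (hol_zero th2 -> formdom_lap <> formdom_deg) /\
      (formdom_lap = formdom_deg <-> ~ hol_zero th2)) /\
    (~ hol_zero th2 <-> compact_resolvent m (laplacian th))).
Proof.
move=> [vanish finV2 bd] G th m m1 m2 formdom_lap formdom_deg.
have [s /esym es] := (finite_seqP _).1 finV2.
pose s2 := undup s.
have us2 : uniq s2 by exact: undup_uniq.
have s2V y : y \in s2.
  rewrite mem_undup; have : [set` s] y by rewrite es.
  by [].
have [C1 C1_ge0 degC1] := degree_bound bd.
have lapE : formdom_lap = form_dom th by exact: sqrt_dom_laplacian.
have [y0 _] := I0.
split.
  move=> hol; rewrite lapE.
  have [phi [phi1 phi_par [C C0 hC]]] := parallel_section s2V y0 hol.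
  apply/seteqP; split=> f.
    exact: (form_dom_tensor th1 I0 us2 s2V C1_ge0 degC1 y0 phi1 phi_par C0 hC f).1.
  exact: (form_dom_tensor th1 I0 us2 s2V C1_ge0 degC1 y0 phi1 phi_par C0 hC f).2.
move=> infV1.
have [g [g_inj g_small]] := sparse_sequence vanish infV1.
split.
  move=> zz.
  have degE f : formdom_deg f <-> l2 m f /\ sumable (fun p => sqc (f p)).
    exact: (degree_dom_sqc I0 us2 s2V C1_ge0 degC1 f zz).
  have neq : hol_zero th2 -> formdom_lap <> formdom_deg.
    move=> hol e; have [phi [phi1 phi_par _]] := parallel_section s2V y0 hol.
    have [f ff nf] := form_dom_not_degree_dom th1 I0 us2 s2V C1_ge0 degC1
      phi1 phi_par g_inj g_small.
    by apply: nf; apply/degE; rewrite -e lapE.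
  split=> //; split=> [e hol|hol]; first exact: neq hol e.
  (* Both domains are the functions of [l2 m] with finite unweighted square sum. *)
  rewrite lapE; apply/seteqP; split=> f.
    by move=> /(form_dom_sqc th1 I0 us2 s2V C1_ge0 degC1 f hol)/degE.
  by move=> /degE/(form_dom_sqc th1 I0 us2 s2V C1_ge0 degC1 f hol).
split=> [hol|cR hol].
  exact: (holonomy_compact_resolvent th1 I0 us2 s2V vanish hol).
have [phi [phi1 phi_par _]] := parallel_section s2V y0 hol.
exact: (trivial_holonomy_not_compact us2 s2V phi1 phi_par g_inj bd cR).
Qed.
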